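(* Let $\ell_1,\ell_2\in\mathbb Z_{>0}$. For $x\in B'_{\ell_1}$, $y\in B'_{\ell_2}$ define $(x',y')$ by the piecewise linear formulas $$\begin{aligned} &x_1'=y_1+V_0^{\sigma_1}-V_1,\quad \bar x_1'=\bar y_1+V_0-V_1,\\ &x_i'=y_i+V_{i-1}+W_i-V_i-W_{i-1},\quad \bar x_i'=\bar y_i+V_{i-1}-V_i\quad(2\le i\le n-1),\\ &x_n'=y_n+V_{n-1}-V_{n-1}^*,\\ &y_1'=x_1+V_0-V_1^*,\quad \bar y_1'=\bar x_1+V_0^{\sigma_1}-V_1^*,\\ &y_i'=x_i+V_{i-1}^*-V_i^*,\quad \bar y_i'=\bar x_i+V_{i-1}^*+W_i-V_i^*-W_{i-1}\quad(2\le i\le n-1),\\ &y_n'=x_n+V_{n-1}^*-V_{n-1}, \end{aligned}$$ with $V_i=V_i(x,y)$, $W_i=W_i(x,y)$ as defined in the context. Then $(x,y)\mapsto(x',y')$ is the combinatorial $R$: $B'_{\ell_1}\otimes B'_{\ell_2}\to B'_{\ell_2}\otimes B'_{\ell_1}$ (in particular $(x',y')\in B'_{\ell_2}\otimes B'_{\ell_1}$).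
   Context: Let $n\ge4$ and $(t)_+=\max(t,0)$. **The crystal $B'_l$.** For $l\in\mathbb Z_{>0}$, $B'_l$ is the set of $x=(x_1,\dots,x_n,\bar x_{n-1},\dots,\bar x_1)\in\mathbb Z^{2n-1}$ with $x_i,\bar x_i\ge0$ ($1\le i\le n-1$), $x_n\ge-\min(x_{n-1},\bar x_{n-1})$ and $\sum_{i=1}^{n-1}(x_i+\bar x_i)+x_n=l$. It carries $\varepsilon_0(x)=x_1+(x_2-\bar x_2)_+$, $\varphi_0(x)=\bar x_1+(\bar x_2-x_2)_+$; $\varepsilon_i(x)=\bar x_i+(x_{i+1}-\bar x_{i+1})_+$, $\varphi_i(x)=x_i+(\bar x_{i+1}-x_{i+1})_+$ ($1\le i\le n-2$); $\varepsilon_{n-1}(x)=x_n+\bar x_{n-1}$, $\varphi_{n-1}(x)=x_{n-1}$; $\varepsilon_n(x)=\bar x_{n-1}$, $\varphi_n(x)=x_{n-1}+x_n$. For $c\in\mathbb Z$ and $\xi_i=\max(x_i,\bar x_i+c)-\max(x_i,\bar x_i)$, the operator $\tilde e_i^c$ changes only the listed coordinates: $\tilde e_0^c$: $x_1\mapsto x_1-\xi_2$, $x_2\mapsto x_2+\xi_2-c$, $\bar x_2\mapsto\bar x_2+\xi_2$, $\bar x_1\mapsto\bar x_1-\xi_2+c$; $\tilde e_i^c$ ($1\le i\le n-2$): $x_i\mapsto x_i-\xi_{i+1}+c$, $x_{i+1}\mapsto x_{i+1}+\xi_{i+1}-c$, $\bar x_{i+1}\mapsto\bar x_{i+1}+\xi_{i+1}$,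 $\bar x_i\mapsto\bar x_i-\xi_{i+1}$; $\tilde e_{n-1}^c$: $x_{n-1}\mapsto x_{n-1}+c$, $x_n\mapsto x_n-c$; $\tilde e_n^c$: $x_n\mapsto x_n+c$, $\bar x_{n-1}\mapsto\bar x_{n-1}-c$. If the result is not in $B'_l$, then $\tilde e_i^c(x):=0$ (for $c<0$, $\tilde e_i^c$ means $\tilde f_i^{-c}$). **Tensor products.** $B'_l\otimes B'_k$ is the set of pairs $x\otimes y=(x,y)$, $x\in B'_l$, $y\in B'_k$, with $\tilde e_i^c(x\otimes y)=\tilde e_i^{c_1}(x)\otimes\tilde e_i^{c_2}(y)$, where $c_1=\max(c+\varphi_i(x),\varepsilon_i(y))-\max(\varphi_i(x),\varepsilon_i(y))$ and $c_2=\max(\varphi_i(x),\varepsilon_i(y))-\max(\varphi_i(x),-c+\varepsilon_i(y))$ (and $0$ if a factor is $0$). **Combinatorial $R$.** It is the bijection $R:B'_l\otimes B'_k\to B'_k\otimes B'_l$ commuting with all $\tilde e_i^c$ ($0\le i\le n$, $c\in\mathbb Z$). It is uniquely characterized by: (i) $R((l,0,\dots,0),(k,0,\dots,0))=((k,0,\dots,0),(l,0,\dots,0))$; (ii) $R\tilde e_i^c(x,y)=\tilde e_i^cR(x,y)$ whenever $(x,y),\tilde e_i^c(x,y)\in B'_l\otimes B'_k$. **The functions $V_i,W_i$.** Put $\ell(x)=\sum_{k=1}^nx_k+\sum_{k=1}^{n-1}\bar x_k$, likewise $\ell(y)$; empty sums are $0$. For a function $F$ of $(x,y)$: $F^{\sigma_1}$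 is obtained by exchanging $x_1\leftrightarrow\bar x_1$, $y_1\leftrightarrow\bar y_1$; $F^*$ by exchanging $x_i\leftrightarrow\bar y_i$, $\bar x_i\leftrightarrow y_i$ ($1\le i\le n-1$), $x_n\leftrightarrow y_n$. For $0\le i\le n-1$, $$V_i=\max\big(\{\theta_{i,j},\theta'_{i,j}\mid1\le j\le n-2\}\cup\{\eta_{i,j},\eta'_{i,j}\mid1\le j\le n\}\big),$$ $\theta_{i,j}=\ell(x)+\sum_{k=j+1}^i(\bar y_k-\bar x_k)$ for $1\le j\le i$, and $\theta_{i,j}=\ell(y)+\sum_{k=i+1}^j(\bar x_k-\bar y_k)$ for $i+1\le j\le n-2$; $\theta'_{i,j}=\ell(x)+\sum_{k=1}^i(\bar y_k-\bar x_k)+\sum_{k=1}^j(y_k-x_k)$ for $1\le j\le n-2$; $\eta_{i,j}=\ell(x)+\sum_{k=j+1}^i(\bar y_k-\bar x_k)+(\bar y_j-x_j)$ for $1\le j\le i$; $\eta_{i,j}=\ell(y)+\sum_{k=i+1}^j(\bar x_k-\bar y_k)+(\bar y_j-x_j)$ for $i+1\le j\le n-1$; $\eta_{i,n}=\ell(y)+\sum_{k=i+1}^{n-1}(\bar x_k-\bar y_k)+x_n$; $\eta'_{i,j}=\ell(x)+\sum_{k=1}^i(\bar y_k-\bar x_k)+\sum_{k=1}^j(y_k-x_k)+(x_j-\bar y_j)$ for $1\le j\le n-1$; $\eta'_{i,n}=\ell(x)+\delta_{i,n-1}(\ell(x)-\ell(y))+\sum_{k=1}^i(\bar y_k-\bar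 x_k)+\sum_{k=1}^{n-1}(y_k-x_k)-x_n$. $W_1=V_0+V_0^{\sigma_1}$; $W_{n-1}=V_{n-1}+V_{n-1}^*$; $W_i=\max(V_i+V_{i-1}^*-y_i,\;V_{i-1}+V_i^*-\bar x_i)+\min(x_i,\bar y_i)$ for $2\le i\le n-2$. *)

(* Defs.v *)
From mathcomp Require Import all_boot all_order all_algebra.

Set Implicit Arguments.
Unset Strict Implicit.
Unset Printing Implicit Defensive.

Import Order.TTheory GRing.Theory Num.Theory.
Local Open Scope ring_scope.

(* A point (x_1, ..., x_n, xbar_{n-1}, ..., xbar_1) of Z^(2n-1) is stored as
   the pair ((x_1, ..., x_n), (xbar_1, ..., xbar_{n-1})). *)
Definition vec (n : nat) : Type := (n.-tuple int * n.-1.-tuple int)%type.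

(* Indices are 1-based: coord x i is x_i (1 <= i <= n) and bcoord x i is
   xbar_i (1 <= i <= n-1).  Other indices return a junk value and never occur
   in a meaningful way below. *)
Definition coord n (x : vec n) (i : nat) : int := nth 0 x.1 i.-1.
Definition bcoord n (x : vec n) (i : nat) : int := nth 0 x.2 i.-1.

Definition mkvec n (a b : nat -> int) : vec n :=
  ([tuple a k.+1 | k < n], [tuple b k.+1 | k < n.-1]).

Lemma coord_mkvec n (a b : nat -> int) i :
  (0 < i <= n)%N -> coord (mkvec n a b) i = a i.
Proof.
case: i => [|i] //= lt_in.
by rewrite /coord /= -[i]/(val (Ordinal lt_in)) nth_mktuple.
Qed.

Lemma bcoord_mkvec n (a b : nat -> int) i :
  (0 < i < n)%N -> bcoord (mkvec n a b) i = b i.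
Proof.
case: i n => [|i] [|n] //= lt_in.
rewrite ltnS in lt_in.
by rewrite /bcoord /= -[i]/(val (Ordinal lt_in)) nth_mktuple.
Qed.

Definition posp (t : int) : int := Num.max t 0.

Definition in_crystal n (l : nat) (x : vec n) : bool :=
  [&& all (fun i => (0 <= coord x i) && (0 <= bcoord x i)) (index_iota 1 n),
      - Num.min (coord x n.-1) (bcoord x n.-1) <= coord x n
    & \sum_(1 <= i < n) (coord x i + bcoord x i) + coord x n == l%:Z].

(* B'_l *)
Definition crystal n (l : nat) : Type := {x : vec n | in_crystal l x}.

Definition eps n (i : nat) (x : vec n) : int :=
  if i == 0%N then coord x 1 + posp (coord x 2 - bcoord x 2)
  else if i == n.-1 then coord x n + bcoord x n.-1
  else if i == n then bcoord x n.-1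
  else bcoord x i + posp (coord x i.+1 - bcoord x i.+1).

Definition phi n (i : nat) (x : vec n) : int :=
  if i == 0%N then bcoord x 1 + posp (bcoord x 2 - coord x 2)
  else if i == n.-1 then coord x n.-1
  else if i == n then coord x n.-1 + coord x n
  else coord x i + posp (bcoord x i.+1 - coord x i.+1).

Definition xi n (c : int) (x : vec n) (i : nat) : int :=
  Num.max (coord x i) (bcoord x i + c) - Num.max (coord x i) (bcoord x i).

(* The formula for e_i^c on Z^(2n-1), before the test for membership in B'_l *)
Definition e_vec n (i : nat) (c : int) (x : vec n) : vec n :=
  if i == 0%N then
    mkvec n
      (fun j => if j == 1%N then coord x 1 - xi c x 2
                else if j == 2%N then coord x 2 + xi c x 2 - c
                else coord x j)
      (fun j => if j == 1%N then bcoord x 1 - xi c x 2 + c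
                else if j == 2%N then bcoord x 2 + xi c x 2
                else bcoord x j)
  else if i == n.-1 then
    mkvec n
      (fun j => if j == n.-1 then coord x n.-1 + c
                else if j == n then coord x n - c
                else coord x j)
      (bcoord x)
  else if i == n then
    mkvec n
      (fun j => if j == n then coord x n + c else coord x j)
      (fun j => if j == n.-1 then bcoord x n.-1 - c else bcoord x j)
  else
    mkvec n
      (fun j => if j == i then coord x i - xi c x i.+1 + c
                else if j == i.+1 then coord x i.+1 + xi c x i.+1 - c
                else coord x j)
      (fun j => if j == i then bcoord x i - xi c x i.+1
                else if j == i.+1 then bcoord x i.+1 + xi c x i.+1
                else bcoord x j).

(* e_i^c on B'_l, where None plays the role of the element 0 adjoined to the
   crystal; for c < 0 this is f_i^{-c}. *)
Definition e_op n l (i : nat) (c : int) (x : crystal n l) :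
    option (crystal n l) :=
  insub (e_vec i c (val x)).

Definition tensor n (l k : nat) : Type := (crystal n l * crystal n k)%type.

Definition e_tensor n l k (i : nat) (c : int) (p : tensor n l k) :
    option (tensor n l k) :=
  let f := phi i (val p.1) in
  let g := eps i (val p.2) in
  let c1 := Num.max (c + f) g - Num.max f g in
  let c2 := Num.max f g - Num.max f (- c + g) in
  match e_op i c1 p.1, e_op i c2 p.2 with
  | Some x, Some y => Some (x, y)
  | _, _ => None
  end.

(* (l, 0, ..., 0) *)
Definition hw_vec n (l : nat) : vec n :=
  mkvec n (fun i => if i == 1%N then l%:Z else 0) (fun=> 0).

(* The membership of (l, 0, ..., 0) in B'_l makes R_normalized below a
   non-vacuous condition. *)
Lemma hw_vec_in_crystal n l : (4 <= n)%N -> in_crystal l (hw_vec n l).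
Proof.
move=> n4; have n1 : (1 < n)%N by apply: leq_trans n4.
have nz : (n == 1%N) = false by case: n n4 n1 => [|[|]].
have n1z : (n.-1 == 1%N) = false by case: n n4 n1 nz => [|[|[|]]].
have cE i : (0 < i <= n)%N ->
    coord (hw_vec n l) i = if i == 1%N then l%:Z else 0.
  exact: coord_mkvec.
have bE i : (0 < i < n)%N -> bcoord (hw_vec n l) i = 0.
  exact: bcoord_mkvec.
have hn1 : (0 < n.-1 < n)%N by case: n n4 {n1 nz n1z cE bE} => [|[|]] //=.
have hn1' : (0 < n.-1 <= n)%N by case/andP: hn1 => -> /ltnW.
have hn : (0 < n <= n)%N by rewrite leqnn andbT ltnW.
apply/and3P; split.
- apply/allP => i; rewrite mem_index_iota => hi.
  rewrite bE // cE; last by case/andP: hi => -> /ltnW.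
  by rewrite lexx andbT; case: ifP.
- by rewrite !cE // bE // nz n1z minxx oppr0.
- rewrite cE // nz addr0 big_ltn // big_nat_cond big1 ?addr0.
    by rewrite cE ?bE // ?addr0 //; case: n n1 {n4 nz n1z cE bE hn1 hn1' hn}.
  move=> i; rewrite andbT => /andP[lt1i lti].
  have hi : (0 < i < n)%N by rewrite (ltnW lt1i).
  rewrite bE // cE; last by rewrite (ltnW lt1i) ltnW.
  by case: (i =P 1%N) lt1i => [->|].
Qed.

Definition R_commutes n l k (R : tensor n l k -> tensor n k l) : Prop :=
  forall (i : nat) (c : int) (p : tensor n l k), (i <= n)%N ->
    e_tensor i c (R p) = omap R (e_tensor i c p).

Definition R_normalized n l k (R : tensor n l k -> tensor n k l) : Prop :=
  forall p : tensor n l k,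
    val p.1 = hw_vec n l -> val p.2 = hw_vec n k ->
    val (R p).1 = hw_vec n k /\ val (R p).2 = hw_vec n l.

(* Compared with R_commutes, nothing is required where e_i^c p = 0. *)
Definition R_intertwines n l k (R : tensor n l k -> tensor n k l) : Prop :=
  forall (i : nat) (c : int) (p q : tensor n l k), (i <= n)%N ->
    e_tensor i c p = Some q -> e_tensor i c (R p) = Some (R q).

(* The last clause makes R the only map with the two characterizing
   properties, hence justifies the definite article. *)
Definition is_combinatorial_R n l k (R : tensor n l k -> tensor n k l) :
    Prop :=
  [/\ bijective R, R_commutes R, R_normalized R
    & forall R' : tensor n l k -> tensor n k l,
        R_normalized R' -> R_intertwines R' -> R' =1 R].

Definition ell n (x : vec n) : int :=
  \sum_(1 <= k < n.+1) coord x k + \sum_(1 <= k < n) bcoord x k.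

Definition swap1 n (x : vec n) : vec n :=
  mkvec n (fun i => if i == 1%N then bcoord x 1 else coord x i)
          (fun i => if i == 1%N then coord x 1 else bcoord x i).

Definition bar_swap n (x : vec n) : vec n :=
  mkvec n (fun i => if i == n then coord x n else bcoord x i) (coord x).

Definition sigma1 n (F : vec n -> vec n -> int) : vec n -> vec n -> int :=
  fun x y => F (swap1 x) (swap1 y).

Definition star n (F : vec n -> vec n -> int) : vec n -> vec n -> int :=
  fun x y => F (bar_swap y) (bar_swap x).

(* The maximum of a nonempty sequence *)
Definition max_seq (s : seq int) : int := foldr Num.max (head 0 s) (behead s).

Section Functions.
Variable n : nat.
Implicit Types (x y : vec n) (i j : nat).

Definition theta i j x y : int :=
  if (j <= i)%N then
    ell x + \sum_(j.+1 <= k < i.+1) (bcoord y k - bcoord x k)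
  else
    ell y + \sum_(i.+1 <= k < j.+1) (bcoord x k - bcoord y k).

Definition theta' i j x y : int :=
  ell x + \sum_(1 <= k < i.+1) (bcoord y k - bcoord x k)
        + \sum_(1 <= k < j.+1) (coord y k - coord x k).

Definition eta i j x y : int :=
  if j == n then
    ell y + \sum_(i.+1 <= k < n) (bcoord x k - bcoord y k) + coord x n
  else if (j <= i)%N then
    ell x + \sum_(j.+1 <= k < i.+1) (bcoord y k - bcoord x k)
          + (bcoord y j - coord x j)
  else
    ell y + \sum_(i.+1 <= k < j.+1) (bcoord x k - bcoord y k)
          + (bcoord y j - coord x j).

Definition eta' i j x y : int :=
  if j == n then
    ell x + (if i == n.-1 then ell x - ell y else 0)
          + \sum_(1 <= k < i.+1) (bcoord y k - bcoord x k)
          + \sum_(1 <= k < n) (coord y k - coord x k) - coord x n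
  else
    ell x + \sum_(1 <= k < i.+1) (bcoord y k - bcoord x k)
          + \sum_(1 <= k < j.+1) (coord y k - coord x k)
          + (coord x j - bcoord y j).

Definition V i x y : int :=
  max_seq ([seq theta i j x y | j <- index_iota 1 n.-1] ++
           [seq theta' i j x y | j <- index_iota 1 n.-1] ++
           [seq eta i j x y | j <- index_iota 1 n.+1] ++
           [seq eta' i j x y | j <- index_iota 1 n.+1]).

Definition W i x y : int :=
  if i == 1%N then V 0 x y + sigma1 (V 0) x y
  else if i == n.-1 then V n.-1 x y + star (V n.-1) x y
  else Num.max (V i x y + star (V i.-1) x y - coord y i)
               (V i.-1 x y + star (V i) x y - bcoord x i)
       + Num.min (coord x i) (bcoord y i).

Definition R_fst x y : vec n :=
  mkvec n
    (fun i => if i == 1%N then coord y 1 + sigma1 (V 0) x y - V 1 x y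
              else if i == n then
                coord y n + V n.-1 x y - star (V n.-1) x y
              else coord y i + V i.-1 x y + W i x y - V i x y - W i.-1 x y)
    (fun i => if i == 1%N then bcoord y 1 + V 0 x y - V 1 x y
              else bcoord y i + V i.-1 x y - V i x y).

Definition R_snd x y : vec n :=
  mkvec n
    (fun i => if i == 1%N then coord x 1 + V 0 x y - star (V 1) x y
              else if i == n then
                coord x n + star (V n.-1) x y - V n.-1 x y
              else coord x i + star (V i.-1) x y - star (V i) x y)
    (fun i => if i == 1%N then
                bcoord x 1 + sigma1 (V 0) x y - star (V 1) x y
              else bcoord x i + star (V i.-1) x y + W i x y
                   - star (V i) x y - W i.-1 x y).

End Functions.

(* Main.v *)
Require Import Defs.
From mathcomp Require Import all_boot all_order all_algebra.
From mathcomp Require Import ring zify.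
Import Defs.

Set Implicit Arguments.
Unset Strict Implicit.
Unset Printing Implicit Defensive.

Import Order.TTheory GRing.Theory Num.Theory.
Local Open Scope ring_scope.

(** All the maps of the statement are max-plus formulas, obtained from
rational formulas without subtraction by replacing (+, *, /) with
(max, +, -).  The identities behind the theorem are hard to see on the
max-plus side, but they become short computations for positive elements of an
ordered field, where subtraction is available.  The proof therefore works with
positive rational points first, and transfers the result by comparing rates of
growth: if every coordinate of a positive point behaves like T ^ a, up to
constant factors, as T grows, then the value of a subtraction-free rational
function behaves like T raised to its max-plus version evaluated at the
exponents a (growthD, growthM, growthV), and the exponent is determined by the
function (growth_unique).

On the rational side write P_i for the product of xb_k / yb_k over k <= i, and
D for ell x - ell y.  The functions V_i satisfy the linear recursion
V_i = (yb_i / xb_i) V_(i-1) + D (1 + yb_i / x_i), modified at i = n - 1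
(gU_rec), the function V_0 is fixed by the anti-involution star, and V_(n-1)
and its image by star are linked by one more linear relation (gV_closing).
Writing V'_i for the image of V_i by star, these relations give
W_i = V_i V'_i + D (V_i - V'_i), which replaces the definition of W_i by cases
(gW, gW_mid, gW_1, gW_last).

Fix a node i with 1 <= i <= n - 1.  Two positive points are on the same orbit
of e_i if and only if they agree on explicit invariants (norbit,
norbit_unique), and for a tensor product x (x) y the only further invariant is
1 / phi_i(x) + 1 / eps_i(y), while phi_i(x) / eps_i(y) is multiplied by c
(rank_one_unique).  All functions V_j and W_j with j <> i are constant on such
an orbit, since the terms of the sums defining them change only at two
neighbouring indices, whose total is an invariant.  Combined with three
identities in the coordinates of index i and i + 1 (local_S1, local_S2,
local_sum), this shows that R maps orbits to orbits, compatibly with c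
(gR_norbit2); so R commutes with e_i, and it preserves the lengths eps_i and
phi_i of the strings of the tensor product (gR_eps, gR_phi).  The node n - 1,
where the invariants have another shape, is treated in the same way.  The nodes
0 and n are deduced from the nodes 1 and n - 1 by the symmetries
x_1 <-> xb_1 and star, which R respects.

The remaining assertions follow from the connectedness of the tensor product
(tensor_connected) and from the computation of R at the pair of highest
elements (R_hw).  Since e_i^c p stays in the crystal exactly when
- phi_i(p) <= c <= eps_i(p), membership of R p propagates along the arrows; so
do the equation R (R p) = p and the equality of R with any other map having
the characterizing properties. *)

(** * Maxima of sequences and rates of growth *)

Lemma foldr_max_init (a b : int) s :
  foldr Num.max (Num.max a b) s = Num.max a (foldr Num.max b s).
Proof. by elim: s => //= c s ->; rewrite maxCA. Qed.

Lemma max_seq_cons (a : int) s :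
  s != [::] -> max_seq (a :: s) = Num.max a (max_seq s).
Proof.
by case: s => //= b s _; rewrite /max_seq /= -!foldr_max_init maxC.
Qed.

Lemma max_seq_cat (s1 s2 : seq int) : s1 != [::] -> s2 != [::] ->
  max_seq (s1 ++ s2) = Num.max (max_seq s1) (max_seq s2).
Proof.
elim: s1 => //= a [|b s] IH _ s2n; first by rewrite cat0s max_seq_cons.
rewrite cat_cons [LHS]max_seq_cons // IH // [max_seq [:: a, b & s]]max_seq_cons //.
by rewrite maxA.
Qed.

(** The constants are required to work for all T = t + 1 at once, and not only
for large T, so that a function of some growth is positive everywhere. *)
Definition growth (f : nat -> rat) (k : int) : Prop :=
  exists2 C : rat, 0 < C &
    forall t, C^-1 * t.+1%:R ^ k <= f t <= C * t.+1%:R ^ k.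

Lemma growth_ext f g k : f =1 g -> growth f k -> growth g k.
Proof. by move=> fg [C C0 h]; exists C => // t; rewrite -fg. Qed.

Lemma growth_eq f k l : growth f k -> k = l -> growth f l.
Proof. by move=> ? <-. Qed.

Lemma growth_gt0 f k t : growth f k -> 0 < f t.
Proof.
move=> [C C0 /(_ t)/andP[h _]]; apply: lt_le_trans h.
by rewrite mulr_gt0 ?invr_gt0 // exprz_gt0.
Qed.

Lemma growth_le f k l : growth f k -> growth f l -> k <= l.
Proof.
move=> [C C0 hC] [B B0 hB]; rewrite leNgt; apply/negP => lt_lk.
pose M := B * C; have M0 : 0 < M by rewrite mulr_gt0.
set t := Num.bound M.
have Mt : M < t.+1%:R :> rat.
  apply: lt_trans (_ : t%:R < _); last by rewrite ltr_nat.
  by have := archi_boundP (ltW M0).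
have T0 : 0 < t.+1%:R :> rat by rewrite ltr0n.
have T1 : 1 <= t.+1%:R :> rat by rewrite ler1n.
have /andP[h1 _] := hC t; have /andP[_ h2] := hB t.
have h := le_trans h1 h2.
have e : t.+1%:R ^ k = t.+1%:R ^ (k - l) * t.+1%:R ^ l :> rat.
  by rewrite -expfzDr ?gt_eqF // subrK.
move: h; rewrite e mulrA ler_pM2r ?exprz_gt0 // mulrC ler_pdivrMr // => h.
have /(lt_le_trans Mt) : t.+1%:R <= t.+1%:R ^ (k - l) :> rat.
  by rewrite -{1}(expr1z t.+1%:R) ler_weXz2l //; lia.
by rewrite ltNge h.
Qed.

Lemma growth_unique f k l : growth f k -> growth f l -> k = l.
Proof.
by move=> fk fl; apply/le_anti; rewrite (growth_le fk fl) (growth_le fl fk).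
Qed.

Lemma growth_lift k : growth (fun t => t.+1%:R ^ k) k.
Proof. by exists 1 => // t; rewrite invr1 mul1r lexx. Qed.

Lemma growth1 : growth (fun=> 1) 0.
Proof. exact: growth_lift 0. Qed.

(** Both summands are positive, so no cancellation can lower the exponent. *)
Lemma growthD f g k l :
  growth f k -> growth g l -> growth (fun t => f t + g t) (Num.max k l).
Proof.
move=> fk gl; wlog le_kl : f g k l fk gl / k <= l => [IH|].
  case/orP: (le_total k l) => [/IH|lk]; first exact.
  rewrite maxC; apply: (@growth_ext (fun t => g t + f t)) (IH _ _ _ _ gl fk lk).
  by move=> t; rewrite addrC.
rewrite max_r //; have gt0 t := growth_gt0 t gl; have ft0 t := growth_gt0 t fk.
case: fk gl => [B B0 hB] [C C0 hC]; exists (B + C) => [|t]; first exact: addr_gt0.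
have /andP[_ h1] := hB t; have /andP[h2 h3] := hC t.
have T0 : 0 < t.+1%:R :> rat by rewrite ltr0n.
have T1 : 1 <= t.+1%:R :> rat by rewrite ler1n.
apply/andP; split.
  apply: le_trans (_ : g t <= _); last by rewrite lerDr ltW.
  apply: le_trans h2; rewrite ler_pM2r ?exprz_gt0 // lef_pV2 ?qualifE //=.
    by rewrite lerDr ltW.
  exact: addr_gt0.
rewrite mulrDl lerD //; apply: le_trans h1 _.
by rewrite ler_pM2l // ler_weXz2l.
Qed.

Lemma growthM f g k l :
  growth f k -> growth g l -> growth (fun t => f t * g t) (k + l).
Proof.
move=> fk gl; have gt0 t := growth_gt0 t gl; have ft0 t := growth_gt0 t fk.
case: fk gl => [B B0 hB] [C C0 hC]; exists (B * C) => [|t]; first exact: mulr_gt0.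
have /andP[h0 h1] := hB t; have /andP[h2 h3] := hC t.
have T0 : 0 < t.+1%:R :> rat by rewrite ltr0n.
rewrite expfzDr ?gt_eqF // invfM mulrACA [B * C * _]mulrACA.
by rewrite !ler_pM // ?mulr_ge0 ?invr_ge0 ?exprz_ge0 // ltW.
Qed.

Lemma growthV f k : growth f k -> growth (fun t => (f t)^-1) (- k).
Proof.
move=> fk; have ft0 t := growth_gt0 t fk.
case: fk => [B B0 hB]; exists B => // t.
have /andP[h0 h1] := hB t.
have T0 : 0 < t.+1%:R :> rat by rewrite ltr0n.
have Tk : 0 < t.+1%:R ^ k :> rat by rewrite exprz_gt0.
rewrite -invr_expz -invfM -[B in _ && (_ <= B * _)]invrK -invfM.
by rewrite !lef_pV2 ?qualifE //= ?mulr_gt0 ?invr_gt0 // h0 h1.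
Qed.

Lemma growth_div f g k l :
  growth f k -> growth g l -> growth (fun t => f t / g t) (k - l).
Proof. by move=> fk gl; apply: growthM fk (growthV gl). Qed.

Lemma growth_prod (r : seq nat) f (a : nat -> int) :
  (forall j, j \in r -> growth (f^~ j) (a j)) ->
  growth (fun t => \prod_(j <- r) f t j) (\sum_(j <- r) a j).
Proof.
elim: r => [|j r IH] h.
  by rewrite big_nil; apply: growth_ext growth1 => t; rewrite big_nil.
rewrite big_cons; apply: (@growth_ext (fun t => f t j * \prod_(j <- r) f t j)).
  by move=> t; rewrite big_cons.
apply: growthM; first by apply: h; rewrite mem_head.
by apply: IH => k kr; apply: h; rewrite in_cons kr orbT.
Qed.

Lemma growth_sum (r : seq nat) f (a : nat -> int) :
  r != [::] -> (forall j, j \in r -> growth (f^~ j) (a j)) ->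
  growth (fun t => \sum_(j <- r) f t j) (max_seq [seq a j | j <- r]).
Proof.
elim: r => // j [|k r] IH _ h.
  apply: (@growth_ext (fun t => f t j)) => [t|]; first by rewrite big_seq1.
  by apply: h; rewrite mem_head.
rewrite map_cons max_seq_cons //.
apply: (@growth_ext (fun t => f t j + \sum_(j <- k :: r) f t j)).
  by move=> t; rewrite [RHS]big_cons.
apply: growthD; first by apply: h; rewrite mem_head.
by apply: IH => // i ir; apply: h; rewrite in_cons ir orbT.
Qed.

(** * The rational versions of ell, V and star *)

(** The form in which the invariance of sums and products under e_i is used:
only the terms of index i and i + 1 may change. *)
Lemma eq_big_nat2 (T : Type) (idx : T) (op : Monoid.com_law idx) (i a b : nat)
    (f g : nat -> T) :
  (a <= i)%N -> (i.+1 < b)%N ->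
  (forall j, (a <= j < b)%N -> j != i -> j != i.+1 -> f j = g j) ->
  op (f i) (f i.+1) = op (g i) (g i.+1) ->
  \big[op/idx]_(a <= j < b) f j = \big[op/idx]_(a <= j < b) g j.
Proof.
move=> ai ib fg fgi.
have split2 (h : nat -> T) : \big[op/idx]_(a <= j < b) h j =
    op (\big[op/idx]_(a <= j < i) h j)
       (op (op (h i) (h i.+1)) (\big[op/idx]_(i.+2 <= j < b) h j)).
  have [ib1 i1b] : (i <= b)%N /\ (i < b)%N by lia.
  rewrite (big_cat_nat (n := i)) //= (big_ltn (m := i)) //.
  by rewrite (big_ltn (m := i.+1)) // -!Monoid.mulmA.
rewrite !split2 fgi; congr (op _ (op _ _)).
  by apply: eq_big_nat => j hj; apply: fg; lia.
by apply: eq_big_nat => j hj; apply: fg; lia.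
Qed.

Section Geometric.
Variables (F : realFieldType) (m : nat).

(** A pair of sequences x_k and xb_k; only the indices 1 <= k <= m + 1 = n of the
first and 1 <= k <= m of the second are meaningful. *)
Definition gvec : Type := ((nat -> F) * (nat -> F))%type.
Implicit Types (x y X Y : gvec) (i j k : nat).

Definition gpos x := forall k, 0 < x.1 k /\ 0 < x.2 k.

(** The involution bar_swap; the action on pairs exchanges the factors as well,
(x, y) |-> (gstar y, gstar x). *)
Definition gstar x : gvec :=
  (fun k => if k == m.+1 then x.1 k else x.2 k, x.1).

Definition gell x : F :=
  \prod_(1 <= k < m.+1) x.1 k * \prod_(1 <= k < m.+1) x.2 k * x.1 m.+1.

(** Every product occurring in the V_i is a quotient of two of these, or of two
of their images by star. *)
Definition gP x y i : F := \prod_(1 <= k < i.+1) (x.2 k / y.2 k).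

Definition gE x y : F :=
  \prod_(1 <= k < m.+1) x.2 k * \prod_(1 <= k < m.+1) y.1 k.

(** The term 1 comes from theta_(i,j), which exists for j < m only, and
yb_j / x_j comes from eta_(i,j). *)
Definition gb x y j : F := (j < m)%N%:R + y.2 j / x.1 j.

Definition gK (w : nat -> F) x y : F :=
  \sum_(1 <= j < m.+1) w j * (gP x y j * gb x y j).

(** The factor ell x or ell y of the terms theta_(i,j) and eta_(i,j). *)
Definition gw i x y j : F := if (j <= i)%N then gell x else gell y.

(** The sum of all exponentials of theta, theta', eta and eta', in a form that
shows its dependence on i: the dashed terms are the image by star of those of
V_0, and the two terms with j = n are collected in the last summand. *)
Definition gV i x y : F :=
  (gK (gw i x y) x y + gell x * gK (fun=> 1) (gstar y) (gstar x)
   + gE x y * (x.1 m.+1 * y.1 m.+1 + if i == m then gell x / gell y else 1))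
  / gP x y i.

Definition gVs i x y : F := gV i (gstar y) (gstar x).

Definition gD x y : F := gell x - gell y.

Lemma gstar_pos x : gpos x -> gpos (gstar x).
Proof. by move=> hx k; rewrite /gstar /=; case: ifP; case: (hx k). Qed.

Lemma gstar1 x k : (k < m.+1)%N -> (gstar x).1 k = x.2 k.
Proof. by rewrite /gstar /= => hk; rewrite ltn_eqF. Qed.

Lemma gstarn x : (gstar x).1 m.+1 = x.1 m.+1.
Proof. by rewrite /gstar /= eqxx. Qed.

Lemma gell_star x : gell (gstar x) = gell x.
Proof.
rewrite /gell gstarn; congr (_ * _); rewrite mulrC; congr (_ * _).
by apply: eq_big_nat => k hk; rewrite gstar1 //; lia.
Qed.

Lemma gD_star x y : gD (gstar y) (gstar x) = - gD x y.
Proof. by rewrite /gD !gell_star opprB. Qed.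

Lemma gE_star x y : gE (gstar y) (gstar x) = gE x y.
Proof.
rewrite /gE mulrC; congr (_ * _).
by apply: eq_big_nat => k hk; rewrite gstar1 //; lia.
Qed.

Lemma gP_star2 x y i : (i <= m)%N ->
  gP (gstar (gstar x)) (gstar (gstar y)) i = gP x y i.
Proof.
move=> im; apply: eq_big_nat => k hk.
by rewrite /gstar /= !ltn_eqF //; lia.
Qed.

Lemma gK_star2 w x y : gK w (gstar (gstar x)) (gstar (gstar y)) = gK w x y.
Proof.
apply: eq_big_nat => j hj; rewrite gP_star2; last by lia.
by rewrite /gb /gstar /= !ltn_eqF //; lia.
Qed.

Lemma gPS x y i : gP x y i.+1 = gP x y i * (x.2 i.+1 / y.2 i.+1).
Proof. by rewrite /gP big_nat_recr. Qed.

Lemma gP0 x y : gP x y 0 = 1.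
Proof. by rewrite /gP big_nil. Qed.

Section Positive.
Variables (x y : gvec) (xp : gpos x) (yp : gpos y).

Let x1p k : 0 < x.1 k. Proof. by case: (xp k). Qed.
Let x2p k : 0 < x.2 k. Proof. by case: (xp k). Qed.
Let y1p k : 0 < y.1 k. Proof. by case: (yp k). Qed.
Let y2p k : 0 < y.2 k. Proof. by case: (yp k). Qed.

Lemma gell_gt0 : 0 < gell x.
Proof. by rewrite /gell !mulr_gt0 // prodr_gt0. Qed.

Lemma gP_gt0 i : 0 < gP x y i.
Proof. by rewrite prodr_gt0 // => k _; rewrite divr_gt0. Qed.

Lemma gE_gt0 : 0 < gE x y.
Proof. by rewrite mulr_gt0 ?prodr_gt0. Qed.

Lemma gb_gt0 j : 0 < gb x y j.
Proof. by rewrite ltr_wpDl ?ler0n ?divr_gt0. Qed.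

Lemma gK_ge0 w : (forall j, 0 <= w j) -> 0 <= gK w x y.
Proof.
move=> w0; apply: sumr_ge0 => j _.
by rewrite !mulr_ge0 // ?(ltW (gP_gt0 _)) ?(ltW (gb_gt0 _)).
Qed.

End Positive.

Lemma gV_gt0 i x y : gpos x -> gpos y -> 0 < gV i x y.
Proof.
move=> xp yp; have lx := gell_gt0 xp; have ly := gell_gt0 yp.
rewrite divr_gt0 ?gP_gt0 // ltr_wpDl //.
  rewrite addr_ge0 ?gK_ge0 // => [j|]; first by rewrite /gw; case: ifP => _; apply: ltW.
  by rewrite mulr_ge0 ?(ltW lx) // gK_ge0 //; apply: gstar_pos.
have [[x0 _] [y0 _]] := (xp m.+1, yp m.+1).
rewrite mulr_gt0 ?gE_gt0 // addr_gt0 ?mulr_gt0 //.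
by case: ifP => _; rewrite ?divr_gt0.
Qed.

Lemma gVs_gt0 i x y : gpos x -> gpos y -> 0 < gVs i x y.
Proof. by move=> xp yp; apply: gV_gt0; apply: gstar_pos. Qed.

(** Together with its image by star, this relates the two families of products
P_i and star P_i. *)
Lemma gell_gP x y : gpos x -> gpos y ->
  gell y * gP x y m = y.1 m.+1 * gE x y.
Proof.
move=> xp yp; rewrite /gell /gP /gE prodf_div.
have y0 : \prod_(1 <= k < m.+1) y.2 k != 0.
  by rewrite lt0r_neq0 // prodr_gt0 // => k _; case: (yp k).
by field.
Qed.

Lemma gVs0 x y : (0 < m)%N -> gVs 0 x y = gV 0 x y.
Proof.
move=> m0; rewrite /gVs /gV !gP0 !divr1 gE_star gell_star gK_star2 !gstarn.
have K0 (z t : gvec) : gK (gw 0 z t) z t = gell t * gK (fun=> 1) z t.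
  rewrite /gK mulr_sumr; apply: eq_big_nat => j hj.
  by rewrite /gw leqn0 gtn_eqF ?mul1r //; lia.
rewrite !K0 !gell_star [X in _ = X + _]addrC; congr (_ + _ * (_ + _)).
  by rewrite mulrC.
by rewrite ltn_eqF.
Qed.

Lemma gK_step x y i : (i < m)%N ->
  gK (gw i.+1 x y) x y
  = gK (gw i x y) x y + gD x y * (gP x y i.+1 * gb x y i.+1).
Proof.
move=> im; rewrite /gK.
rewrite (bigD1_seq i.+1) ?iota_uniq ?mem_index_iota //=.
rewrite [X in _ = X + _](bigD1_seq i.+1) ?iota_uniq ?mem_index_iota //=.
rewrite {1 3}/gw leqnn ltnn /gD mulrBl addrAC -[RHS]addrA [RHS]addrC.
rewrite [X in _ + X = _](_ : _ = \sum_(1 <= j < m.+1 | j != i.+1)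
   gw i x y j * (gP x y j * gb x y j)); first by ring.
apply: eq_bigr => j ji; rewrite /gw.
by have -> : (j <= i.+1)%N = (j <= i)%N by lia.
Qed.

(** The correction makes the recursion hold for i = m in the same form as for
i < m. *)
Definition gU i x y : F :=
  gV i x y + if i == m then gD x y * (1 - (y.1 m.+1)^-1) else 0.

Definition gUs i x y : F := gU i (gstar y) (gstar x).

Lemma gU_lt i x y : (i < m)%N -> gU i x y = gV i x y.
Proof. by rewrite /gU => im; rewrite ltn_eqF // addr0. Qed.

(** Multiplied by P_i, the two sides differ only in the weight of the term of
index i + 1, which is ell x in one of them and ell y in the other. *)
Lemma gU_rec i x y : gpos x -> gpos y -> (i < m)%N ->
  gU i.+1 x y = y.2 i.+1 / x.2 i.+1 * gV i x y
                + gD x y * (1 + y.2 i.+1 / x.1 i.+1).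
Proof.
move=> xp yp im; rewrite /gU /gV gK_step // (ltn_eqF im) gPS.
have P0 := lt0r_neq0 (gP_gt0 xp yp i).
have ly := lt0r_neq0 (gell_gt0 yp).
have y0 k : y.2 k != 0 by case: (yp k) => _ /lt0r_neq0.
have y1 k : y.1 k != 0 by case: (yp k) => /lt0r_neq0.
have x0 k : x.2 k != 0 by case: (xp k) => _ /lt0r_neq0.
have x1 k : x.1 k != 0 by case: (xp k) => /lt0r_neq0.
have [im1|im1] := boolP (i.+1 == m); last first.
  rewrite /gb (_ : (i.+1 < m)%N = true); last by lia.
  rewrite /= mulr1n addr0.
  by field; rewrite ?x0 ?y0 ?x1 ?P0.
have PE := gell_gP xp yp; rewrite -(eqP im1) gPS in PE *.
rewrite /gb (eqP im1) ltnn /= mulr0n add0r.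
have -> : gE x y = gell y * (gP x y i * (x.2 m / y.2 m)) / y.1 m.+1.
  by rewrite -(eqP im1) PE; field; rewrite (eqP im1).
rewrite /gD; field.
by rewrite ?x0 ?y0 ?x1 ?P0 ?y1 ?ly.
Qed.

(** For i = m all the weights in the sum are equal, hence the sums in V_m and in
its image by star agree up to the factor given by gell_gP. *)
Lemma gV_closing x y : gpos x -> gpos y ->
  y.1 m.+1 * gV m x y + gD x y * (x.1 m.+1 * y.1 m.+1)
  = x.1 m.+1 * gVs m x y + gD x y.
Proof.
move=> xp yp; have xs := gstar_pos xp; have ys := gstar_pos yp.
rewrite /gVs /gV eqxx gE_star !gell_star gK_star2 !gstarn.
have Kw (z t : gvec) : gK (gw m z t) z t = gell z * gK (fun=> 1) z t.
  rewrite /gK mulr_sumr; apply: eq_big_nat => j hj.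
  by rewrite /gw (_ : (j <= m)%N) ?mul1r //; lia.
rewrite !Kw !gell_star.
have PE := gell_gP xp yp; have QE := gell_gP ys xs.
rewrite gE_star gell_star gstarn in QE.
have P0 := lt0r_neq0 (gP_gt0 xp yp m).
have Q0 := lt0r_neq0 (gP_gt0 ys xs m).
have ly := lt0r_neq0 (gell_gt0 yp).
have lx := lt0r_neq0 (gell_gt0 xp).
have E0 := lt0r_neq0 (gE_gt0 xp yp).
have y1 : y.1 m.+1 != 0 by case: (yp m.+1) => /lt0r_neq0.
have x1 : x.1 m.+1 != 0 by case: (xp m.+1) => /lt0r_neq0.
have -> : gP x y m = y.1 m.+1 * gE x y / gell y by rewrite -PE; field.
have -> : gP (gstar y) (gstar x) m = x.1 m.+1 * gE x y / gell x.
  by rewrite -QE; field.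
by rewrite /gD; field; rewrite ?x1 ?y1 ?E0 ?lx ?ly.
Qed.

End Geometric.

(** * The functions W *)

Section GeometricW.
Variables (F : realFieldType) (m : nat).
Implicit Types (x y X Y : gvec F) (i j k : nat).

Local Notation gV := (@gV F m).
Local Notation gVs := (@gVs F m).
Local Notation gU := (@gU F m).
Local Notation gUs := (@gUs F m).
Local Notation gD := (@gD F m).
Local Notation gstar := (@gstar F m).
Local Notation gell := (@gell F m).

(** With this formula the cases of the definition of W_i become theorems:
see gW_1, gW_mid and gW_last.  The value at 0 makes the formulas for
x'_1 and yb'_1 special cases of those for larger indices. *)
Definition gW i x y : F :=
  if i == 0%N then gV 0 x y ^+ 2
  else gU i x y * gUs i x y + gD x y * (gU i x y - gUs i x y).

Lemma gUs_rec i x y : gpos x -> gpos y -> (i < m)%N ->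
  gUs i.+1 x y = x.1 i.+1 / y.1 i.+1 * gVs i x y
                 - gD x y * (1 + x.1 i.+1 / y.2 i.+1).
Proof.
move=> xp yp im; rewrite /gUs gU_rec ?gD_star ?mulNr //; try exact: gstar_pos.
by rewrite gstar1 // ltnW.
Qed.

Lemma gUs_lt i x y : (i < m)%N -> gUs i x y = gVs i x y.
Proof. exact: gU_lt. Qed.

Lemma gW_rec i x y : gpos x -> gpos y -> (i < m)%N ->
  gW i.+1 x y =
    gV i x y * gVs i x y * (x.1 i.+1 * y.2 i.+1) / (x.2 i.+1 * y.1 i.+1)
    + gD x y * (y.2 i.+1 * gVs i x y / y.1 i.+1
                - x.1 i.+1 * gV i x y / x.2 i.+1).
Proof.
move=> xp yp im; rewrite /gW /= gU_rec // gUs_rec //.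
have y0 : y.2 i.+1 != 0 by case: (yp i.+1) => _ /lt0r_neq0.
have y1 : y.1 i.+1 != 0 by case: (yp i.+1) => /lt0r_neq0.
have x0 : x.2 i.+1 != 0 by case: (xp i.+1) => _ /lt0r_neq0.
have x1 : x.1 i.+1 != 0 by case: (xp i.+1) => /lt0r_neq0.
by field; rewrite x0 x1 y0 y1.
Qed.

Lemma gW_last x y : gpos x -> gpos y -> (0 < m)%N ->
  gW m x y = gV m x y * gVs m x y.
Proof.
move=> xp yp m0; have cl := gV_closing m xp yp.
have y1 : y.1 m.+1 != 0 by case: (yp m.+1) => /lt0r_neq0.
have x1 : x.1 m.+1 != 0 by case: (xp m.+1) => /lt0r_neq0.
rewrite /gW (gtn_eqF m0) /gUs /gU eqxx gD_star -/(gVs m x y) gstarn.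
move: (gV m x y) (gVs m x y) (gD x y) cl => v vs d cl.
have -> : v = (x.1 m.+1 * vs + d - d * (x.1 m.+1 * y.1 m.+1)) / y.1 m.+1.
  by rewrite -cl; field.
by field; rewrite x1 y1.
Qed.

Lemma gW_mid i x y : gpos x -> gpos y -> (i.+1 < m)%N ->
  gW i.+1 x y =
    (gV i.+1 x y * gVs i x y / y.1 i.+1 + gV i x y * gVs i.+1 x y / x.2 i.+1)
    / ((x.1 i.+1)^-1 + (y.2 i.+1)^-1).
Proof.
move=> xp yp im; rewrite gW_rec // 1?ltnW //.
rewrite -(gU_lt x y im) -(gUs_lt x y im) gU_rec ?gUs_rec // 1?ltnW //.
have [[x1 x2] [y1 y2]] := (xp i.+1, yp i.+1).
have xy := addr_gt0 x1 y2.
by field; rewrite addrC !lt0r_neq0.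
Qed.

Lemma gV0E x y : (0 < m)%N ->
  gV 0 x y = gell y * gK m (fun=> 1) x y
             + gell x * gK m (fun=> 1) (gstar y) (gstar x)
             + gE m x y * (x.1 m.+1 * y.1 m.+1 + 1).
Proof.
move=> m0; rewrite /gV gP0 divr1 (ltn_eqF m0); congr (_ + _ + _).
rewrite /gK mulr_sumr; apply: eq_big_nat => j hj.
by rewrite /gw leqn0 gtn_eqF ?mul1r //; lia.
Qed.

Definition gswap1 x : gvec F :=
  (fun k => if k == 1%N then x.2 1%N else x.1 k,
   fun k => if k == 1%N then x.1 1%N else x.2 k).

Lemma gswap1_pos x : gpos x -> gpos (gswap1 x).
Proof.
by move=> xp k; rewrite /gswap1 /=; case: ifP; case: (xp k); case: (xp 1%N).
Qed.

(** The part of gK that does not involve the coordinates of index 1. *)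
Definition gK2 x y : F :=
  \sum_(2 <= j < m.+1) \prod_(2 <= k < j.+1) (x.2 k / y.2 k) * gb m x y j.

Lemma gK_peel x y : (1 < m)%N ->
  gK m (fun=> 1) x y
  = x.2 1%N / y.2 1%N * (1 + y.2 1%N / x.1 1%N + gK2 x y).
Proof.
move=> m1; rewrite /gK big_ltn; last by lia.
rewrite mul1r gPS gP0 mul1r /gb m1 mulr1n [RHS]mulrDr; congr (_ + _).
rewrite mulr_sumr; apply: eq_big_nat => j hj.
by rewrite mul1r mulrA; congr (_ * _); rewrite /gP big_ltn //; lia.
Qed.

Lemma gell_swap1 x : (0 < m)%N -> gell (gswap1 x) = gell x.
Proof.
move=> m0; rewrite /gell /= (_ : (m.+1 == 1%N) = false); last by lia.
congr (_ * _); rewrite !(big_ltn (m := 1) (n := m.+1)) //=.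
rewrite mulrACA [in RHS]mulrACA [x.2 1%N * _]mulrC; congr (_ * (_ * _)).
  by apply: eq_big_nat => k hk; rewrite gtn_eqF //; lia.
by apply: eq_big_nat => k hk; rewrite gtn_eqF //; lia.
Qed.

Lemma gK2_swap1 x y : gK2 (gswap1 x) (gswap1 y) = gK2 x y.
Proof.
apply: eq_big_nat => j hj; congr (_ * _).
  by apply: eq_big_nat => k hk; rewrite /= gtn_eqF //; lia.
by rewrite /gb /= gtn_eqF //; lia.
Qed.

Lemma gK2_star_swap1 x y :
  gK2 (gstar (gswap1 y)) (gstar (gswap1 x)) = gK2 (gstar y) (gstar x).
Proof.
apply: eq_big_nat => j hj; congr (_ * _).
  by apply: eq_big_nat => k hk; rewrite /= gtn_eqF //; lia.
rewrite /gb /= (_ : (j == m.+1) = false); last by lia.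
by rewrite gtn_eqF //; lia.
Qed.

Lemma gE_swap1 x y : (0 < m)%N ->
  gE m (gswap1 x) (gswap1 y) * (x.2 1%N * y.1 1%N)
  = gE m x y * (x.1 1%N * y.2 1%N).
Proof.
move=> m0; rewrite /gE !(big_ltn (m := 1) (n := m.+1)) //.
have eq2 (f g : nat -> F) : (forall k, (1 < k)%N -> f k = g k) ->
    \prod_(2 <= k < m.+1) f k = \prod_(2 <= k < m.+1) g k.
  by move=> fg; apply: eq_big_nat => k /andP[/fg].
have -> := eq2 (gswap1 x).2 x.2; last by move=> k k1; rewrite /= gtn_eqF.
have -> := eq2 (gswap1 y).1 y.1; last by move=> k k1; rewrite /= gtn_eqF.
by rewrite /=; ring.
Qed.

(** The two sides are the values of V_1 given by the recursion at the swapped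
pair and at the pair itself; hence V_1 is symmetric. *)
Lemma gV0_swap1 x y : gpos x -> gpos y -> (1 < m)%N ->
  y.1 1%N / x.1 1%N * gV 0 (gswap1 x) (gswap1 y)
    + gD x y * (1 + y.1 1%N / x.2 1%N)
  = y.2 1%N / x.2 1%N * gV 0 x y + gD x y * (1 + y.2 1%N / x.1 1%N).
Proof.
move=> xp yp m1; have m0 := ltnW m1.
have [[x1 x2] [y1 y2]] := (xp 1%N, yp 1%N).
rewrite !gV0E // !gell_swap1 // !gK_peel // gK2_swap1 gK2_star_swap1.
have n1 : (m.+1 == 1%N) = false by lia.
have n1' : (1%N == m.+1) = false by lia.
rewrite /= n1' n1.
have -> : gE m (gswap1 x) (gswap1 y)
    = gE m x y * (x.1 1%N * y.2 1%N) / (x.2 1%N * y.1 1%N).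
  by rewrite -gE_swap1 //; field; rewrite !lt0r_neq0.
by rewrite /gD; field; rewrite !lt0r_neq0.
Qed.

Lemma gD_swap1 x y : (0 < m)%N -> gD (gswap1 x) (gswap1 y) = gD x y.
Proof. by move=> m0; rewrite /gD !gell_swap1. Qed.

Lemma gW_1 x y : gpos x -> gpos y -> (1 < m)%N ->
  gW 1 x y = gV 0 x y * gV 0 (gswap1 x) (gswap1 y).
Proof.
move=> xp yp m1; have m0 := ltnW m1.
have [[x1 x2] [y1 y2]] := (xp 1%N, yp 1%N).
rewrite gW_rec // gVs0 //; move: (gV0_swap1 xp yp m1).
move: (gV 0 _ _) (gV 0 _ _) (gD _ _) => v w d h.
have -> : w = (y.2 1%N / x.2 1%N * v + d * (1 + y.2 1%N / x.1 1%N)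
   - d * (1 + y.1 1%N / x.2 1%N)) * x.1 1%N / y.1 1%N.
  by rewrite -h; field; rewrite !lt0r_neq0.
by field; rewrite !lt0r_neq0.
Qed.

Lemma gV_swap1 i x y : gpos x -> gpos y -> (1 < m)%N -> (0 < i <= m)%N ->
  gV i (gswap1 x) (gswap1 y) = gV i x y.
Proof.
move=> xp yp m1; have m0 := ltnW m1.
have n1 : (m.+1 == 1%N) = false by lia.
have UV j : gU j (gswap1 x) (gswap1 y) = gU j x y ->
    gV j (gswap1 x) (gswap1 y) = gV j x y.
  by rewrite /gU gD_swap1 //= n1; apply: addIr.
have [xs ys] := (gswap1_pos xp, gswap1_pos yp).
elim: i => // -[|i] IH /andP[_ im]; apply: UV; rewrite !gU_rec //.
  by rewrite gD_swap1 //= -gV0_swap1.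
by rewrite IH ?(ltnW im) //= gD_swap1.
Qed.

(** The subtraction in gW hides the positivity, which comes from the
subtraction-free formulas. *)
Lemma gW_gt0 i x y : gpos x -> gpos y -> (1 < m)%N -> (i <= m)%N ->
  0 < gW i x y.
Proof.
move=> xp yp m1; have m0 := ltnW m1.
have [xs ys] := (gswap1_pos xp, gswap1_pos yp).
case: i => [_|i im].
  by rewrite /gW /= exprn_gt0 // gV_gt0.
have [->|im1] := eqVneq i.+1 m; first by rewrite gW_last // mulr_gt0 //; [exact: gV_gt0|exact: gVs_gt0].
have [[x1 x2] [y1 y2]] := (xp i.+1, yp i.+1).
rewrite gW_mid //; last by lia.
have [v0 w0] := (gV_gt0 m i xp yp, gVs_gt0 m i xp yp).
have [v1 w1] := (gV_gt0 m i.+1 xp yp, gVs_gt0 m i.+1 xp yp).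
apply: divr_gt0; last by rewrite addr_gt0 ?invr_gt0.
by rewrite addr_gt0 // divr_gt0 // mulr_gt0.
Qed.

End GeometricW.

(** * Invariants of the nodes 1, ..., n - 2 *)

Section Middle.
Variables (F : realFieldType) (m i : nat).
Hypothesis i_mid : (0 < i < m)%N.
Implicit Types (x y X Y : gvec F) (j k : nat).

Definition gphi x : F := x.1 i * (1 + x.2 i.+1 / x.1 i.+1).
Definition geps x : F := x.2 i * (1 + x.1 i.+1 / x.2 i.+1).
(** Invariant under e_i, and gphi * geps is a product of such invariants. *)
Definition gC x : F := (x.1 i.+1)^-1 + (x.2 i.+1)^-1.

Definition gorbit x X : Prop :=
  [/\ forall k, (0 < k <= m.+1)%N -> k != i -> k != i.+1 -> x.1 k = X.1 k,
      forall k, (0 < k <= m)%N -> k != i -> k != i.+1 -> x.2 k = X.2 k,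
      x.1 i * x.1 i.+1 = X.1 i * X.1 i.+1,
      x.2 i * x.2 i.+1 = X.2 i * X.2 i.+1
    & gC x = gC X].

(** Necessary and sufficient for (x, y) and (X, Y) to be related by e_i: see
rank_one_unique for the sum of inverses. *)
Definition gorbit2 x y X Y : Prop :=
  [/\ gorbit x X, gorbit y Y &
      (gphi x)^-1 + (geps y)^-1 = (gphi X)^-1 + (geps Y)^-1].

Lemma gorbit_star x X : gorbit x X -> gorbit (gstar m x) (gstar m X).
Proof.
move=> [h1 h2 h3 h4 h5]; split; rewrite ?gstar1 //; try lia.
- by move=> k hk ki ki1; rewrite /=; case: ifP => [/eqP->|km]; rewrite ?h1 ?h2 //; lia.
- by move=> k hk ki ki1; rewrite /= h1 //; lia.
- rewrite /gC gstar1 //; last by lia.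
  by rewrite gstar1 //=; [move: h5; rewrite /gC addrC => ->; rewrite addrC|lia].
Qed.

Lemma gorbit_n x X : gorbit x X -> x.1 m.+1 = X.1 m.+1.
Proof. by case=> h _ _ _ _; apply: h; lia. Qed.

Lemma gphi_star x : gphi (gstar m x) = geps x.
Proof. by rewrite /gphi !gstar1 //; lia. Qed.

Lemma geps_star x : geps (gstar m x) = gphi x.
Proof. by rewrite /geps !gstar1 //; lia. Qed.

Lemma gorbit2_star x y X Y : gorbit2 x y X Y ->
  gorbit2 (gstar m y) (gstar m x) (gstar m Y) (gstar m X).
Proof.
move=> [xX yY h]; split; try exact: gorbit_star.
by rewrite !gphi_star !geps_star addrC h addrC.
Qed.

Section Same.
Variables (x y X Y : gvec F).
Hypotheses (xp : gpos x) (yp : gpos y) (Xp : gpos X) (Yp : gpos Y).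
Hypothesis s : gorbit2 x y X Y.

Lemma gP_orbit2 j : (j <= m)%N -> j != i -> gP x y j = gP X Y j.
Proof.
move=> jm ji; have [[_ hx _ hx2 _] [_ hy _ hy2 _] _] := s.
have [lt_ji|le_ij] := ltnP j i.
  by apply: eq_big_nat => k hk; rewrite hx ?hy //; lia.
apply: (eq_big_nat2 (i := i)); try by lia.
  by move=> k hk ki ki1; rewrite hx ?hy //; lia.
by rewrite /= !mulf_div hx2 hy2.
Qed.

Lemma gell_orbit x' X' : gorbit x' X' -> gell m x' = gell m X'.
Proof.
move=> [h1 h2 h3 h4 h5]; rewrite /gell h1; try by lia.
congr (_ * _ * _); apply: (eq_big_nat2 (i := i)) => //; try by lia.
by move=> k hk ki ki1; rewrite h1 //; lia.
Qed.

Lemma gE_orbit2 : gE m x y = gE m X Y.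
Proof.
have [[h1 h2 h3 h4 h5] [g1 g2 g3 g4 g5] _] := s.
congr (_ * _); apply: (eq_big_nat2 (i := i)) => //; try by lia.
by move=> k hk ki ki1; rewrite g1 //; lia.
Qed.

(** The left-hand side is the part of gK attached to the indices i and i + 1,
divided by P_(i-1); the right-hand side consists of invariants. *)
Lemma gK_local x' y' : gpos x' -> gpos y' ->
  x'.2 i / y'.2 i * (1 + y'.2 i / x'.1 i)
    + x'.2 i / y'.2 i * (x'.2 i.+1 / y'.2 i.+1) * (y'.2 i.+1 / x'.1 i.+1)
  = x'.2 i * x'.2 i.+1 * gC x' * (((gphi x')^-1 + (geps y')^-1)
      + (y'.2 i * y'.2 i.+1 * gC y')^-1).
Proof.
move=> xp' yp'; rewrite /gphi /geps /gC.
have [[x1 x2] [y1 y2]] := (xp' i, yp' i).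
have [[x3 x4] [y3 y4]] := (xp' i.+1, yp' i.+1).
have [xx yy] := (addr_gt0 x3 x4, addr_gt0 y3 y4).
by field; rewrite !lt0r_neq0 // addrC.
Qed.

(** The weights w must not separate i from i + 1: this is why V_i itself is
not invariant. *)
Lemma gK_orbit2 w : w i = w i.+1 -> gK m w x y = gK m w X Y.
Proof.
move=> wi; have [[h1 h2 h3 h4 h5] [g1 g2 g3 g4 g5] h] := s.
apply: (eq_big_nat2 (i := i)); try by lia.
  move=> k hk ki ki1; rewrite gP_orbit2 //; last by lia.
  by rewrite /gb h1 ?g2 //; lia.
rewrite /= -wi -!mulrDr; congr (_ * _).
have [k ik] : {k | i = k.+1} by exists i.-1; lia.
have Pk : gP x y k = gP X Y k by apply: gP_orbit2; lia.
have loc z t : gP z t i * gb m z t i + gP z t i.+1 * gb m z t i.+1 =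
    gP z t k * (z.2 i / t.2 i * (1 + t.2 i / z.1 i)
      + z.2 i / t.2 i * (z.2 i.+1 / t.2 i.+1) * (t.2 i.+1 / z.1 i.+1))
    + gP z t i.+1 * (i.+1 < m)%N%:R.
  rewrite /gb (_ : (i < m)%N = true) /= ?mulr1n; last by lia.
  have gPi : gP z t i = gP z t k * (z.2 i / t.2 i) by rewrite {1}ik gPS -ik.
  by rewrite gPS gPi; ring.
by rewrite !loc !gK_local // Pk (gP_orbit2 (j := i.+1)) ?h ?h4 ?g4 ?h5 ?g5 //; lia.
Qed.

End Same.

Lemma gV_orbit2 x y X Y j : gpos x -> gpos y -> gpos X -> gpos Y ->
  gorbit2 x y X Y -> (j <= m)%N -> j != i -> gV m j x y = gV m j X Y.
Proof.
move=> xp yp Xp Yp s jm ji; have [h g _] := s; rewrite /gV.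
have [xx yy] := (gell_orbit h, gell_orbit g).
rewrite (gorbit_n h) (gorbit_n g).
rewrite (gE_orbit2 s) (gP_orbit2 s) // xx yy.
have -> : gw m j x y = gw m j X Y.
  by rewrite /gw xx yy.
have K1 : gK m (gw m j X Y) x y = gK m (gw m j X Y) X Y.
  by apply: gK_orbit2 => //; rewrite /gw; have -> : (i <= j)%N = (i.+1 <= j)%N by lia.
have K2 : gK m (fun=> 1) (gstar m y) (gstar m x)
        = gK m (fun=> 1) (gstar m Y) (gstar m X).
  by apply: gK_orbit2 => //; try exact: gstar_pos; apply: gorbit2_star.
by rewrite K1 K2.
Qed.

Lemma gVs_orbit2 x y X Y j : gpos x -> gpos y -> gpos X -> gpos Y ->
  gorbit2 x y X Y -> (j <= m)%N -> j != i -> gVs m j x y = gVs m j X Y.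
Proof.
by move=> *; apply: gV_orbit2 => //; try exact: gstar_pos; apply: gorbit2_star.
Qed.

Lemma gD_orbit2 x y X Y : gorbit2 x y X Y -> gD m x y = gD m X Y.
Proof. by case=> h g _; rewrite /gD (gell_orbit h) (gell_orbit g). Qed.

Lemma gU_orbit2 x y X Y j : gpos x -> gpos y -> gpos X -> gpos Y ->
  gorbit2 x y X Y -> (j <= m)%N -> j != i -> gU m j x y = gU m j X Y.
Proof.
move=> xp yp Xp Yp s jm ji; rewrite /gU (gV_orbit2 _ _ _ _ s) // (gD_orbit2 s).
by have [_ /gorbit_n->] := s.
Qed.

Lemma gUs_orbit2 x y X Y j : gpos x -> gpos y -> gpos X -> gpos Y ->
  gorbit2 x y X Y -> (j <= m)%N -> j != i -> gUs m j x y = gUs m j X Y.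
Proof.
by move=> *; apply: gU_orbit2 => //; try exact: gstar_pos; apply: gorbit2_star.
Qed.

Lemma gW_orbit2 x y X Y j : gpos x -> gpos y -> gpos X -> gpos Y ->
  gorbit2 x y X Y -> (j <= m)%N -> j != i -> gW m j x y = gW m j X Y.
Proof.
move=> xp yp Xp Yp s jm ji; rewrite /gW (gD_orbit2 s).
case: eqP => [_|_]; first by rewrite (gV_orbit2 _ _ _ _ s) //; lia.
by rewrite (gU_orbit2 _ _ _ _ s) // (gUs_orbit2 _ _ _ _ s).
Qed.

End Middle.

(** * R at the nodes 1, ..., n - 2 *)

Ltac pos :=
  repeat first [done | apply: mulr_gt0 | rewrite invr_gt0 | apply: addr_gt0].

(** The variables q, qb, t, tb stand for x_(i+1), xb_(i+1), y_(i+1), yb_(i+1), and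
u, us, w, U, Us, om for V_i, star V_i, W_i, V_(i+1), star V_(i+1), W_(i+1).  The
point of S1 and S2 is that they are invariant under e_i, although the left-hand
sides and the factors u and us are not. *)
Section LocalIdentities.
Variables (F : realFieldType) (q qb t tb u us d : F).
Hypotheses (q0 : 0 < q) (qb0 : 0 < qb) (t0 : 0 < t) (tb0 : 0 < tb).

Let w : F := u * us + d * (u - us).
Let U : F := tb / qb * u + d * (1 + tb / q).
Let Us : F := q / t * us - d * (1 + q / tb).
Let om : F := U * Us + d * (U - Us).
Let S1 : F := (q^-1 + qb^-1) * (Us + d) + d * (t^-1 + tb^-1).
Let S2 : F := (t^-1 + tb^-1) * (U - d) - d * (q^-1 + qb^-1).

Lemma local_S1 : w / t + om / tb = u * S1.
Proof. by rewrite /S1 /om /Us /U /w; field; rewrite !lt0r_neq0. Qed.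

Lemma local_S2 : om / q + w / qb = us * S2.
Proof. by rewrite /S2 /om /Us /U /w; field; rewrite !lt0r_neq0. Qed.

(** Here v and vs stand for V_(i-1) and star V_(i-1), and p, pb, s, sb for the
coordinates of index i.  The last factor on the right is a multiple of
1 / phi_i(x) + 1 / eps_i(y) by an invariant. *)
Lemma local_sum p pb s sb v vs :
  0 < p -> 0 < pb -> 0 < s -> 0 < sb ->
  u = sb / pb * v + d * (1 + sb / p) ->
  us = p / s * vs - d * (1 + p / sb) ->
  s * tb * v * S1 + pb * q * vs * S2
  = w * (pb * s / (p * sb)) * (p * q * (q^-1 + qb^-1) * (tb / t)
      + sb * tb * (t^-1 + tb^-1) * (q / qb)).
Proof.
move=> p0 pb0 s0 sb0 uE usE.
by rewrite /S2 /S1 /w /Us /U uE usE; field; rewrite !lt0r_neq0.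
Qed.

End LocalIdentities.

Section GeometricR.
Variables (F : realFieldType) (m : nat).
Implicit Types (x y X Y : gvec F) (i j k h : nat).

(** Thanks to the value of W_0, the coordinates of index 1 need no separate
formula. *)
Definition gR1 x y : gvec F :=
  (fun k => if k == m.+1 then y.1 k * gV m m x y / gVs m m x y
            else y.1 k * gV m k.-1 x y * gW m k x y
                 / (gV m k x y * gW m k.-1 x y),
   fun k => y.2 k * gV m k.-1 x y / gV m k x y).

Definition gR2 x y : gvec F :=
  (fun k => if k == m.+1 then x.1 k * gVs m m x y / gV m m x y
            else x.1 k * gVs m k.-1 x y / gVs m k x y,
   fun k => x.2 k * gVs m k.-1 x y * gW m k x y
            / (gVs m k x y * gW m k.-1 x y)).

Section MiddleValues.
Variables (h : nat) (x y : gvec F).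
Hypotheses (hm : (h.+1 < m)%N) (xp : gpos x) (yp : gpos y).

Let i := h.+1.
Let S1 := gC i x * (gUs m i.+1 x y + gD m x y) + gD m x y * gC i y.
Let S2 := gC i y * (gU m i.+1 x y - gD m x y) - gD m x y * gC i x.
Let v := gV m h x y.
Let vs := gVs m h x y.
Let z := gV m i.+1 x y.
Let zs := gVs m i.+1 x y.
Let w0 := gW m h x y.
Let w := gW m i x y.
Let om := gW m i.+1 x y.

Let v_gt0 : 0 < v. Proof. exact: gV_gt0. Qed.
Let vs_gt0 : 0 < vs. Proof. exact: gVs_gt0. Qed.
Let z_gt0 : 0 < z. Proof. exact: gV_gt0. Qed.
Let zs_gt0 : 0 < zs. Proof. exact: gVs_gt0. Qed.
Let u_gt0 : 0 < gV m i x y. Proof. exact: gV_gt0. Qed.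
Let us_gt0 : 0 < gVs m i x y. Proof. exact: gVs_gt0. Qed.
Let w0_gt0 : 0 < w0. Proof. by apply: gW_gt0 => //; lia. Qed.
Let w_gt0 : 0 < w. Proof. by apply: gW_gt0 => //; lia. Qed.
Let om_gt0 : 0 < om. Proof. by apply: gW_gt0 => //; lia. Qed.

Let uE : gV m i x y = y.2 i / x.2 i * v + gD m x y * (1 + y.2 i / x.1 i).
Proof. by rewrite -gU_lt // gU_rec //; lia. Qed.

Let usE : gVs m i x y = x.1 i / y.1 i * vs - gD m x y * (1 + x.1 i / y.2 i).
Proof. by rewrite -gUs_lt // gUs_rec //; lia. Qed.

Let wE : w = gV m i x y * gVs m i x y
             + gD m x y * (gV m i x y - gVs m i x y).
Proof. by rewrite /w /gW /= gU_lt // gUs_lt. Qed.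

Let x1p k : 0 < x.1 k. Proof. by case: (xp k). Qed.
Let x2p k : 0 < x.2 k. Proof. by case: (xp k). Qed.
Let y1p k : 0 < y.1 k. Proof. by case: (yp k). Qed.
Let y2p k : 0 < y.2 k. Proof. by case: (yp k). Qed.

Let S1E : w / y.1 i.+1 + om / y.2 i.+1 = gV m i x y * S1.
Proof.
rewrite wE /S1 /om /gW /= (gU_rec xp yp hm) (gUs_rec xp yp hm).
by apply: local_S1.
Qed.

Let S2E : om / x.1 i.+1 + w / x.2 i.+1 = gVs m i x y * S2.
Proof.
rewrite wE /S2 /om /gW /= (gU_rec xp yp hm) (gUs_rec xp yp hm).
by apply: local_S2.
Qed.

Let S_sum : y.1 i * y.2 i.+1 * v * S1 + x.2 i * x.1 i.+1 * vs * S2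
  = w * (x.2 i * y.1 i / (x.1 i * y.2 i))
    * (x.1 i * x.1 i.+1 * gC i x * (y.2 i.+1 / y.1 i.+1)
       + y.2 i * y.2 i.+1 * gC i y * (x.1 i.+1 / x.2 i.+1)).
Proof.
rewrite wE /S1 /S2 (gU_rec xp yp hm) (gUs_rec xp yp hm) -/i.
by apply: local_sum; rewrite ?uE ?usE.
Qed.

Let S1_gt0 : 0 < S1.
Proof.
by rewrite -(pmulr_rgt0 _ u_gt0) -S1E addr_gt0 ?divr_gt0.
Qed.

Let S2_gt0 : 0 < S2.
Proof.
by rewrite -(pmulr_rgt0 _ us_gt0) -S2E addr_gt0 ?divr_gt0.
Qed.

Let i_n : (i == m.+1) = false.
Proof. exact: ltn_eqF (ltnW hm). Qed.
Let i1_n : (i.+1 == m.+1) = false.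
Proof. exact: ltn_eqF hm. Qed.

Lemma gC_R1 : gC i (gR1 x y) = z / om * S1.
Proof.
have -> : S1 = (w / y.1 i.+1 + om / y.2 i.+1) / gV m i x y.
  by rewrite S1E mulrAC divff ?mul1r ?lt0r_neq0.
rewrite /gC /gR1 /= i1_n -/w -/om -/z.
by field; rewrite !lt0r_neq0.
Qed.

Lemma gC_R2 : gC i (gR2 x y) = zs / om * S2.
Proof.
have -> : S2 = (om / x.1 i.+1 + w / x.2 i.+1) / gVs m i x y.
  by rewrite S2E mulrAC divff ?mul1r ?lt0r_neq0.
rewrite /gC /gR2 /= i1_n -/w -/om -/zs.
by field; rewrite !lt0r_neq0.
Qed.

Let R1p : 0 < (gR1 x y).1 i.+1 /\ 0 < (gR1 x y).2 i.+1.
Proof. by rewrite /gR1 /= i1_n; split; pos. Qed.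

Let R2p : 0 < (gR2 x y).1 i.+1 /\ 0 < (gR2 x y).2 i.+1.
Proof. by rewrite /gR2 /= i1_n; split; pos. Qed.

Let phiE (X : gvec F) : 0 < X.1 i.+1 /\ 0 < X.2 i.+1 ->
  gphi i X = X.1 i * X.2 i.+1 * gC i X.
Proof. by case=> a b; rewrite /gphi /gC; field; rewrite !lt0r_neq0. Qed.

Let epsE (X : gvec F) : 0 < X.1 i.+1 /\ 0 < X.2 i.+1 ->
  geps i X = X.2 i * X.1 i.+1 * gC i X.
Proof. by case=> a b; rewrite /geps /gC; field; rewrite !lt0r_neq0. Qed.

Let phiR1 : gphi i (gR1 x y) = y.1 i * y.2 i.+1 * v * w * S1 / (w0 * om).
Proof.
rewrite phiE // gC_R1 /gR1 /= i_n -/v -/z -/w -/w0.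
by field; rewrite !lt0r_neq0.
Qed.

Let epsR2 : geps i (gR2 x y) = x.2 i * x.1 i.+1 * vs * w * S2 / (w0 * om).
Proof.
rewrite epsE // gC_R2 /gR2 /= i1_n -/vs -/zs -/w -/w0.
by field; rewrite !lt0r_neq0.
Qed.

Let epsR1 : geps i (gR1 x y) = y.2 i * y.1 i.+1 * v * S1 / w.
Proof.
rewrite epsE // gC_R1 /gR1 /= i1_n -/v -/z -/w -/om.
by field; rewrite !lt0r_neq0.
Qed.

Let phiR2 : gphi i (gR2 x y) = x.1 i * x.2 i.+1 * vs * S2 / w.
Proof.
rewrite phiE // gC_R2 /gR2 /= i_n -/vs -/zs -/w -/om.
by field; rewrite !lt0r_neq0.
Qed.

Let Cx_gt0 : 0 < gC i x. Proof. by rewrite addr_gt0 ?invr_gt0. Qed.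
Let Cy_gt0 : 0 < gC i y. Proof. by rewrite addr_gt0 ?invr_gt0. Qed.

(** The factor on the right is invariant under e_i. *)
Lemma gR_mid_harmonic :
  (gphi i (gR1 x y))^-1 + (geps i (gR2 x y))^-1
  = w0 * om * gC i x * gC i y / (v * vs * S1 * S2)
    * ((gphi i x)^-1 + (geps i y)^-1).
Proof.
rewrite phiR1 epsR2 (phiE (X := x)) // (epsE (X := y)) //.
have -> : (y.1 i * y.2 i.+1 * v * w * S1 / (w0 * om))^-1
    + (x.2 i * x.1 i.+1 * vs * w * S2 / (w0 * om))^-1
  = w0 * om * (y.1 i * y.2 i.+1 * v * S1 + x.2 i * x.1 i.+1 * vs * S2)
    / (y.1 i * y.2 i.+1 * v * w * S1 * (x.2 i * x.1 i.+1 * vs * S2)).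
  by field; rewrite !lt0r_neq0.
by rewrite S_sum; field; rewrite !lt0r_neq0.
Qed.

Lemma gR_mid_ratio :
  gphi i (gR1 x y) / geps i (gR2 x y)
  = y.1 i * y.1 i.+1 * (y.2 i * y.2 i.+1) * v * S1 * gC i y
    / (x.1 i * x.1 i.+1 * (x.2 i * x.2 i.+1) * vs * S2 * gC i x)
    * (gphi i x / geps i y).
Proof.
rewrite phiR1 epsR2 (phiE (X := x)) // (epsE (X := y)) //.
by field; rewrite !lt0r_neq0.
Qed.

(** Since eps_i of a tensor product is eps_i(x) (1 + eps_i(y) / phi_i(x)), which
is eps_i(x) eps_i(y) times the sum of inverses, this says that R preserves
eps_i. *)
Lemma gR_mid_eps :
  geps i (gR1 x y) * geps i (gR2 x y)
    * ((gphi i (gR1 x y))^-1 + (geps i (gR2 x y))^-1)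
  = geps i x * geps i y * ((gphi i x)^-1 + (geps i y)^-1).
Proof.
rewrite gR_mid_harmonic epsR1 epsR2 (epsE (X := x)) // (epsE (X := y)) //.
by field; rewrite !lt0r_neq0 // phiE // !mulr_gt0.
Qed.

Lemma gR_mid_phi :
  gphi i (gR2 x y) * gphi i (gR1 x y)
    * ((gphi i (gR1 x y))^-1 + (geps i (gR2 x y))^-1)
  = gphi i y * gphi i x * ((gphi i x)^-1 + (geps i y)^-1).
Proof.
rewrite gR_mid_harmonic phiR1 phiR2 (phiE (X := x)) // (phiE (X := y)) //.
by field; rewrite !lt0r_neq0 // epsE // !mulr_gt0.
Qed.

End MiddleValues.

End GeometricR.

Section GeometricR2.
Variables (F : realFieldType) (m : nat).
Implicit Types (x y X Y : gvec F) (i j k h : nat).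
Local Notation gR1 := (@gR1 F m).
Local Notation gR2 := (@gR2 F m).


Let midF j : (j < m)%N -> (j.+1 == m.+1) = false.
Proof. exact: ltn_eqF. Qed.

Lemma gR1_line1 h x y : (h.+1 < m)%N -> gpos x -> gpos y ->
  (gR1 x y).1 h.+1 * (gR1 x y).1 h.+2
  = y.1 h.+1 * y.1 h.+2 * gV m h x y * gW m h.+2 x y
    / (gV m h.+2 x y * gW m h x y).
Proof.
move=> hm xp yp; rewrite /gR1 /= (midF (ltnW hm)) (midF hm).
have := gV_gt0 m h.+1 xp yp; have := gV_gt0 m h.+2 xp yp.
have W0 j : (j <= m)%N -> 0 < gW m j x y by move=> jm; apply: gW_gt0 => //; lia.
have := W0 h.+1 (ltnW hm); have := W0 h (ltnW (ltnW hm)).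
by move=> *; field; rewrite !lt0r_neq0.
Qed.

Lemma gR1_line2 h x y : gpos x -> gpos y ->
  (gR1 x y).2 h.+1 * (gR1 x y).2 h.+2
  = y.2 h.+1 * y.2 h.+2 * gV m h x y / gV m h.+2 x y.
Proof.
move=> xp yp; rewrite /gR1 /=.
have := gV_gt0 m h.+1 xp yp; have := gV_gt0 m h.+2 xp yp.
by move=> *; field; rewrite !lt0r_neq0.
Qed.

Lemma gR2_line1 h x y : (h.+1 < m)%N -> gpos x -> gpos y ->
  (gR2 x y).1 h.+1 * (gR2 x y).1 h.+2
  = x.1 h.+1 * x.1 h.+2 * gVs m h x y / gVs m h.+2 x y.
Proof.
move=> hm xp yp; rewrite /gR2 /= (midF (ltnW hm)) (midF hm).
have := gVs_gt0 m h.+1 xp yp; have := gVs_gt0 m h.+2 xp yp.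
by move=> *; field; rewrite !lt0r_neq0.
Qed.

Lemma gR2_line2 h x y : (h.+1 < m)%N -> gpos x -> gpos y ->
  (gR2 x y).2 h.+1 * (gR2 x y).2 h.+2
  = x.2 h.+1 * x.2 h.+2 * gVs m h x y * gW m h.+2 x y
    / (gVs m h.+2 x y * gW m h x y).
Proof.
move=> hm xp yp; rewrite /gR2 /=.
have := gVs_gt0 m h.+1 xp yp; have := gVs_gt0 m h.+2 xp yp.
have W0 j : (j <= m)%N -> 0 < gW m j x y by move=> jm; apply: gW_gt0 => //; lia.
have := W0 h.+1 (ltnW hm); have := W0 h (ltnW (ltnW hm)).
by move=> *; field; rewrite !lt0r_neq0.
Qed.

(** The second part says that the action of e_i^c with a given c is mapped to the
action with the same c, since e_i^c multiplies phi_i(x) / eps_i(y) by c. *)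
Lemma gR_mid_orbit2 i x y X Y : (0 < i < m)%N ->
  gpos x -> gpos y -> gpos X -> gpos Y -> gorbit2 m i x y X Y ->
  gorbit2 m i (gR1 x y) (gR2 x y) (gR1 X Y) (gR2 X Y)
  /\ gphi i (gR1 x y) / geps i (gR2 x y) * (gphi i X / geps i Y)
     = gphi i (gR1 X Y) / geps i (gR2 X Y) * (gphi i x / geps i y).
Proof.
case: i => // h hm xp yp Xp Yp s; have hm1 : (h.+1 < m)%N by [].
have V_s j := gV_orbit2 (j := j) hm xp yp Xp Yp s.
have Vs_s j := gVs_orbit2 (j := j) hm xp yp Xp Yp s.
have W_s j := gW_orbit2 (j := j) hm xp yp Xp Yp s.
have U_s := gU_orbit2 (j := h.+2) hm xp yp Xp Yp s hm1.
have Us_s := gUs_orbit2 (j := h.+2) hm xp yp Xp Yp s hm1.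
have D_s := gD_orbit2 hm s.
have [[a1 a2 a3 a4 a5] [b1 b2 b3 b4 b5] ab] := s.
have hh1 : h != h.+1 by lia.
have hh2 : h.+2 != h.+1 by lia.
have hm0 : (h <= m)%N by lia.
split; last first.
  rewrite !gR_mid_ratio // V_s // Vs_s // U_s // Us_s // D_s a3 a4 a5 b3 b4 b5.
  by rewrite mulrAC.
split.
- split.
  + move=> k hk ki ki1; rewrite /gR1 /= b1 //; case: eqP => [->|kn].
      by rewrite V_s ?Vs_s //; lia.
    by rewrite (V_s k) ?(V_s k.-1) ?(W_s k) ?(W_s k.-1) //; lia.
  + move=> k hk ki ki1; rewrite /gR1 /= b2 //.
    by rewrite (V_s k) ?(V_s k.-1) //; lia.
  + by rewrite !gR1_line1 // b3 !V_s // !W_s.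
  + by rewrite !gR1_line2 // b4 !V_s.
  + by rewrite !gC_R1 // V_s // W_s // Us_s // D_s a5 b5.
- split.
  + move=> k hk ki ki1; rewrite /gR2 /= a1 //; case: eqP => [->|kn].
      by rewrite V_s ?Vs_s //; lia.
    by rewrite (Vs_s k) ?(Vs_s k.-1) //; lia.
  + move=> k hk ki ki1; rewrite /gR2 /= a2 //.
    by rewrite (Vs_s k) ?(Vs_s k.-1) ?(W_s k) ?(W_s k.-1) //; lia.
  + by rewrite !gR2_line1 // a3 !Vs_s.
  + by rewrite !gR2_line2 // a4 !Vs_s // !W_s.
  + by rewrite !gC_R2 // Vs_s // W_s // U_s // D_s a5 b5.
rewrite !gR_mid_harmonic // ab V_s // Vs_s // W_s // W_s // U_s // Us_s // D_s.
by rewrite a5 b5.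
Qed.

End GeometricR2.

(** * Invariants of the node n - 1 *)

Section EndNode.
Variables (F : realFieldType) (m : nat).
Hypothesis m1 : (1 < m)%N.
Implicit Types (x y X Y : gvec F) (i j k h : nat).
Local Notation gR1 := (@gR1 F m).
Local Notation gR2 := (@gR2 F m).

Definition gphi_end x : F := x.1 m.
Definition geps_end x : F := x.1 m.+1 * x.2 m.

Definition gorbit_end x X : Prop :=
  [/\ forall k, (0 < k < m)%N -> x.1 k = X.1 k,
      forall k, (0 < k <= m)%N -> x.2 k = X.2 k
    & x.1 m * x.1 m.+1 = X.1 m * X.1 m.+1].

Definition gorbit2_end x y X Y : Prop :=
  [/\ gorbit_end x X, gorbit_end y Y &
      (gphi_end x)^-1 + (geps_end y)^-1 = (gphi_end X)^-1 + (geps_end Y)^-1].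

(** The part of gK unaffected by e_m. *)
Definition gKlow (w : nat -> F) x y : F :=
  \sum_(1 <= j < m) w j * (gP x y j * gb m x y j).

(** The terms of index m and n of P_j V_j, for j < m; in the other terms, e_m
affects at most the factors ell x and ell y, which it preserves.  The two
factors in parentheses are exchanged by star, so that the tail is common to
V_j and star V_j. *)
Definition gtail x y : F :=
  gE m x y * (1 + y.1 m.+1 * y.2 m / x.1 m) * (1 + x.1 m.+1 * x.1 m / y.2 m).

Lemma gtail_star x y : gtail (gstar m y) (gstar m x) = gtail x y.
Proof. by rewrite /gtail gE_star !gstarn !gstar1 //= mulrAC. Qed.

(** The product form of gtail comes from gell_gP, by which the terms of index m
in both sums have the same factor gE. *)
Lemma gV_low j x y : gpos x -> gpos y -> (j < m)%N ->
  gV m j x y =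
    (gKlow (gw m j x y) x y
     + gell m x * gKlow (fun=> 1) (gstar m y) (gstar m x) + gtail x y)
    / gP x y j.
Proof.
move=> xp yp jm; have [xs ys] := (gstar_pos m xp, gstar_pos m yp).
rewrite /gV; congr (_ / _).
have KE w z t : gK m w z t = gKlow w z t + w m * (gP z t m * (t.2 m / z.1 m)).
  rewrite /gK big_nat_recr /=; last by lia.
  by rewrite /gb ltnn add0r.
have mj : (m <= j)%N = false by rewrite leqNgt jm.
rewrite !KE (ltn_eqF jm) mul1r /gw mj.
have PE := gell_gP m xp yp; have QE := gell_gP m ys xs.
rewrite gE_star gell_star gstarn in QE.
have [[x1 x2] [y1 y2]] := (xp m, yp m).
rewrite /gtail gstar1 // [gell m x * (_ + _)]mulrDr [gell m y * _]mulrA PE.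
rewrite [gell m x * (gP _ _ m * _)]mulrA QE /=.
by field; rewrite !lt0r_neq0.
Qed.

Lemma gell_end x X : gorbit_end x X -> gell m x = gell m X.
Proof.
move=> [h1 h2 h3]; rewrite /gell mulrAC [in RHS]mulrAC.
congr (_ * _); last by apply: eq_big_nat => k hk; apply: h2.
rewrite (big_nat_recr _ _ x.1 (ltnW m1)) (big_nat_recr _ _ X.1 (ltnW m1)) /=.
rewrite -!mulrA h3; congr (_ * _).
exact: eq_big_nat.
Qed.

(** Up to factors that do not move, gtail is y_m y_(m+1) yb_m times the sum
of inverses 1 / phi_m(x) + 1 / eps_m(y), times 1 + x_m x_(m+1) / yb_m. *)
Lemma gtail_end x y X Y : gpos x -> gpos y -> gpos X -> gpos Y ->
  gorbit2_end x y X Y -> gtail x y = gtail X Y.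
Proof.
move=> xp yp Xp Yp [[h1 h2 h3] [g1 g2 g3] s].
have tE z t : gpos z -> gpos t -> gtail z t =
    \prod_(1 <= k < m.+1) z.2 k * \prod_(1 <= k < m) t.1 k
    * (t.1 m * t.1 m.+1 * t.2 m * ((gphi_end z)^-1 + (geps_end t)^-1))
    * (1 + z.1 m * z.1 m.+1 / t.2 m).
  move=> zp tp; have [[a b] [c d]] := (zp m, tp m); have [e f] := tp m.+1.
  rewrite /gtail /gE (big_nat_recr _ _ t.1 (ltnW m1)) /=.
  rewrite /gphi_end /geps_end; move: (\prod_(_ <= _ < _) _) (\prod_(_ <= _ < _) _).
  by move=> *; field; rewrite !lt0r_neq0.
rewrite !tE // h3 g3 s g2; last by lia.
congr (_ * _ * _ * _); last exact: eq_big_nat.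
by apply: eq_big_nat => k hk; rewrite h2 //; lia.
Qed.

Lemma gP_end x y X Y j : (j <= m)%N ->
  gorbit_end x X -> gorbit_end y Y -> gP x y j = gP X Y j.
Proof.
move=> jm [_ h _] [_ g _]; apply: eq_big_nat => k hk.
by rewrite h ?g //; lia.
Qed.

Lemma gPs_end x y X Y j : (j < m)%N -> gorbit_end x X -> gorbit_end y Y ->
  gP (gstar m y) (gstar m x) j = gP (gstar m Y) (gstar m X) j.
Proof.
move=> jm [h _ _] [g _ _]; apply: eq_big_nat => k hk.
by rewrite /= h ?g //; lia.
Qed.

Lemma gKlow_end w x y X Y : gorbit_end x X -> gorbit_end y Y ->
  gKlow w x y = gKlow w X Y.
Proof.
move=> xX yY; apply: eq_big_nat => k hk.
rewrite (gP_end _ xX yY); last by lia.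
have [[h1 h2 _] [_ g2 _]] := (xX, yY).
by rewrite /gb h1 ?g2 //; lia.
Qed.

Lemma gKlows_end w x y X Y : gorbit_end x X -> gorbit_end y Y ->
  gKlow w (gstar m y) (gstar m x) = gKlow w (gstar m Y) (gstar m X).
Proof.
move=> xX yY; apply: eq_big_nat => k hk.
rewrite (gPs_end _ xX yY); last by lia.
have [[h1 h2 _] [_ g2 _]] := (xX, yY).
by rewrite /gb !gstar1 ?g2 /= ?h1 //; lia.
Qed.

Lemma gV_low_end j x y X Y : gpos x -> gpos y -> gpos X -> gpos Y ->
  gorbit2_end x y X Y -> (j < m)%N ->
  gV m j x y = gV m j X Y /\ gVs m j x y = gVs m j X Y.
Proof.
move=> xp yp Xp Yp s jm; have [xX yY _] := s.
have [lx ly] := (gell_end xX, gell_end yY).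
split; rewrite /gVs !gV_low //; try exact: gstar_pos.
  rewrite (gtail_end _ _ _ _ s) // (gP_end _ xX yY) 1?ltnW //.
  by rewrite (gKlow_end _ xX yY) (gKlows_end _ xX yY) lx /gKlow /gw lx ly.
rewrite !gtail_star (gtail_end _ _ _ _ s) // (gPs_end _ xX yY) //.
rewrite (gKlows_end _ xX yY) !gell_star ly /gKlow /gw !gell_star lx ly.
congr ((_ + _ * _ + _) / _); apply: eq_big_nat => k hk.
have [[h1 h2 _] [_ g2 _]] := (xX, yY).
rewrite gP_star2 ?gP_star2 ?(gP_end _ xX yY) //; try by lia.
by rewrite /gb /= !ltn_eqF ?h1 ?g2 //; lia.
Qed.

End EndNode.

(** * R at the node n - 1 *)

Section EndNodeR.
Variables (F : realFieldType) (h : nat).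
Hypothesis h0 : (0 < h)%N.
Implicit Types (x y X Y : gvec F).
Local Notation m := h.+1.
Local Notation gR1 := (@gR1 F m).
Local Notation gR2 := (@gR2 F m).

(** In this form V_m is visibly invariant under e_m; its image by star is not. *)
Lemma gV_last x y : gpos x -> gpos y ->
  gV m m x y = y.2 m / x.2 m * gV m h x y
    + gD m x y * y.2 m * ((gphi_end m x)^-1 + (geps_end m y)^-1).
Proof.
move=> xp yp; have := gU_rec (i := h) xp yp (ltnSn h).
have [[a b] [c d]] := (xp m, yp m); have [e f] := yp m.+1.
rewrite /gU eqxx /gphi_end /geps_end => /eqP.
rewrite eq_sym -subr_eq => /eqP <-.
by field; rewrite !lt0r_neq0.
Qed.

(** A combination of the recursion and of gV_closing that contains no D. *)
Lemma gVs_last x y : gpos x -> gpos y ->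
  x.1 m.+1 * x.2 m * y.1 m * gVs m m x y
    * ((gphi_end m x)^-1 + (geps_end m y)^-1)
  = x.1 m.+1 * x.2 m * gVs m h x y + y.1 m * gV m h x y.
Proof.
move=> xp yp; have cl := gV_closing m xp yp.
have := gUs_rec xp yp (ltnSn h).
rewrite /gUs /gU eqxx gD_star -/(gVs m m x y) gstarn => zsE.
rewrite (gV_last xp yp) /gphi_end /geps_end in cl *.
have [[x1 x2] [y1 y2]] := (xp m, yp m).
have [[x3 _] [y3 _]] := (xp m.+1, yp m.+1).
set zs := gVs m m x y in zsE cl *; set d := gD m x y in zsE cl *.
have A : zs = x.1 m / y.1 m * gVs m h x y - d * (x.1 m / y.2 m + (x.1 m.+1)^-1).
  by rewrite -[LHS](addrK (- d * (1 - (x.1 m.+1)^-1))) zsE; ring.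
have B : x.1 m.+1 * zs = y.1 m.+1 * (y.2 m / x.2 m * gV m h x y + d * y.2 m
     * ((x.1 m)^-1 + (y.1 m.+1 * y.2 m)^-1)) + d * (x.1 m.+1 * y.1 m.+1) - d.
  by rewrite cl addrK.
(* the first of the two expressions of zs serves for 1 / x_m, the second for
   1 / (y_n yb_m) *)
have -> : x.1 m.+1 * x.2 m * y.1 m * zs * ((x.1 m)^-1 + (y.1 m.+1 * y.2 m)^-1)
  = x.1 m.+1 * x.2 m * y.1 m / x.1 m * zs
    + x.2 m * y.1 m / (y.1 m.+1 * y.2 m) * (x.1 m.+1 * zs).
  by field; rewrite !lt0r_neq0.
by rewrite B A; field; rewrite !lt0r_neq0.
Qed.

Section Values.
Variables (x y : gvec F).
Hypotheses (xp : gpos x) (yp : gpos y).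

Let v := gV m h x y.
Let vs := gVs m h x y.
Let z := gV m m x y.
Let zs := gVs m m x y.
Let w0 := gW m h x y.

Let v_gt0 : 0 < v. Proof. exact: gV_gt0. Qed.
Let vs_gt0 : 0 < vs. Proof. exact: gVs_gt0. Qed.
Let z_gt0 : 0 < z. Proof. exact: gV_gt0. Qed.
Let zs_gt0 : 0 < zs. Proof. exact: gVs_gt0. Qed.
Let w0_gt0 : 0 < w0. Proof. exact: gW_gt0. Qed.
Let x1p k : 0 < x.1 k. Proof. by case: (xp k). Qed.
Let x2p k : 0 < x.2 k. Proof. by case: (xp k). Qed.
Let y1p k : 0 < y.1 k. Proof. by case: (yp k). Qed.
Let y2p k : 0 < y.2 k. Proof. by case: (yp k). Qed.
Let mn : (m == m.+1) = false. Proof. exact: ltn_eqF. Qed.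

Lemma gR1_m1 : (gR1 x y).1 m = y.1 m * v * zs / w0.
Proof.
rewrite /gR1 /= mn gW_last // -/v -/z -/zs -/w0.
by field; rewrite !lt0r_neq0.
Qed.

Lemma gR2_m2 : (gR2 x y).2 m = x.2 m * vs * z / w0.
Proof.
rewrite /gR2 /= gW_last // -/vs -/z -/zs -/w0.
by field; rewrite !lt0r_neq0.
Qed.

Lemma gR1_m2 : (gR1 x y).2 m = y.2 m * v / z. Proof. by []. Qed.
Lemma gR2_m1 : (gR2 x y).1 m = x.1 m * vs / zs.
Proof. by rewrite /gR2 /= mn. Qed.
Lemma gR1_n : (gR1 x y).1 m.+1 = y.1 m.+1 * z / zs.
Proof. by rewrite /gR1 /= eqxx. Qed.
Lemma gR2_n : (gR2 x y).1 m.+1 = x.1 m.+1 * zs / z.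
Proof. by rewrite /gR2 /= eqxx. Qed.

Lemma gR1_line_end :
  (gR1 x y).1 m * (gR1 x y).1 m.+1 = y.1 m * y.1 m.+1 * v * z / w0.
Proof. by rewrite gR1_m1 gR1_n; field; rewrite !lt0r_neq0. Qed.

Lemma gR2_line_end :
  (gR2 x y).1 m * (gR2 x y).1 m.+1 = x.1 m * x.1 m.+1 * vs / z.
Proof. by rewrite gR2_m1 gR2_n; field; rewrite !lt0r_neq0. Qed.

Lemma gR_end_harmonic :
  (gphi_end m (gR1 x y))^-1 + (geps_end m (gR2 x y))^-1
  = w0 / (v * vs) * ((gphi_end m x)^-1 + (geps_end m y)^-1).
Proof.
have zsE := gVs_last xp yp; rewrite -/zs -/v -/vs in zsE.
rewrite {1}/gphi_end {1}/geps_end gR1_m1 gR2_n gR2_m2.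
have -> : (y.1 m * v * zs / w0)^-1
    + (x.1 m.+1 * zs / z * (x.2 m * vs * z / w0))^-1
  = w0 * (x.1 m.+1 * x.2 m * vs + y.1 m * v)
    / (zs * y.1 m * v * (x.1 m.+1 * x.2 m * vs)).
  by field; rewrite !lt0r_neq0.
rewrite -zsE; move: (_^-1 + _^-1) => s.
by field; rewrite !lt0r_neq0.
Qed.

Lemma gR_end_ratio :
  gphi_end m (gR1 x y) / geps_end m (gR2 x y)
  = y.1 m * y.1 m.+1 * y.2 m * v / (x.1 m * x.1 m.+1 * x.2 m * vs)
    * (gphi_end m x / geps_end m y).
Proof.
rewrite /gphi_end /geps_end gR1_m1 gR2_n gR2_m2.
by field; rewrite !lt0r_neq0.
Qed.

Lemma gR_end_eps :
  geps_end m (gR1 x y) * geps_end m (gR2 x y)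
    * ((gphi_end m (gR1 x y))^-1 + (geps_end m (gR2 x y))^-1)
  = geps_end m x * geps_end m y * ((gphi_end m x)^-1 + (geps_end m y)^-1).
Proof.
rewrite gR_end_harmonic /geps_end gR1_n gR1_m2 gR2_n gR2_m2.
move: (_^-1 + _^-1) => s.
by field; rewrite !lt0r_neq0.
Qed.

Lemma gR_end_phi :
  gphi_end m (gR2 x y) * gphi_end m (gR1 x y)
    * ((gphi_end m (gR1 x y))^-1 + (geps_end m (gR2 x y))^-1)
  = gphi_end m y * gphi_end m x * ((gphi_end m x)^-1 + (geps_end m y)^-1).
Proof.
rewrite gR_end_harmonic /gphi_end gR2_m1 gR1_m1.
move: (_^-1 + _^-1) => s.
by field; rewrite !lt0r_neq0.
Qed.

End Values.

Lemma gR_end_orbit2 x y X Y :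
  gpos x -> gpos y -> gpos X -> gpos Y -> gorbit2_end m x y X Y ->
  gorbit2_end m (gR1 x y) (gR2 x y) (gR1 X Y) (gR2 X Y)
  /\ gphi_end m (gR1 x y) / geps_end m (gR2 x y)
       * (gphi_end m X / geps_end m Y)
     = gphi_end m (gR1 X Y) / geps_end m (gR2 X Y)
       * (gphi_end m x / geps_end m y).
Proof.
move=> xp yp Xp Yp s; have [xX yY hs] := s; have m1 : (1 < m)%N by [].
have Vs j (jm : (j < m)%N) := gV_low_end m1 xp yp Xp Yp s jm.
have [lx ly] := (gell_end m1 xX, gell_end m1 yY).
have [[a1 a2 a3] [b1 b2 b3]] := (xX, yY).
have D_s : gD m x y = gD m X Y by rewrite /gD lx ly.
have mm : (0 < m <= m)%N by rewrite leqnn.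
have zE : gV m m x y = gV m m X Y.
  by rewrite !gV_last // (Vs h _).1 // D_s hs a2 // b2.
have W_s j : (j < m)%N -> gW m j x y = gW m j X Y.
  move=> jm; rewrite /gW D_s !gU_lt // !gUs_lt // !(Vs _ jm).1 !(Vs _ jm).2.
  by rewrite (Vs 0%N _).1.
have [v_h vs_h] := Vs h (ltnSn h).
split; last first.
  by rewrite !gR_end_ratio // v_h vs_h a3 b3 a2 // b2 // mulrAC.
split.
- split.
  + move=> k hk; rewrite /gR1 /= b1 //.
    rewrite (_ : (k == m.+1) = false); last by lia.
    by rewrite !(Vs k _).1 ?(Vs k.-1 _).1 ?(W_s k) ?(W_s k.-1) //; lia.
  + move=> k hk; rewrite /gR1 /= b2 //.
    have [->|km] := eqVneq k m; first by rewrite zE v_h.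
    by rewrite (Vs k _).1 ?(Vs k.-1 _).1 //; lia.
  + by rewrite !gR1_line_end // b3 zE v_h W_s.
- split.
  + move=> k hk; rewrite /gR2 /= a1 //.
    rewrite (_ : (k == m.+1) = false); last by lia.
    by rewrite (Vs k _).2 ?(Vs k.-1 _).2 //; lia.
  + move=> k hk; have [->|km] := eqVneq k m.
      by rewrite !gR2_m2 // a2 // zE vs_h W_s.
    rewrite /gR2 /= a2 //.
    by rewrite (Vs k _).2 ?(Vs k.-1 _).2 ?(W_s k) ?(W_s k.-1) //; lia.
  + by rewrite !gR2_line_end // a3 zE vs_h.
by rewrite !gR_end_harmonic // hs v_h vs_h W_s.
Qed.

End EndNodeR.

(** * R commutes with the rational actions of e_i, 1 <= i <= n - 1 *)

Section RankOne.
Variables (F : realFieldType) (c f g f' g' : F).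
Hypotheses (c0 : 0 < c) (f0 : 0 < f) (g0 : 0 < g) (g0' : 0 < g').

Definition gc1 : F := (c * f + g) / (f + g).
Definition gc2 : F := (f + g) / (f + g / c).

Lemma gc1_gt0 : 0 < gc1. Proof. by rewrite /gc1; pos. Qed.
Lemma gc2_gt0 : 0 < gc2. Proof. by rewrite /gc2; pos. Qed.

(** With f = phi_i(x) and g = eps_i(y), the two equations determine the new
values f' and g', and the solution is the tensor product rule. *)
Lemma rank_one_unique : f'^-1 + g'^-1 = f^-1 + g^-1 -> f' / g' = c * (f / g) ->
  f' = gc1 * f /\ g' = g / gc2.
Proof.
move=> hs hr; have fg0 := addr_gt0 f0 g0; have cfg0 := addr_gt0 (mulr_gt0 c0 f0) g0.
have fE : f' = c * (f / g) * g' by rewrite -hr; field; rewrite !lt0r_neq0 //; pos.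
have gE : g' = g / gc2.
  have h1 : f'^-1 + g'^-1 = (1 + g / (c * f)) / g'.
    by rewrite fE; field; rewrite !lt0r_neq0 //; pos.
  have -> : g' = (1 + g / (c * f)) / (f'^-1 + g'^-1).
    by rewrite h1; field; rewrite !lt0r_neq0 //; pos.
  by rewrite hs /gc2; field; rewrite !lt0r_neq0 //; pos.
by split=> //; rewrite fE gE /gc1 /gc2; field; rewrite !lt0r_neq0 //; pos.
Qed.

Lemma rank_one_harmonic : (gc1 * f)^-1 + (g / gc2)^-1 = f^-1 + g^-1.
Proof.
have fg0 := addr_gt0 f0 g0; have cfg0 := addr_gt0 (mulr_gt0 c0 f0) g0.
by rewrite /gc1 /gc2; field; rewrite !lt0r_neq0 //; pos.
Qed.

Lemma rank_one_ratio : gc1 * f / (g / gc2) = c * (f / g).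
Proof.
have fg0 := addr_gt0 f0 g0; have cfg0 := addr_gt0 (mulr_gt0 c0 f0) g0.
by rewrite /gc1 /gc2; field; rewrite !lt0r_neq0 //; pos.
Qed.

End RankOne.

Section Action.
Variables (F : realFieldType) (m : nat).
Hypothesis m1 : (1 < m)%N.
Implicit Types (x y X Y : gvec F) (i j k : nat) (a c : F).
Local Notation gR1 := (@gR1 F m).
Local Notation gR2 := (@gR2 F m).

Definition gxi a x j : F := (x.1 j + a * x.2 j) / (x.1 j + x.2 j).

Definition ge i a x : gvec F :=
  if i == m then
    (fun k => if k == m then a * x.1 m
              else if k == m.+1 then x.1 m.+1 / a else x.1 k, x.2)
  else
    (fun k => if k == i then a * x.1 i / gxi a x i.+1
              else if k == i.+1 then x.1 i.+1 * gxi a x i.+1 / a else x.1 k,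
     fun k => if k == i then x.2 i / gxi a x i.+1
              else if k == i.+1 then x.2 i.+1 * gxi a x i.+1 else x.2 k).

Definition nphi i x : F := if i == m then gphi_end m x else gphi i x.
Definition neps i x : F := if i == m then geps_end m x else geps i x.

Definition norbit i x X : Prop :=
  if i == m then gorbit_end m x X else gorbit m i x X.

Definition norbit2 i x y X Y : Prop :=
  [/\ norbit i x X, norbit i y Y &
      (nphi i x)^-1 + (neps i y)^-1 = (nphi i X)^-1 + (neps i Y)^-1].

Definition gpos_in x : Prop :=
  (forall k, (0 < k <= m.+1)%N -> 0 < x.1 k)
  /\ (forall k, (0 < k <= m)%N -> 0 < x.2 k).

Definition gagree x X : Prop :=
  (forall k, (0 < k <= m.+1)%N -> x.1 k = X.1 k)
  /\ (forall k, (0 < k <= m)%N -> x.2 k = X.2 k).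

Lemma gpos_gpos_in x : gpos x -> gpos_in x.
Proof. by move=> xp; split=> k _; case: (xp k). Qed.

Lemma ge_gt0 i a x : 0 < a -> gpos x -> gpos (ge i a x).
Proof.
move=> a0 xp k; have x1 j : 0 < x.1 j by case: (xp j).
have x2 j : 0 < x.2 j by case: (xp j).
have xi0 : 0 < gxi a x i.+1 by rewrite /gxi; pos.
by rewrite /ge; case: ifP => _ /=; split; do ?case: ifP => _ //; pos.
Qed.

Lemma gR_pos x y : gpos x -> gpos y -> gpos_in (gR1 x y) /\ gpos_in (gR2 x y).
Proof.
move=> xp yp.
have V0 j := gV_gt0 m j xp yp; have Vs0 j := gVs_gt0 m j xp yp.
have W0 j : (j <= m)%N -> 0 < gW m j x y by move=> jm; apply: gW_gt0.
have x1 j : 0 < x.1 j by case: (xp j).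
have x2 j : 0 < x.2 j by case: (xp j).
have y1 j : 0 < y.1 j by case: (yp j).
have y2 j : 0 < y.2 j by case: (yp j).
split; split=> k hk /=; do ?case: eqP => [_|kn].
all: by pos; apply: W0; lia.
Qed.

Lemma nphi_gt0 i x : (0 < i <= m)%N -> gpos_in x -> 0 < nphi i x.
Proof.
move=> im [h1 h2]; rewrite /nphi; case: eqP => [_|km].
  by apply: h1; lia.
have [a b c] : [/\ 0 < x.1 i, 0 < x.1 i.+1 & 0 < x.2 i.+1].
  by split; [apply: h1|apply: h1|apply: h2]; lia.
by rewrite /gphi; pos.
Qed.

Lemma neps_gt0 i x : (0 < i <= m)%N -> gpos_in x -> 0 < neps i x.
Proof.
move=> im [h1 h2]; rewrite /neps; case: eqP => [_|km].
  by rewrite /geps_end mulr_gt0 //; [apply: h1|apply: h2]; lia.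
have [a b c] : [/\ 0 < x.2 i, 0 < x.1 i.+1 & 0 < x.2 i.+1].
  by split; [apply: h2|apply: h1|apply: h2]; lia.
by rewrite /geps; pos.
Qed.

Lemma ge_orbit i a x : (0 < i <= m)%N -> 0 < a -> gpos_in x ->
  [/\ norbit i x (ge i a x), nphi i (ge i a x) = a * nphi i x
    & neps i (ge i a x) = neps i x / a].
Proof.
move=> im a0 [h1 h2]; rewrite /norbit /nphi /neps /ge.
have [_|im'] := eqVneq i m.
  have e1 : (m.+1 == m) = false by rewrite gtn_eqF.
  rewrite /gorbit_end /gphi_end /geps_end /= e1 !eqxx.
  split; [split|by []|by rewrite mulrAC] => //.
  - by move=> k hk; rewrite !ltn_eqF //; lia.
  - by field; rewrite lt0r_neq0.
have [a1 [b1 b2]] : [/\ 0 < x.1 i & 0 < x.1 i.+1 /\ 0 < x.2 i.+1].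
  by split; [apply: h1|split; [apply: h1|apply: h2]]; lia.
have e1 : (i.+1 == i) = false by rewrite gtn_eqF.
rewrite /gorbit /gphi /geps /gC /gxi /= e1 !eqxx.
have bb := addr_gt0 b1 b2; have bb' := addr_gt0 b1 (mulr_gt0 a0 b2).
split; last first.
- by field; rewrite !lt0r_neq0 //; pos.
- by field; rewrite !lt0r_neq0 //; pos.
split.
- by move=> k hk ki ki1; rewrite (negPf ki) (negPf ki1).
- by move=> k hk ki ki1; rewrite (negPf ki) (negPf ki1).
- by field; rewrite !lt0r_neq0 //; pos.
- by field; rewrite !lt0r_neq0 //; pos.
- by field; rewrite !lt0r_neq0 //; pos.
Qed.

End Action.

Section Commute.
Variables (F : realFieldType) (m : nat).
Hypothesis m1 : (1 < m)%N.
Implicit Types (x y X Y : gvec F) (i j k : nat) (a c : F).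
Local Notation gR1 := (@gR1 F m).
Local Notation gR2 := (@gR2 F m).

Lemma norbit_norm i x X : (0 < i <= m)%N -> gpos_in m x -> gpos_in m X ->
  norbit m i x X -> nphi m i X * neps m i X = nphi m i x * neps m i x.
Proof.
move=> im [h1 h2] [H1 H2]; rewrite /norbit /nphi /neps.
have [_|im'] := eqVneq i m.
  by move=> [_ g2 g3]; rewrite /gphi_end /geps_end !mulrA g3 g2 //; lia.
move=> [_ _ g3 g4 g5].
have nE (z : gvec F) : gpos_in m z -> gphi i z * geps i z
    = z.1 i * z.1 i.+1 * (z.2 i * z.2 i.+1) * gC i z ^+ 2.
  move=> [z1 z2].
  have [b1 b2] : 0 < z.1 i.+1 /\ 0 < z.2 i.+1.
    by split; [apply: z1|apply: z2]; lia.
  by rewrite /gphi /geps /gC; field; rewrite !lt0r_neq0.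
by rewrite !nE // g3 g4 g5.
Qed.

(** The invariants determine all coordinates in terms of phi_i. *)
Lemma norbit_unique i x X a : (0 < i <= m)%N -> 0 < a ->
  gpos_in m x -> gpos_in m X ->
  norbit m i x X -> nphi m i X = a * nphi m i x -> gagree m X (ge m i a x).
Proof.
move=> im a0 [h1 h2] [H1 H2]; rewrite /norbit /nphi /ge.
have [_|im'] := eqVneq i m.
  move=> [g1 g2 g3]; rewrite /gphi_end => hX.
  have xm : 0 < x.1 m by apply: h1; lia.
  split=> k hk /=; last by rewrite g2.
  have [->|km] := eqVneq k m; first by [].
  have [->|kn] := eqVneq k m.+1; last by rewrite g1 //; lia.
  have -> : x.1 m.+1 = X.1 m * X.1 m.+1 / x.1 m.
    by rewrite -g3; field; rewrite lt0r_neq0.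
  by rewrite hX; field; rewrite !lt0r_neq0.
move=> [g1 g2 g3 g4 g5]; rewrite /gphi => hX.
have [[a1 a2] [b1 b2]] : (0 < x.1 i /\ 0 < x.2 i) /\ 0 < x.1 i.+1 /\ 0 < x.2 i.+1.
  by split; (split; [apply: h1|apply: h2]); lia.
have [[A1 A2] [B1 B2]] : (0 < X.1 i /\ 0 < X.2 i) /\ 0 < X.1 i.+1 /\ 0 < X.2 i.+1.
  by split; (split; [apply: H1|apply: H2]); lia.
(* the ratio xb_(i+1) / x_(i+1) is multiplied by a *)
have hr : X.2 i.+1 = a * x.2 i.+1 / x.1 i.+1 * X.1 i.+1.
  have e1 : X.1 i * (1 + X.2 i.+1 / X.1 i.+1)
      = X.1 i * X.1 i.+1 * (X.2 i.+1 * gC i X) / X.1 i.+1.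
    by rewrite /gC; field; rewrite !lt0r_neq0.
  have e2 : x.1 i * (1 + x.2 i.+1 / x.1 i.+1)
      = x.1 i * x.1 i.+1 * (x.2 i.+1 * gC i x) / x.1 i.+1.
    by rewrite /gC; field; rewrite !lt0r_neq0.
  rewrite e1 e2 g3 g5 in hX.
  have C0 : 0 < gC i X by rewrite /gC; pos.
  have -> : X.2 i.+1 = X.1 i * X.1 i.+1 * (X.2 i.+1 * gC i X) / X.1 i.+1
      / (X.1 i * gC i X) by field; rewrite !lt0r_neq0.
  by rewrite hX; field; rewrite !lt0r_neq0.
have bb := addr_gt0 b1 b2; have bb' := addr_gt0 b1 (mulr_gt0 a0 b2).
have hX1 : X.1 i.+1 = x.1 i.+1 * gxi a x i.+1 / a.
  have -> : X.1 i.+1 = (1 + x.1 i.+1 / (a * x.2 i.+1)) / gC i X.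
    by rewrite /gC hr; field; rewrite !lt0r_neq0 //; pos.
  by rewrite -g5 /gC /gxi; field; rewrite !lt0r_neq0 //; pos.
have xi0 : 0 < gxi a x i.+1 by rewrite /gxi; pos.
have hX2 : X.2 i.+1 = x.2 i.+1 * gxi a x i.+1.
  by rewrite hr hX1; field; rewrite !lt0r_neq0.
have hX3 : X.1 i = a * x.1 i / gxi a x i.+1.
  have -> : X.1 i = x.1 i * x.1 i.+1 / X.1 i.+1.
    by rewrite g3; field; rewrite lt0r_neq0.
  by rewrite hX1; field; rewrite !lt0r_neq0.
have hX4 : X.2 i = x.2 i / gxi a x i.+1.
  have -> : X.2 i = x.2 i * x.2 i.+1 / X.2 i.+1.
    by rewrite g4; field; rewrite lt0r_neq0.
  by rewrite hX2; field; rewrite !lt0r_neq0.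
split=> k hk /=.
  have [->|ki] := eqVneq k i; first by [].
  have [->|ki1] := eqVneq k i.+1; first by [].
  by rewrite g1.
have [->|ki] := eqVneq k i; first by [].
have [->|ki1] := eqVneq k i.+1; first by [].
by rewrite g2.
Qed.

Definition nc1 i c x y : F := gc1 c (nphi m i x) (neps m i y).
Definition nc2 i c x y : F := gc2 c (nphi m i x) (neps m i y).

Lemma gR_norbit2 i x y X Y : (0 < i <= m)%N ->
  gpos x -> gpos y -> gpos X -> gpos Y -> norbit2 m i x y X Y ->
  norbit2 m i (gR1 x y) (gR2 x y) (gR1 X Y) (gR2 X Y)
  /\ nphi m i (gR1 x y) / neps m i (gR2 x y) * (nphi m i X / neps m i Y)
     = nphi m i (gR1 X Y) / neps m i (gR2 X Y) * (nphi m i x / neps m i y).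
Proof.
move=> im; rewrite /norbit2 /norbit /nphi /neps.
have [_|im'] := eqVneq i m; last by apply: gR_mid_orbit2; lia.
case: m m1 => // h h0; exact: gR_end_orbit2.
Qed.

Lemma gR_eps i x y : (0 < i <= m)%N -> gpos x -> gpos y ->
  neps m i (gR1 x y) * (1 + neps m i (gR2 x y) / nphi m i (gR1 x y))
  = neps m i x * (1 + neps m i y / nphi m i x).
Proof.
move=> im xp yp; have [r1 r2] := gR_pos m1 xp yp.
have f1 := nphi_gt0 m1 im r1; have g1 := neps_gt0 m1 im r2.
have f2 := nphi_gt0 m1 im (gpos_gpos_in m xp).
have g2 := neps_gt0 m1 im (gpos_gpos_in m yp).
have E (e f g : F) : 0 < f -> 0 < g -> e * (1 + g / f) = e * g * (f^-1 + g^-1).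
  by move=> *; field; rewrite !lt0r_neq0.
rewrite !E //; move: {f1 g1 f2 g2}im; rewrite /nphi /neps.
have [_|im' im] := eqVneq i m.
  case: m m1 xp yp => // h h0 xp yp _; exact: gR_end_eps.
by case: i im im' => // h im im'; apply: gR_mid_eps => //; lia.
Qed.

Lemma gR_phi i x y : (0 < i <= m)%N -> gpos x -> gpos y ->
  nphi m i (gR2 x y) * (1 + nphi m i (gR1 x y) / neps m i (gR2 x y))
  = nphi m i y * (1 + nphi m i x / neps m i y).
Proof.
move=> im xp yp; have [r1 r2] := gR_pos m1 xp yp.
have f1 := nphi_gt0 m1 im r1; have g1 := neps_gt0 m1 im r2.
have f2 := nphi_gt0 m1 im (gpos_gpos_in m xp).
have g2 := neps_gt0 m1 im (gpos_gpos_in m yp).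
have E (p f g : F) : 0 < f -> 0 < g -> p * (1 + f / g) = p * f * (f^-1 + g^-1).
  by move=> *; field; rewrite !lt0r_neq0.
rewrite !E //; move: {f1 g1 f2 g2}im; rewrite /nphi /neps.
have [_|im' im] := eqVneq i m.
  case: m m1 xp yp => // h h0 xp yp _; exact: gR_end_phi.
by case: i im im' => // h im im'; apply: gR_mid_phi => //; lia.
Qed.

(** The image by R of e_i^c (x, y) lies on the orbit of R (x, y), at the place
determined by c. *)
Theorem gR_commutes i c x y : (0 < i <= m)%N -> 0 < c -> gpos x -> gpos y ->
  let X := ge m i (nc1 i c x y) x in
  let Y := ge m i (nc2 i c x y)  y in
  let x' := gR1 x y in let y' := gR2 x y in
  gagree m (gR1 X Y) (ge m i (nc1 i c x' y') x')
  /\ gagree m (gR2 X Y) (ge m i (nc2 i c x' y') y').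
Proof.
move=> im c0 xp yp X Y x' y'.
have [xi yi] := (gpos_gpos_in m xp, gpos_gpos_in m yp).
have [f0 g0] := (nphi_gt0 m1 im xi, neps_gt0 m1 im yi).
have [a1 a2] : 0 < nc1 i c x y /\ 0 < nc2 i c x y.
  by split; [apply: gc1_gt0|apply: gc2_gt0].
have [Xp Yp] := (ge_gt0 m i a1 xp, ge_gt0 m i a2 yp).
have [l1 p1 e1] := ge_orbit m1 im a1 xi.
have [l2 p2 e2] := ge_orbit m1 im a2 yi.
have s : norbit2 m i x y X Y.
  by split=> //; rewrite p1 e2 rank_one_harmonic.
have [[L1 L2 hs] hr] := gR_norbit2 im xp yp Xp Yp s.
rewrite p1 e2 rank_one_ratio // in hr.
have [x'i y'i] := gR_pos m1 xp yp; have [X'i Y'i] := gR_pos m1 Xp Yp.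
have [f0' g0'] := (nphi_gt0 m1 im x'i, neps_gt0 m1 im y'i).
have [F0' G0'] := (nphi_gt0 m1 im X'i, neps_gt0 m1 im Y'i).
have hr' : nphi m i (gR1 X Y) / neps m i (gR2 X Y)
    = c * (nphi m i x' / neps m i y').
  have fg0 : 0 < nphi m i x / neps m i y by rewrite divr_gt0.
  by apply: (mulIf (lt0r_neq0 fg0)); rewrite -hr mulrCA mulrA.
have [fE gE] := rank_one_unique c0 f0' g0' G0' (esym hs) hr'.
have [b1 b2] : 0 < nc1 i c x' y' /\ 0 < nc2 i c x' y'.
  by split; [apply: gc1_gt0|apply: gc2_gt0].
split; first exact: (norbit_unique im b1 x'i X'i L1 fE).
apply: (norbit_unique im b2 y'i Y'i L2).
have nn := norbit_norm im y'i Y'i L2.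
apply: (mulIf (lt0r_neq0 G0')); rewrite nn gE -/(nc2 i c x' y').
by field; rewrite lt0r_neq0.
Qed.

End Commute.

(** * From rational to max-plus formulas *)

Section Tropicalization.
Variable m : nat.
Hypothesis m1 : (1 < m)%N.
Local Notation vec := (Defs.vec m.+1).
Implicit Types (x y : vec) (X Y : nat -> gvec rat) (i j k : nat).

(** A family of positive points, indexed by T = t + 1, that tends to the max-plus
point x.  Only the meaningful coordinates are constrained, since those of
index out of range of mkvec are junk. *)
Definition rep X x : Prop :=
  (forall k, (0 < k <= m.+1)%N -> growth (fun t => (X t).1 k) (coord x k))
  /\ (forall k, (0 < k <= m)%N -> growth (fun t => (X t).2 k) (bcoord x k)).

Definition glift x (t : nat) : gvec rat :=
  (fun k => t.+1%:R ^ coord x k, fun k => t.+1%:R ^ bcoord x k).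

Lemma rep_lift x : rep (glift x) x.
Proof. by split=> k _; apply: growth_lift. Qed.

Lemma glift_pos x t : gpos (glift x t).
Proof. by move=> k; split; apply: exprz_gt0; rewrite ltr0n. Qed.

Lemma coord_mk a b k : (0 < k <= m.+1)%N -> coord (mkvec m.+1 a b) k = a k.
Proof. exact: coord_mkvec. Qed.

Lemma bcoord_mk a b k : (0 < k <= m)%N -> bcoord (mkvec m.+1 a b) k = b k.
Proof. by move=> hk; apply: bcoord_mkvec. Qed.

Lemma vec_eq x y :
  (forall k, (0 < k <= m.+1)%N -> coord x k = coord y k) ->
  (forall k, (0 < k <= m)%N -> bcoord x k = bcoord y k) -> x = y.
Proof.
case: x y => [a b] [c d] h1 h2; congr (_, _); apply: eq_from_tnth => i.
  by have := h1 i.+1 (ltn_ord i); rewrite /coord /= !(tnth_nth 0).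
by have := h2 i.+1 (ltn_ord i); rewrite /bcoord /= !(tnth_nth 0).
Qed.

Lemma rep_unique X x y : rep X x -> rep X y -> x = y.
Proof.
move=> [h1 h2] [g1 g2]; apply: vec_eq => k hk.
  exact: growth_unique (h1 k hk) (g1 k hk).
exact: growth_unique (h2 k hk) (g2 k hk).
Qed.

Lemma rep_agree X Y x : (forall t, gagree m (X t) (Y t)) -> rep Y x -> rep X x.
Proof.
move=> XY [h1 h2]; split=> k hk.
  by apply: growth_ext (h1 k hk) => t; case: (XY t) => ->.
by apply: growth_ext (h2 k hk) => t; case: (XY t) => _ ->.
Qed.

Lemma rep_star X x : rep X x -> rep (fun t => gstar m (X t)) (bar_swap x).
Proof.
move=> [h1 h2]; split=> k hk; last by rewrite bcoord_mk //; apply: h1; lia.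
rewrite coord_mk //=; have [->|km] := eqVneq k m.+1; first by apply: h1; lia.
by apply: h2; lia.
Qed.

Lemma rep_swap1 X x : rep X x -> rep (fun t => gswap1 (X t)) (swap1 x).
Proof.
move=> [h1 h2]; split=> k hk.
  rewrite coord_mk //=; have [_|km] := eqVneq k 1%N; first by apply: h2; lia.
  exact: h1.
rewrite bcoord_mk //=; have [_|km] := eqVneq k 1%N; first by apply: h1; lia.
exact: h2.
Qed.

Lemma sum_tail (f : nat -> int) i j : (j <= i)%N ->
  \sum_(j.+1 <= k < i.+1) f k
  = \sum_(1 <= k < i.+1) f k - \sum_(1 <= k < j.+1) f k.
Proof.
move=> ji; rewrite [in RHS](big_cat_nat (n := j.+1)) //=.
by rewrite addrAC subrr add0r.
Qed.

Lemma sum_opp (f g : nat -> int) i j :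
  \sum_(i <= k < j) (f k - g k) = - \sum_(i <= k < j) (g k - f k).
Proof. by rewrite -sumrN; apply: eq_bigr => k _; rewrite opprB. Qed.

Section GrowthV.
Variables (X Y : nat -> gvec rat) (x y : vec).
Hypotheses (Xx : rep X x) (Yy : rep Y y).
Hypotheses (Xp : forall t, gpos (X t)) (Yp : forall t, gpos (Y t)).

Let gX1 k (hk : (0 < k <= m.+1)%N) := Xx.1 k hk.
Let gX2 k (hk : (0 < k <= m)%N) := Xx.2 k hk.
Let gY1 k (hk : (0 < k <= m.+1)%N) := Yy.1 k hk.
Let gY2 k (hk : (0 < k <= m)%N) := Yy.2 k hk.

Lemma ellE (z : vec) : ell z = \sum_(1 <= k < m.+1) coord z k
  + \sum_(1 <= k < m.+1) bcoord z k + coord z m.+1.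
Proof. by rewrite /ell big_nat_recr //= addrAC. Qed.

Lemma growth_gell Z z : rep Z z -> growth (fun t => gell m (Z t)) (ell z).
Proof.
move=> [h1 h2]; rewrite ellE; apply: growthM; last by apply: h1; lia.
apply: growthM; apply: growth_prod => k; rewrite mem_index_iota => hk.
  by apply: h1; lia.
by apply: h2; lia.
Qed.

Let S j := \sum_(1 <= k < j.+1) (bcoord x k - bcoord y k).
Let T j := \sum_(1 <= k < j.+1) (coord y k - coord x k).

Let gS j : (j <= m)%N -> growth (fun t => gP (X t) (Y t) j) (S j).
Proof.
move=> jm; apply: growth_prod => k; rewrite mem_index_iota => hk.
by apply: growth_div; [apply: gX2|apply: gY2]; lia.
Qed.

Let gT j : (j <= m)%N ->
  growth (fun t => gP (gstar m (Y t)) (gstar m (X t)) j) (T j).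
Proof.
move=> jm; apply: growth_prod => k; rewrite mem_index_iota => hk.
by apply: growth_div; [apply: gY1|apply: gX1]; lia.
Qed.

Let gEg : growth (fun t => gE m (X t) (Y t))
  (\sum_(1 <= k < m.+1) bcoord x k + \sum_(1 <= k < m.+1) coord y k).
Proof.
apply: growthM; apply: growth_prod => k; rewrite mem_index_iota => hk.
  by apply: gX2; lia.
by apply: gY1; lia.
Qed.

(** The sum defining gV is split into the four families of terms of the list in
the definition of V, in the same order. *)
Lemma growth_gV i : (i <= m)%N ->
  growth (fun t => gV m i (X t) (Y t)) (V i x y).
Proof.
move=> im.
pose th t j := gw m i (X t) (Y t) j * gP (X t) (Y t) j / gP (X t) (Y t) i.
pose th' t j := gell m (X t) * gP (gstar m (Y t)) (gstar m (X t)) j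
  / gP (X t) (Y t) i.
pose et t j := if j == m.+1 then
    gE m (X t) (Y t) * ((X t).1 j * (Y t).1 j) / gP (X t) (Y t) i
  else th t j * ((Y t).2 j / (X t).1 j).
pose et' t j := if j == m.+1 then
    gE m (X t) (Y t) * (if i == m then gell m (X t) / gell m (Y t) else 1)
    / gP (X t) (Y t) i
  else th' t j * ((X t).1 j / (Y t).2 j).
apply: (@growth_ext (fun t => \sum_(1 <= j < m) th t j
  + (\sum_(1 <= j < m) th' t j
     + (\sum_(1 <= j < m.+2) et t j + \sum_(1 <= j < m.+2) et' t j)))).
  move=> t; rewrite /gV.
  have split_K w (z u : gvec rat) : gK m w z u =
      \sum_(1 <= j < m) w j * gP z u j
      + \sum_(1 <= j < m.+1) w j * gP z u j * (u.2 j / z.1 j).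
    rewrite /gK !big_nat_recr ?(ltnW m1) //= addrA -big_split /=.
    rewrite /gb ltnn add0r mulrA; congr (_ + _).
    by apply: eq_big_nat => j /andP[_ ->] /=; ring.
  have -> : \sum_(1 <= j < m) th t j
      = (\sum_(1 <= j < m) gw m i (X t) (Y t) j * gP (X t) (Y t) j)
        / gP (X t) (Y t) i by rewrite mulr_suml.
  have -> : \sum_(1 <= j < m) th' t j = gell m (X t)
      * (\sum_(1 <= j < m) 1 * gP (gstar m (Y t)) (gstar m (X t)) j)
        / gP (X t) (Y t) i.
    rewrite mulr_sumr mulr_suml; apply: eq_bigr => j _.
    by rewrite mul1r.
  rewrite ![\sum_(1 <= j < m.+2) _](big_nat_recr m.+1) //=.
  have -> : et t m.+1 = gE m (X t) (Y t) * ((X t).1 m.+1 * (Y t).1 m.+1)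
      / gP (X t) (Y t) i by rewrite /et eqxx.
  have -> : et' t m.+1 = gE m (X t) (Y t)
      * (if i == m then gell m (X t) / gell m (Y t) else 1)
      / gP (X t) (Y t) i by rewrite /et' eqxx.
  have -> : \sum_(1 <= j < m.+1) et t j
      = (\sum_(1 <= j < m.+1) gw m i (X t) (Y t) j * gP (X t) (Y t) j
          * ((Y t).2 j / (X t).1 j)) / gP (X t) (Y t) i.
    rewrite mulr_suml; apply: eq_big_nat => j /andP[_ jm].
    by rewrite /et (ltn_eqF jm) /th mulrAC.
  have -> : \sum_(1 <= j < m.+1) et' t j
      = gell m (X t) * (\sum_(1 <= j < m.+1)
          1 * gP (gstar m (Y t)) (gstar m (X t)) j
          * ((gstar m (X t)).2 j / (gstar m (Y t)).1 j)) / gP (X t) (Y t) i.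
    rewrite mulr_sumr mulr_suml; apply: eq_big_nat => j /andP[_ jm].
    by rewrite /et' (ltn_eqF jm) /th' gstar1 //=; ring.
  rewrite !split_K; do 4!move: (bigop.body _ _ _); move=> k1 k2 k3 k4.
  by case: (i == m); ring.
have Sm : \sum_(1 <= k < m.+1) (bcoord x k - bcoord y k)
    = \sum_(1 <= k < m.+1) bcoord x k - \sum_(1 <= k < m.+1) bcoord y k.
  by rewrite sumrB.
have Tm : \sum_(1 <= k < m.+1) (coord y k - coord x k)
    = \sum_(1 <= k < m.+1) coord y k - \sum_(1 <= k < m.+1) coord x k.
  by rewrite sumrB.
have gth j : (0 < j <= m)%N -> growth (th^~ j) (theta i j x y).
  move=> /andP[_ jm]; rewrite /th /theta /gw.
  have [ji|ij] := leqP j i.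
    apply: growth_eq (growth_div (growthM (growth_gell Xx) (gS jm)) (gS im)) _.
    by rewrite sum_opp sum_tail // /S; ring.
  apply: growth_eq (growth_div (growthM (growth_gell Yy) (gS jm)) (gS im)) _.
  by rewrite sum_tail 1?ltnW // /S; ring.
have gth' j : (0 < j <= m)%N -> growth (th'^~ j) (theta' i j x y).
  move=> /andP[_ jm]; rewrite /th' /theta'.
  apply: growth_eq (growth_div (growthM (growth_gell Xx) (gT jm)) (gS im)) _.
  by rewrite [\sum_(1 <= k < i.+1) _]sum_opp /T /S; ring.
have n_in : (0 < m.+1 <= m.+1)%N by rewrite leqnn.
have get j : (0 < j <= m.+1)%N -> growth (et^~ j) (eta i j x y).
  move=> /andP[j0 jn]; rewrite /et /eta; have [->|jm] := eqVneq j m.+1.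
    apply: growth_eq (growth_div (growthM gEg (growthM (gX1 n_in) (gY1 n_in))) (gS im)) _.
    by rewrite (sum_tail _ im) Sm ellE /S; ring.
  have hj : (0 < j <= m)%N by rewrite j0; lia.
  have hj1 : (0 < j <= m.+1)%N by rewrite j0; lia.
  apply: growth_eq (growthM (gth j hj) (growth_div (gY2 hj) (gX1 hj1))) _.
  by rewrite /theta; case: ifP.
have get' j : (0 < j <= m.+1)%N -> growth (et'^~ j) (eta' i j x y).
  move=> /andP[j0 jn]; rewrite /et' /eta'; have [_|jm] := eqVneq j m.+1.
    rewrite [\sum_(1 <= k < i.+1) _]sum_opp Tm ellE.
    rewrite (_ : m.+1.-1 = m) //; have [_|_] := eqVneq i m.
      apply: growth_eq (growth_div (growthM gEg
        (growth_div (growth_gell Xx) (growth_gell Yy))) (gS im)) _.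
      by rewrite ellE /S; ring.
    apply: growth_eq (growth_div (growthM gEg growth1) (gS im)) _.
    by rewrite /S; ring.
  have hj : (0 < j <= m)%N by rewrite j0; lia.
  have hj1 : (0 < j <= m.+1)%N by rewrite j0; lia.
  exact: growthM (gth' j hj) (growth_div (gX1 hj1) (gY2 hj)).
have ne (f : nat -> int) k : (1 < k)%N -> [seq f j | j <- index_iota 1 k] != [::].
  by move=> k1; rewrite -size_eq0 size_map size_iota; lia.
have iota_ne k : (1 < k)%N -> index_iota 1 k != [::].
  by move=> k1; rewrite -size_eq0 size_iota; lia.
have catE (s1 s2 : seq int) : s1 != [::] -> s1 ++ s2 != [::] by case: s1.
rewrite /V (_ : m.+1.-1 = m) // !max_seq_cat ?catE ?ne //; try lia.
apply: growthD; last (apply: growthD; last apply: growthD).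
all: apply: growth_sum => [|j]; [by apply: iota_ne; lia|rewrite mem_index_iota => hj].
- by apply: gth; lia.
- by apply: gth'; lia.
- by apply: get; lia.
- by apply: get'; lia.
Qed.

End GrowthV.
End Tropicalization.

Section TropicalR.
Variable m : nat.
Hypothesis m2 : (2 < m)%N.
Local Notation vec := (Defs.vec m.+1).
Implicit Types (x y : vec) (X Y : nat -> gvec rat) (i j k : nat).

Let m1 : (1 < m)%N. Proof. exact: ltnW. Qed.

Lemma bar_swapK x : bar_swap (bar_swap x) = x.
Proof.
apply: vec_eq => k hk.
  rewrite coord_mk //; have [->|km] := eqVneq k m.+1.
    by rewrite coord_mk ?eqxx // leqnn.
  by rewrite bcoord_mk //; lia.
rewrite bcoord_mk // coord_mk; last by lia.
by rewrite ltn_eqF //; lia.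
Qed.

Lemma swap1K x : swap1 (swap1 x) = x.
Proof.
apply: vec_eq => k hk.
  rewrite coord_mk //; have [->|km] := eqVneq k 1%N.
    by rewrite bcoord_mk //; lia.
  by rewrite coord_mk // (negPf km).
rewrite bcoord_mk //; have [->|km] := eqVneq k 1%N.
  by rewrite coord_mk //; lia.
by rewrite bcoord_mk // (negPf km).
Qed.

Section RepR.
Variables (X Y : nat -> gvec rat) (x y : vec).
Hypotheses (Xx : rep X x) (Yy : rep Y y).
Hypotheses (Xp : forall t, gpos (X t)) (Yp : forall t, gpos (Y t)).

Let v j (jm : (j <= m)%N) := growth_gV m1 Xx Yy jm.
Let vs j (jm : (j <= m)%N) : growth (fun t => gVs m j (X t) (Y t)) (star (V j) x y)
  := growth_gV m1 (rep_star m1 Yy) (rep_star m1 Xx) jm.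
Let v0s : growth (fun t => gV m 0 (gswap1 (X t)) (gswap1 (Y t)))
                 (sigma1 (V 0) x y).
Proof. by apply: growth_gV => //; apply: rep_swap1. Qed.

(** The three cases of the definition of W are the three subtraction-free
expressions of gW. *)
Lemma growth_gW j : (0 < j <= m)%N ->
  growth (fun t => gW m j (X t) (Y t)) (W j x y).
Proof.
move=> /andP[j0 jm]; rewrite /W.
have [->|j1] := eqVneq j 1%N.
  apply: (@growth_ext (fun t => gV m 0 (X t) (Y t)
      * gV m 0 (gswap1 (X t)) (gswap1 (Y t)))) => [t|]; first by rewrite gW_1.
  exact: growthM (v (leq0n m)) v0s.
rewrite (_ : m.+1.-1 = m) //; have [->|jm'] := eqVneq j m.
  apply: (@growth_ext (fun t => gV m m (X t) (Y t) * gVs m m (X t) (Y t))) => [t|].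
    by rewrite gW_last // ltnW.
  exact: growthM (v (leqnn m)) (vs (leqnn m)).
case: j j0 j1 jm jm' => // j _ j1 jm jm'; have jm1 : (j <= m)%N by apply: ltnW.
have hj : (0 < j.+1 <= m)%N by [].
have hj1 : (0 < j.+1 <= m.+1)%N by rewrite ltnS.
apply: (@growth_ext (fun t => (gV m j.+1 (X t) (Y t) * gVs m j (X t) (Y t) / (Y t).1 j.+1
   + gV m j (X t) (Y t) * gVs m j.+1 (X t) (Y t) / (X t).2 j.+1)
   / (((X t).1 j.+1)^-1 + ((Y t).2 j.+1)^-1))).
  by move=> t; rewrite -gW_mid //; lia.
rewrite -[Num.min _ _]opprK oppr_min.
apply: growth_div; apply: growthD.
- exact: growth_div (growthM (v jm) (vs jm1)) (Yy.1 _ hj1).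
- exact: growth_div (growthM (v jm1) (vs jm)) (Xx.2 _ hj).
- exact: growthV (Xx.1 _ hj1).
- exact: growthV (Yy.2 _ hj).
Qed.

Let w0 : growth (fun t => gW m 0 (X t) (Y t)) (V 0 x y + V 0 x y).
Proof.
apply: (@growth_ext (fun t => gV m 0 (X t) (Y t) * gV m 0 (X t) (Y t))).
  by move=> t; rewrite /gW /= expr2.
exact: growthM (v (leq0n m)) (v (leq0n m)).
Qed.

Let W1 : W 1 x y = V 0 x y + sigma1 (V 0) x y. Proof. by []. Qed.

Lemma starV0 : star (V 0) x y = V 0 x y.
Proof.
apply: growth_unique (vs (leq0n m)) _.
by apply: growth_ext (v (leq0n m)) => t; rewrite gVs0 // ltnW.
Qed.

Lemma rep_R1 : rep (fun t => gR1 m (X t) (Y t)) (R_fst x y).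
Proof.
split=> k hk; rewrite ?coord_mk ?bcoord_mk //=.
  have [k1|k1] := eqVneq k 1%N.
    rewrite k1 (_ : (1 == m.+1)%N = false); last by lia.
    apply: growth_eq (growth_div (growthM (growthM (Yy.1 1%N _) (v _)) (growth_gW _))
      (growthM (v _) w0)) _ => //; try lia.
    by rewrite W1; ring.
  have [kn|kn] := eqVneq k m.+1.
    by rewrite kn; apply: growth_div (vs (leqnn m)); apply: growthM (v (leqnn m));
       apply: Yy.1; lia.
  case: k hk k1 kn => [//|k] hk k1 kn.
  apply: growth_eq (growth_div (growthM (growthM (Yy.1 k.+1 _) (v _)) (growth_gW _))
      (growthM (v _) (growth_gW _))) _; lia.
have vk : (k.-1 <= m)%N by lia.
have vk1 : (k <= m)%N by lia.
apply: growth_eq (growth_div (growthM (Yy.2 k hk) (v vk)) (v vk1)) _.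
by case: (k =P 1%N) => [->|].
Qed.

Lemma rep_R2 : rep (fun t => gR2 m (X t) (Y t)) (R_snd x y).
Proof.
split=> k hk; rewrite ?coord_mk ?bcoord_mk //=.
  have [kn|kn] := eqVneq k m.+1.
    rewrite kn (_ : (m.+1 == 1)%N = false); last by lia.
    by apply: growth_div (v (leqnn m)); apply: growthM (vs (leqnn m));
       apply: Xx.1; lia.
  have vk : (k.-1 <= m)%N by lia.
  have vk1 : (k <= m)%N by lia.
  apply: growth_eq (growth_div (growthM (Xx.1 k hk) (vs vk)) (vs vk1)) _.
  by case: (k =P 1%N) => [->|]; rewrite ?starV0.
have [k1|k1] := eqVneq k 1%N.
  rewrite k1.
  apply: growth_eq (growth_div (growthM (growthM (Xx.2 1%N _) (vs _)) (growth_gW _))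
      (growthM (vs _) w0)) _ => //; try lia.
  by rewrite W1 starV0; ring.
case: k hk k1 => [//|k] hk k1.
apply: growth_eq (growth_div (growthM (growthM (Xx.2 k.+1 _) (vs _)) (growth_gW _))
      (growthM (vs _) (growth_gW _))) _; lia.
Qed.

End RepR.
End TropicalR.

(** * R commutes with the max-plus actions of e_i, 1 <= i <= n - 1 *)

Section TropicalAction.
Variable m : nat.
Hypothesis m2 : (2 < m)%N.
Local Notation vec := (Defs.vec m.+1).
Implicit Types (x y : vec) (X Y : nat -> gvec rat) (i j k : nat) (c : int).

Let m1 : (1 < m)%N. Proof. exact: ltnW. Qed.

Definition tc1 i c x y : int :=
  Num.max (c + phi i x) (eps i y) - Num.max (phi i x) (eps i y).
Definition tc2 i c x y : int :=
  Num.max (phi i x) (eps i y) - Num.max (phi i x) (- c + eps i y).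
(** The lengths of the i-string through x (x) y, see in_tensor_tstep. *)
Definition teps i x y : int := eps i x + posp (eps i y - phi i x).
Definition tphi i x y : int := phi i y + posp (phi i x - eps i y).

Section Node.
Variable i : nat.
Hypothesis im : (0 < i <= m)%N.

Let i0F : (i == 0%N) = false. Proof. by rewrite gtn_eqF; case/andP: im. Qed.
Let inF : (i == m.+1) = false.
Proof. by rewrite ltn_eqF // ltnS; case/andP: im. Qed.

Lemma growth_gxi X x (a : nat -> rat) c j : rep X x -> growth a c ->
  (0 < j <= m)%N -> growth (fun t => gxi (a t) (X t) j) (xi c x j).
Proof.
move=> [h1 h2] ac jm; have jm' : (0 < j <= m.+1)%N by lia.
rewrite /xi [bcoord x j + c]addrC; apply: growth_div; apply: growthD; auto.
exact: growthM (h2 _ _).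
Qed.

Lemma rep_ge X x (a : nat -> rat) c : rep X x -> growth a c ->
  rep (fun t => ge m i (a t) (X t)) (e_vec i c x).
Proof.
move=> Xx ac; have [h1 h2] := Xx; rewrite /e_vec /ge i0F inF.
rewrite (_ : m.+1.-1 = m) //; have [eim|nim] := eqVneq i m.
  split=> k hk; rewrite ?coord_mk ?bcoord_mk //=; last exact: h2.
  have [_|km] := eqVneq k m.
    by apply: growth_eq (growthM ac (h1 m _)) _; [lia|rewrite addrC].
  have [_|kn] := eqVneq k m.+1; last exact: h1.
  by apply: growth_div => //; apply: h1; lia.
have i1 : (0 < i.+1 <= m)%N by lia.
have i1' : (0 < i.+1 <= m.+1)%N by lia.
have i' : (0 < i <= m.+1)%N by lia.
have gx := growth_gxi Xx ac i1.
split=> k hk; rewrite ?coord_mk ?bcoord_mk //=.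
  have [_|ki] := eqVneq k i.
    by apply: growth_eq (growth_div (growthM ac (h1 i i')) gx) _; ring.
  have [_|ki1] := eqVneq k i.+1; last exact: h1.
  exact: growth_div (growthM (h1 _ i1') gx) ac.
have [_|ki] := eqVneq k i; first exact: growth_div (h2 i im) gx.
have [_|ki1] := eqVneq k i.+1; last exact: h2.
exact: growthM (h2 _ i1) gx.
Qed.

Lemma growth_nphi X x : rep X x -> growth (fun t => nphi m i (X t)) (phi i x).
Proof.
move=> [h1 h2]; rewrite /phi /nphi i0F inF.
rewrite (_ : m.+1.-1 = m) //; have [eim|nim] := eqVneq i m.
  by apply: h1; lia.
apply: growthM; first by apply: h1; lia.
rewrite /posp maxC; apply: growthD; first exact: growth1.
by apply: growth_div; [apply: h2|apply: h1]; lia.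
Qed.

Lemma growth_neps X x : rep X x -> growth (fun t => neps m i (X t)) (eps i x).
Proof.
move=> [h1 h2]; rewrite /eps /neps i0F inF.
rewrite (_ : m.+1.-1 = m) //; have [eim|nim] := eqVneq i m.
  by apply: growthM; [apply: h1|apply: h2]; lia.
apply: growthM; first by apply: h2; lia.
rewrite /posp maxC; apply: growthD; first exact: growth1.
by apply: growth_div; [apply: h1|apply: h2]; lia.
Qed.

Lemma growth_nc X Y x y (a : nat -> rat) c : rep X x -> rep Y y -> growth a c ->
  growth (fun t => nc1 m i (a t) (X t) (Y t)) (tc1 i c x y)
  /\ growth (fun t => nc2 m i (a t) (X t) (Y t)) (tc2 i c x y).
Proof.
move=> Xx Yy ac; have f := growth_nphi Xx; have g := growth_neps Yy.
split; apply: growth_div; apply: growthD => //; first exact: growthM.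
by rewrite addrC; apply: growth_div.
Qed.

Lemma R_commutes_node c x y :
  let x' := R_fst x y in let y' := R_snd x y in
  R_fst (e_vec i (tc1 i c x y) x) (e_vec i (tc2 i c x y) y)
    = e_vec i (tc1 i c x' y') x'
  /\ R_snd (e_vec i (tc1 i c x y) x) (e_vec i (tc2 i c x y) y)
    = e_vec i (tc2 i c x' y') y'.
Proof.
move=> x' y'.
pose X := glift x; pose Y := glift y; pose a t : rat := t.+1%:R ^ c.
have ac : growth a c := growth_lift c.
have a0 t : 0 < a t := growth_gt0 t ac.
have [Xx Yy] : rep X x /\ rep Y y by split; apply: rep_lift.
have [Xp Yp] : (forall t, gpos (X t)) /\ (forall t, gpos (Y t)).
  by split; apply: glift_pos.
have [c1 c2] := growth_nc Xx Yy ac.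
have R1x := rep_R1 m2 Xx Yy Xp Yp; have R2y := rep_R2 m2 Xx Yy Xp Yp.
have [d1 d2] := growth_nc R1x R2y ac.
have eX := rep_ge Xx c1; have eY := rep_ge Yy c2.
have eXp t : gpos (ge m i (nc1 m i (a t) (X t) (Y t)) (X t)).
  by apply: ge_gt0 (Xp t); apply: growth_gt0 c1.
have eYp t : gpos (ge m i (nc2 m i (a t) (X t) (Y t)) (Y t)).
  by apply: ge_gt0 (Yp t); apply: growth_gt0 c2.
have comm t := gR_commutes m1 im (a0 t) (Xp t) (Yp t).
split.
  apply: rep_unique (rep_R1 m2 eX eY eXp eYp) _.
  by apply: rep_agree (rep_ge R1x d1) => t; case: (comm t).
apply: rep_unique (rep_R2 m2 eX eY eXp eYp) _.
by apply: rep_agree (rep_ge R2y d2) => t; case: (comm t).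
Qed.

Lemma growth_teps X Y x y : rep X x -> rep Y y ->
  growth (fun t => neps m i (X t) * (1 + neps m i (Y t) / nphi m i (X t)))
    (teps i x y).
Proof.
move=> Xx Yy; apply: growthM; first exact: growth_neps.
rewrite /posp maxC; apply: growthD; first exact: growth1.
by apply: growth_div; [apply: growth_neps|apply: growth_nphi].
Qed.

Lemma growth_tphi X Y x y : rep X x -> rep Y y ->
  growth (fun t => nphi m i (Y t) * (1 + nphi m i (X t) / neps m i (Y t)))
    (tphi i x y).
Proof.
move=> Xx Yy; apply: growthM; first exact: growth_nphi.
rewrite /posp maxC; apply: growthD; first exact: growth1.
by apply: growth_div; [apply: growth_nphi|apply: growth_neps].
Qed.

Lemma R_string_node x y :
  teps i (R_fst x y) (R_snd x y) = teps i x y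
  /\ tphi i (R_fst x y) (R_snd x y) = tphi i x y.
Proof.
have [Xx Yy] := (rep_lift x, rep_lift y).
have [Xp Yp] := (@glift_pos _ x, @glift_pos _ y).
have R1x := rep_R1 m2 Xx Yy Xp Yp; have R2y := rep_R2 m2 Xx Yy Xp Yp.
split.
  apply: growth_unique (growth_teps R1x R2y) _.
  by apply: growth_ext (growth_teps Xx Yy) => t; rewrite -gR_eps.
apply: growth_unique (growth_tphi R1x R2y) _.
by apply: growth_ext (growth_tphi Xx Yy) => t; rewrite -gR_phi.
Qed.

End Node.
End TropicalAction.

(** * Symmetries, and the nodes 0 and n *)

Section Symmetries.
Variable m : nat.
Hypothesis m2 : (2 < m)%N.
Local Notation vec := (Defs.vec m.+1).
Implicit Types (x y : vec) (i j k : nat) (c : int).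

Let m1 : (1 < m)%N. Proof. exact: ltnW. Qed.
Let n_in : (0 < m.+1 <= m.+1)%N. Proof. exact: leqnn. Qed.
Let one_in : (0 < 1 <= m)%N. Proof. exact: ltnW. Qed.
Let m_in : (0 < m <= m)%N. Proof. by rewrite leqnn (ltnW m1). Qed.
Let two_in : (0 < 2 <= m)%N. Proof. exact: ltnW. Qed.
Let coord_mk := @coord_mk m.
Let bcoord_mk := @bcoord_mk m.

Lemma coord_swap1 x k : (0 < k <= m.+1)%N ->
  coord (swap1 x) k = if k == 1%N then bcoord x 1 else coord x k.
Proof. exact: coord_mk. Qed.

Lemma bcoord_swap1 x k : (0 < k <= m)%N ->
  bcoord (swap1 x) k = if k == 1%N then coord x 1 else bcoord x k.
Proof. exact: bcoord_mk. Qed.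

Lemma coord_bar x k : (0 < k <= m.+1)%N ->
  coord (bar_swap x) k = if k == m.+1 then coord x m.+1 else bcoord x k.
Proof. exact: coord_mk. Qed.

Lemma bcoord_bar x k : (0 < k <= m)%N -> bcoord (bar_swap x) k = coord x k.
Proof. exact: bcoord_mk. Qed.

Lemma bar_swap_swap1 x : bar_swap (swap1 x) = swap1 (bar_swap x).
Proof.
have n1 : (m.+1 == 1%N) = false by lia.
have n1' : (1%N == m.+1) = false by lia.
apply: vec_eq => k hk.
  rewrite coord_bar // !coord_swap1 //; have [->|kn] := eqVneq k m.+1.
    by rewrite n1 coord_bar // eqxx.
  rewrite !coord_bar // (negPf kn) !bcoord_swap1 ?bcoord_bar //; lia.
rewrite bcoord_bar // coord_swap1 ?bcoord_swap1 ?bcoord_bar //; try lia.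
by case: ifP => // _; rewrite coord_bar ?n1'.
Qed.

Lemma V_swap1 j x y : (0 < j <= m)%N -> V j (swap1 x) (swap1 y) = V j x y.
Proof.
move=> jm; have [Xp Yp] := (@glift_pos _ x, @glift_pos _ y).
have [Xs Ys] := (rep_swap1 m1 (rep_lift x), rep_swap1 m1 (rep_lift y)).
have jm' : (j <= m)%N by case/andP: jm.
apply: growth_unique (growth_gV m1 Xs Ys jm') _.
apply: growth_ext (growth_gV m1 (rep_lift x) (rep_lift y) jm') => t.
by rewrite gV_swap1.
Qed.

Lemma V0_star x y : star (V 0) x y = V 0 x y.
Proof.
by apply: starV0 (rep_lift x) (rep_lift y).
Qed.

Lemma star_V_swap1 j x y : (0 < j <= m)%N ->
  star (V j) (swap1 x) (swap1 y) = star (V j) x y.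
Proof. by move=> jm; rewrite /star !bar_swap_swap1 V_swap1. Qed.

Lemma sigma1_V0_swap1 x y : sigma1 (V 0) (swap1 x) (swap1 y) = V 0 x y.
Proof. by rewrite /sigma1 !swap1K. Qed.

Lemma W_swap1 j x y : (0 < j <= m)%N -> W j (swap1 x) (swap1 y) = W j x y.
Proof.
move=> jm; rewrite /W; have [_|j1] := eqVneq j 1%N.
  by rewrite sigma1_V0_swap1 addrC.
rewrite (_ : m.+1.-1 = m) //; have [_|jm'] := eqVneq j m.
  by rewrite V_swap1 ?star_V_swap1 //; lia.
rewrite !coord_swap1 ?bcoord_swap1 ?(negPf j1) ?V_swap1 ?star_V_swap1 //; lia.
Qed.

Lemma coord_R_fst x y k : (0 < k <= m.+1)%N ->
  coord (R_fst x y) k =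
    if k == 1%N then coord y 1 + sigma1 (V 0) x y - V 1 x y
    else if k == m.+1 then coord y m.+1 + V m x y - star (V m) x y
    else coord y k + V k.-1 x y + W k x y - V k x y - W k.-1 x y.
Proof. exact: coord_mk. Qed.

Lemma bcoord_R_fst x y k : (0 < k <= m)%N ->
  bcoord (R_fst x y) k =
    if k == 1%N then bcoord y 1 + V 0 x y - V 1 x y
    else bcoord y k + V k.-1 x y - V k x y.
Proof. exact: bcoord_mk. Qed.

Lemma coord_R_snd x y k : (0 < k <= m.+1)%N ->
  coord (R_snd x y) k =
    if k == 1%N then coord x 1 + V 0 x y - star (V 1) x y
    else if k == m.+1 then coord x m.+1 + star (V m) x y - V m x y
    else coord x k + star (V k.-1) x y - star (V k) x y.
Proof. exact: coord_mk. Qed.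

Lemma bcoord_R_snd x y k : (0 < k <= m)%N ->
  bcoord (R_snd x y) k =
    if k == 1%N then bcoord x 1 + sigma1 (V 0) x y - star (V 1) x y
    else bcoord x k + star (V k.-1) x y + W k x y - star (V k) x y
         - W k.-1 x y.
Proof. exact: bcoord_mk. Qed.

Let n1 : (m.+1 == 1%N) = false. Proof. by rewrite gtn_eqF // ltnS ltnW. Qed.

Lemma R_fst_swap1 x y : R_fst (swap1 x) (swap1 y) = swap1 (R_fst x y).
Proof.
apply: vec_eq => k hk.
  rewrite coord_swap1 // !coord_R_fst //; have [k1|k1] := eqVneq k 1%N.
    by rewrite coord_swap1 // bcoord_R_fst // sigma1_V0_swap1 V_swap1.
  have [kn|kn] := eqVneq k m.+1.
    by rewrite coord_swap1 // n1 V_swap1 // star_V_swap1.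
  by rewrite coord_swap1 // (negPf k1) !V_swap1 ?W_swap1 //; lia.
rewrite bcoord_swap1 // !bcoord_R_fst //; have [k1|k1] := eqVneq k 1%N.
  by rewrite bcoord_swap1 // coord_R_fst // (V_swap1 _ _ one_in).
by rewrite bcoord_swap1 // (negPf k1) !V_swap1 //; lia.
Qed.

Lemma R_snd_swap1 x y : R_snd (swap1 x) (swap1 y) = swap1 (R_snd x y).
Proof.
apply: vec_eq => k hk.
  rewrite coord_swap1 // !coord_R_snd //; have [k1|k1] := eqVneq k 1%N.
    by rewrite coord_swap1 // bcoord_R_snd // star_V_swap1 // -V0_star
      [star _ _ _]V0_star.
  have [kn|kn] := eqVneq k m.+1.
    by rewrite coord_swap1 // n1 V_swap1 // star_V_swap1.
  by rewrite coord_swap1 // (negPf k1) !star_V_swap1 //; lia.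
rewrite bcoord_swap1 // !bcoord_R_snd //; have [k1|k1] := eqVneq k 1%N.
  by rewrite bcoord_swap1 // coord_R_snd // sigma1_V0_swap1 star_V_swap1.
by rewrite bcoord_swap1 // (negPf k1) !star_V_swap1 ?W_swap1 //; lia.
Qed.

Lemma star_star j x y : star (V j) (bar_swap y) (bar_swap x) = V j x y.
Proof. by rewrite /star !bar_swapK. Qed.

Lemma W_star j x y : (0 < j <= m)%N -> W j (bar_swap y) (bar_swap x) = W j x y.
Proof.
move=> jm; rewrite /W; have [_|j1] := eqVneq j 1%N.
  by rewrite -[V 0 _ _]V0_star star_star /sigma1 -!bar_swap_swap1
    -[V 0 (bar_swap _) _]V0_star star_star.
rewrite (_ : m.+1.-1 = m) //; have [_|jm'] := eqVneq j m.
  by rewrite star_star addrC.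
rewrite !star_star coord_bar ?coord_bar ?bcoord_bar; try lia.
rewrite (_ : (j == m.+1) = false); last by lia.
rewrite [Num.min _ _]minC [Num.max _ _]maxC -/(star (V j) x y).
by rewrite -/(star (V j.-1) x y) [V j.-1 x y + _]addrC [V j x y + _]addrC.
Qed.

Lemma sigma1_V0_star x y :
  sigma1 (V 0) (bar_swap y) (bar_swap x) = sigma1 (V 0) x y.
Proof.
by rewrite /sigma1 -!bar_swap_swap1 -[V 0 (bar_swap _) _]V0_star star_star.
Qed.

Lemma R_fst_star x y : R_fst (bar_swap y) (bar_swap x) = bar_swap (R_snd x y).
Proof.
have n1' : (1%N == m.+1) = false by lia.
apply: vec_eq => k hk.
  rewrite coord_bar // coord_R_fst //; have [kn|kn] := eqVneq k m.+1.
    by rewrite kn n1 coord_R_snd // n1 eqxx coord_bar // eqxx star_star.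
  rewrite bcoord_R_snd; last by lia.
  have [k1|k1] := eqVneq k 1%N.
    by rewrite coord_bar // n1' sigma1_V0_star.
  by rewrite coord_bar // (negPf kn) !W_star //; lia.
have hk' : (0 < k <= m.+1)%N by lia.
rewrite bcoord_bar // coord_R_snd // bcoord_R_fst //.
rewrite (_ : (k == m.+1) = false); last by lia.
have [k1|k1] := eqVneq k 1%N; rewrite bcoord_bar //.
by rewrite -[V 0 (bar_swap _) _]V0_star star_star.
Qed.

Lemma R_snd_star x y : R_snd (bar_swap y) (bar_swap x) = bar_swap (R_fst x y).
Proof.
by apply: (can_inj (@bar_swapK _ m2)); rewrite -R_fst_star !bar_swapK.
Qed.

Lemma e_vec_0 c x : e_vec 0 c x = swap1 (e_vec 1 c (swap1 x)).
Proof.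
have h1 : (1%N == m) = false by lia.
have hn : (1%N == m.+1) = false by lia.
rewrite /e_vec /= h1 hn.
have c2 : coord (swap1 x) 2 = coord x 2 by rewrite coord_swap1.
have b2 : bcoord (swap1 x) 2 = bcoord x 2 by rewrite bcoord_swap1.
have xiE : xi c (swap1 x) 2 = xi c x 2 by rewrite /xi c2 b2.
apply: vec_eq => k hk.
  rewrite coord_swap1 // coord_mk //; have [k0|k1] := eqVneq k 1%N.
    by rewrite bcoord_mk //= ?bcoord_swap1 ?xiE //; lia.
  rewrite coord_mk // (negPf k1) xiE c2.
  by case: ifP => // _; rewrite coord_swap1 // (negPf k1).
rewrite bcoord_swap1 // bcoord_mk //; have [k0|k1] := eqVneq k 1%N.
  by rewrite coord_mk //= coord_swap1 ?xiE.
rewrite bcoord_mk // (negPf k1) xiE b2.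
by case: ifP => // _; rewrite bcoord_swap1 // (negPf k1).
Qed.

Lemma phi_0 x : phi 0 x = phi 1 (swap1 x).
Proof.
have h1 : (1%N == m) = false by lia.
have hn : (1%N == m.+1) = false by lia.
rewrite /phi /= h1 hn.
by rewrite !coord_swap1 ?bcoord_swap1.
Qed.

Lemma eps_0 x : eps 0 x = eps 1 (swap1 x).
Proof.
have h1 : (1%N == m) = false by lia.
have hn : (1%N == m.+1) = false by lia.
rewrite /eps /= h1 hn.
by rewrite !coord_swap1 ?bcoord_swap1 //; lia.
Qed.

(** Star exchanges the nodes n - 1 and n, and reverses the arrows. *)
Lemma e_vec_n c x : e_vec m.+1 c x = bar_swap (e_vec m (- c) (bar_swap x)).
Proof.
have h1 : (m == 0%N) = false by lia.
have hn : (m.+1 == m) = false by lia.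
have hn' : (m == m.+1) = false by lia.
rewrite /e_vec /= h1 hn !eqxx.
apply: vec_eq => k hk.
  rewrite coord_bar // coord_mk //; have [k0|k1] := eqVneq k m.+1.
    by rewrite coord_mk ?leqnn // eqxx hn coord_bar ?leqnn // eqxx opprK.
  by rewrite bcoord_mk ?bcoord_bar //; lia.
rewrite bcoord_bar // bcoord_mk // coord_mk; last by lia.
have [k0|k1] := eqVneq k m; first by rewrite coord_bar ?hn' //; lia.
have kn : (k == m.+1) = false by lia.
by rewrite kn coord_bar ?kn //; lia.
Qed.

Lemma phi_n x : phi m.+1 x = eps m (bar_swap x).
Proof.
have h1 : (m == 0%N) = false by lia.
have hn : (m.+1 == m) = false by lia.
rewrite /phi /eps /= h1 hn !eqxx.
by rewrite coord_bar ?leqnn // eqxx bcoord_bar 1?addrC //; lia.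
Qed.

Lemma eps_n x : eps m.+1 x = phi m (bar_swap x).
Proof.
have h1 : (m == 0%N) = false by lia.
have hn : (m.+1 == m) = false by lia.
rewrite /phi /eps /= h1 hn !eqxx.
have mn : (m == m.+1) = false by lia.
by rewrite coord_bar ?mn //; lia.
Qed.

Theorem R_commutes_vec i c x y : (i <= m.+1)%N ->
  let x' := R_fst x y in let y' := R_snd x y in
  R_fst (e_vec i (tc1 i c x y) x) (e_vec i (tc2 i c x y) y)
    = e_vec i (tc1 i c x' y') x'
  /\ R_snd (e_vec i (tc1 i c x y) x) (e_vec i (tc2 i c x y) y)
    = e_vec i (tc2 i c x' y') y'.
Proof.
move=> im x' y'; have [i0|i0] := posnP i.
  have h1 : (0 < 1 <= m)%N by lia.
  have [e1 e2] := R_commutes_node m2 h1 c (swap1 x) (swap1 y).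
  rewrite i0 /tc1 /tc2 !phi_0 !eps_0 !e_vec_0.
  by rewrite R_fst_swap1 R_snd_swap1 e1 e2 R_fst_swap1 R_snd_swap1.
have [im'|im'] := leqP i m; first by apply: R_commutes_node => //; rewrite i0.
have -> : i = m.+1 by lia.
have h1 : (0 < m <= m)%N by lia.
have [e1 e2] := R_commutes_node m2 h1 (- c) (bar_swap y) (bar_swap x).
have t1 (z t : vec) : tc1 m.+1 c z t = - tc2 m (- c) (bar_swap t) (bar_swap z).
  by rewrite /tc1 /tc2 !phi_n !eps_n; lia.
have t2 (z t : vec) : tc2 m.+1 c z t = - tc1 m (- c) (bar_swap t) (bar_swap z).
  by rewrite /tc1 /tc2 !phi_n !eps_n; lia.
rewrite !t1 !t2 !e_vec_n !opprK R_fst_star R_snd_star.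
by rewrite e1 e2 !R_fst_star !R_snd_star.
Qed.

Theorem R_string x y i : (i <= m.+1)%N ->
  teps i (R_fst x y) (R_snd x y) = teps i x y
  /\ tphi i (R_fst x y) (R_snd x y) = tphi i x y.
Proof.
move=> im; have [i0|i0] := posnP i.
  have h1 : (0 < 1 <= m)%N by lia.
  have [e1 e2] := R_string_node m2 h1 (swap1 x) (swap1 y).
  rewrite i0 /teps /tphi !phi_0 !eps_0.
  by rewrite -R_fst_swap1 -R_snd_swap1; split.
have [im'|im'] := leqP i m; first by apply: R_string_node => //; rewrite i0.
have -> : i = m.+1 by lia.
have h1 : (0 < m <= m)%N by lia.
have [e1 e2] := R_string_node m2 h1 (bar_swap y) (bar_swap x).
rewrite /teps /tphi !phi_n !eps_n -R_fst_star -R_snd_star.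
by split.
Qed.

End Symmetries.

(** * Strings in the crystals and in their tensor products *)

Section CrystalStrings.
Variable m : nat.
Hypothesis m2 : (2 < m)%N.
Local Notation vec := (Defs.vec m.+1).
Implicit Types (x y : vec) (i j k l : nat) (c : int).

Lemma in_crystalP l x :
  reflect [/\ forall k, (0 < k <= m)%N -> 0 <= coord x k /\ 0 <= bcoord x k,
              - Num.min (coord x m) (bcoord x m) <= coord x m.+1
            & \sum_(1 <= k < m.+1) (coord x k + bcoord x k) + coord x m.+1 = l%:Z]
          (in_crystal l x).
Proof.
rewrite /in_crystal (_ : m.+1.-1 = m) //; apply: (iffP and3P).
  move=> [/allP h1 h2 /eqP h3]; split=> // k hk.
  by apply/andP; apply: h1; rewrite mem_index_iota.
move=> [h1 h2 h3]; split; [|exact: h2|exact/eqP].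
by apply/allP => k; rewrite mem_index_iota => hk; apply/andP/h1.
Qed.

Lemma phi_ge0 l i x : (i <= m.+1)%N -> in_crystal l x -> 0 <= phi i x.
Proof.
move=> im /in_crystalP[h1 h2 _]; rewrite /phi /posp (_ : m.+1.-1 = m) //.
case: eqP => [_|i0]; first by have := h1 1%N; lia.
case: eqP => [_|i1]; first by have := h1 m; lia.
case: eqP => [_|i2]; first by lia.
by have := h1 i; lia.
Qed.

Lemma eps_ge0 l i x : (i <= m.+1)%N -> in_crystal l x -> 0 <= eps i x.
Proof.
move=> im /in_crystalP[h1 h2 _]; rewrite /eps /posp (_ : m.+1.-1 = m) //.
case: eqP => [_|i0]; first by have := h1 1%N; lia.
case: eqP => [_|i1]; first by have := h1 m; lia.
case: eqP => [_|i2]; first by have := h1 m; lia.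
by have := h1 i; lia.
Qed.

Section Node.
Variable i : nat.
Hypothesis im : (0 < i <= m)%N.

Let i0F : (i == 0%N) = false. Proof. by lia. Qed.
Let inF : (i == m.+1) = false. Proof. by lia. Qed.

Lemma coord_e c x k : (0 < k <= m.+1)%N ->
  coord (e_vec i c x) k =
    if i == m then
      if k == m then coord x m + c
      else if k == m.+1 then coord x m.+1 - c else coord x k
    else if k == i then coord x i - xi c x i.+1 + c
    else if k == i.+1 then coord x i.+1 + xi c x i.+1 - c else coord x k.
Proof.
move=> hk; rewrite /e_vec i0F inF (_ : m.+1.-1 = m) //.
by case: ifP => _; rewrite coord_mk.
Qed.

Lemma bcoord_e c x k : (0 < k <= m)%N ->
  bcoord (e_vec i c x) k =
    if i == m then bcoord x k
    else if k == i then bcoord x i - xi c x i.+1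
    else if k == i.+1 then bcoord x i.+1 + xi c x i.+1 else bcoord x k.
Proof.
move=> hk; rewrite /e_vec i0F inF (_ : m.+1.-1 = m) //.
by case: ifP => _; rewrite bcoord_mk.
Qed.

Lemma phi_node x :
  phi i x = if i == m then coord x m
            else coord x i + posp (bcoord x i.+1 - coord x i.+1).
Proof. by rewrite /phi i0F inF. Qed.

Lemma eps_node x :
  eps i x = if i == m then coord x m.+1 + bcoord x m
            else bcoord x i + posp (coord x i.+1 - bcoord x i.+1).
Proof. by rewrite /eps i0F inF. Qed.

Lemma sum_e c x :
  \sum_(1 <= k < m.+1) (coord (e_vec i c x) k + bcoord (e_vec i c x) k)
    + coord (e_vec i c x) m.+1
  = \sum_(1 <= k < m.+1) (coord x k + bcoord x k) + coord x m.+1.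
Proof.
have [e|ne] := eqVneq i m.
  rewrite !(big_nat_recr m) /=; try lia.
  rewrite !coord_e ?bcoord_e; try lia.
  rewrite (introT eqP e) !eqxx (_ : (m.+1 == m) = false); last by lia.
  rewrite (eq_big_nat _ _ (F2 := fun k => coord x k + bcoord x k)).
    by ring.
  move=> k hk; rewrite coord_e ?bcoord_e; try lia.
  by rewrite (introT eqP e) !ltn_eqF //; lia.
congr (_ + _); last first.
  by rewrite coord_e ?(negPf ne) ?gtn_eqF //; lia.
apply: (eq_big_nat2 (i := i)); try lia.
  move=> k hk ki ki1; rewrite coord_e ?bcoord_e; try lia.
  by rewrite (negPf ne) (negPf ki) (negPf ki1).
rewrite /= !coord_e ?bcoord_e; try lia.
rewrite (negPf ne) !eqxx (_ : (i.+1 == i) = false); last by lia.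
by lia.
Qed.

Lemma phi_eps_e c x : phi i (e_vec i c x) = phi i x + c
  /\ eps i (e_vec i c x) = eps i x - c.
Proof.
rewrite !phi_node !eps_node; have [e|ne] := eqVneq i m.
  rewrite !coord_e ?bcoord_e; try lia.
  by rewrite e !eqxx (_ : (m.+1 == m) = false); lia.
rewrite !coord_e ?bcoord_e; try lia.
rewrite (negPf ne) !eqxx (_ : (i.+1 == i) = false); last by lia.
by rewrite /xi /posp; lia.
Qed.

Lemma e_vecK_node c x : e_vec i (- c) (e_vec i c x) = x.
Proof.
have [e|ne] := eqVneq i m.
  have eim := introT eqP e; have mn : (m.+1 == m) = false by lia.
  apply: vec_eq => k hk; last by rewrite bcoord_e // eim bcoord_e // eim.
  rewrite coord_e // eim; case: eqP => [->|km].
    by rewrite coord_e ?eim ?eqxx; lia.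
  case: eqP => [->|/eqP kn]; first by rewrite coord_e ?eim ?eqxx ?mn; lia.
  by rewrite coord_e // eim (negPf kn); move/eqP/negPf: km => ->.
have i1F : (i.+1 == i) = false by lia.
have xiE : xi (- c) (e_vec i c x) i.+1 = - xi c x i.+1.
  rewrite /xi coord_e ?bcoord_e; try lia.
  by rewrite (negPf ne) i1F eqxx /xi; lia.
apply: vec_eq => k hk.
  rewrite coord_e // xiE !coord_e; try lia.
  rewrite (negPf ne) i1F !eqxx; case: eqP => [->|ki]; first by lia.
  by case: eqP => [->|ki1]; lia.
rewrite bcoord_e // xiE !bcoord_e; try lia.
rewrite (negPf ne) i1F !eqxx; case: eqP => [->|ki]; first by lia.
by case: eqP => [->|ki1]; lia.
Qed.

(** For i < m, the coordinates of e_i^c x are nonnegative as soon as xb_i and x_i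
are, and the condition on x_n is unaffected because e_i preserves
min(x_(i+1), xb_(i+1)). *)
Lemma in_crystal_e_node l c x : in_crystal l x ->
  in_crystal l (e_vec i c x) = (- phi i x <= c <= eps i x).
Proof.
move=> /in_crystalP[h1 h2 h3]; rewrite phi_node eps_node.
have [e|ne] := eqVneq i m.
  have [hm hmb] : 0 <= coord x m /\ 0 <= bcoord x m by apply: h1; lia.
  have mn : (m.+1 == m) = false by lia.
  apply/in_crystalP/idP => [[g1 g2 _]|g].
    have [] := g1 m; first by lia.
    move: g2; rewrite !coord_e ?bcoord_e; try lia.
    by rewrite e !eqxx mn; lia.
  split; rewrite ?sum_e //.
    move=> k hk; rewrite coord_e ?bcoord_e; try lia.
    have := h1 k hk; rewrite e eqxx; case: eqP => [->|km]; first by lia.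
    by rewrite (_ : (k == m.+1) = false); lia.
  rewrite !coord_e ?bcoord_e; try lia.
  by rewrite e !eqxx mn; lia.
have [hi hib] : 0 <= coord x i /\ 0 <= bcoord x i by apply: h1; lia.
have [hj hjb] : 0 <= coord x i.+1 /\ 0 <= bcoord x i.+1 by apply: h1; lia.
have i1F : (i.+1 == i) = false by lia.
have mn : (m.+1 == i.+1) = false by lia.
have mi : (m.+1 == i) = false by lia.
have mi' : (m == i) = false by lia.
apply/in_crystalP/idP => [[g1 g2 _]|g].
  have [] := g1 i; first by lia.
  have [] := g1 i.+1; first by lia.
  rewrite !coord_e ?bcoord_e; try lia.
  by rewrite (negPf ne) i1F !eqxx /xi /posp; lia.
split; rewrite ?sum_e //.
  move=> k hk; rewrite coord_e ?bcoord_e; try lia.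
  have := h1 k hk; rewrite (negPf ne).
  case: eqP => [->|ki]; first by move: g; rewrite /xi /posp; lia.
  by case: eqP => [->|//]; move: g; rewrite /xi /posp; lia.
rewrite !coord_e ?bcoord_e; try lia.
rewrite (negPf ne) mn mi mi'.
case: eqP => [e'|//]; have := congr1 (coord x) e'.
by have := congr1 (bcoord x) e'; rewrite /xi; lia.
Qed.

End Node.
End CrystalStrings.

Section TensorSteps.
Variable m : nat.
Hypothesis m2 : (2 < m)%N.
Local Notation vec := (Defs.vec m.+1).
Implicit Types (x y : vec) (i j k l : nat) (c : int) (p q : vec * vec).

Let n_in : (0 < m.+1 <= m.+1)%N. Proof. exact: leqnn. Qed.
Let one_in : (0 < 1 <= m)%N. Proof. exact: ltnW (ltnW m2). Qed.
Let m_in : (0 < m <= m)%N. Proof. by rewrite leqnn (ltnW (ltnW m2)). Qed.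

Lemma in_crystal_swap1_imp l x : in_crystal l x -> in_crystal l (swap1 x).
Proof.
move=> /in_crystalP[h1 h2 h3].
have m1F : (m == 1%N) = false by lia.
have n1F : (m.+1 == 1%N) = false by lia.
apply/in_crystalP; split.
- move=> k hk; rewrite coord_swap1 ?bcoord_swap1 //; last by lia.
  by case: ifP => _; [have := h1 1%N|have := h1 k]; lia.
- by rewrite !coord_swap1 ?bcoord_swap1 ?m1F ?n1F //; lia.
rewrite -h3 coord_swap1 // n1F; congr (_ + _).
apply: eq_big_nat => k hk; rewrite coord_swap1 ?bcoord_swap1 //; last by lia.
by case: eqP => [->|//]; rewrite addrC.
Qed.

Lemma in_crystal_swap1 l x : in_crystal l (swap1 x) = in_crystal l x.
Proof.
apply/idP/idP; last exact: in_crystal_swap1_imp.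
by rewrite -{2}[x](swap1K m2); apply: in_crystal_swap1_imp.
Qed.

Lemma in_crystal_bar_imp l x : in_crystal l x -> in_crystal l (bar_swap x).
Proof.
move=> /in_crystalP[h1 h2 h3].
have cb k : (0 < k <= m)%N -> coord (bar_swap x) k = bcoord x k.
  by move=> hk; rewrite coord_bar ?(ltn_eqF (_ : k < m.+1)%N) //; lia.
have cn : coord (bar_swap x) m.+1 = coord x m.+1 by rewrite coord_bar // eqxx.
apply/in_crystalP; split.
- by move=> k hk; rewrite cb ?bcoord_bar //; have := h1 k; lia.
- by rewrite cn cb ?bcoord_bar // minC.
rewrite -h3 cn; congr (_ + _).
by apply: eq_big_nat => k hk; rewrite cb ?bcoord_bar 1?addrC.
Qed.

Lemma in_crystal_bar l x : in_crystal l (bar_swap x) = in_crystal l x.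
Proof.
apply/idP/idP; last exact: in_crystal_bar_imp.
by rewrite -{2}[x](bar_swapK m2); apply: in_crystal_bar_imp.
Qed.

Lemma phi_eps_e_vec i c x : (i <= m.+1)%N ->
  phi i (e_vec i c x) = phi i x + c /\ eps i (e_vec i c x) = eps i x - c.
Proof.
move=> im; have [->|i0] := posnP i.
  rewrite !phi_0 // !eps_0 // e_vec_0 // swap1K //.
  exact: phi_eps_e.
have [im'|im'] := leqP i m; first by apply: phi_eps_e => //; rewrite i0.
have -> : i = m.+1 by lia.
rewrite !phi_n // !eps_n // e_vec_n // bar_swapK //.
by have [-> ->] := phi_eps_e m2 m_in (- c) (bar_swap x); rewrite opprK.
Qed.

Lemma e_vecK i c x : (i <= m.+1)%N -> e_vec i (- c) (e_vec i c x) = x.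
Proof.
move=> im; have [->|i0] := posnP i.
  by rewrite !e_vec_0 // swap1K // e_vecK_node // swap1K.
have [im'|im'] := leqP i m; first by apply: e_vecK_node => //; rewrite i0.
have -> : i = m.+1 by lia.
by rewrite !e_vec_n // bar_swapK // e_vecK_node // bar_swapK.
Qed.

Lemma in_crystal_e l i c x : (i <= m.+1)%N -> in_crystal l x ->
  in_crystal l (e_vec i c x) = (- phi i x <= c <= eps i x).
Proof.
move=> im xl; have [->|i0] := posnP i.
  rewrite e_vec_0 // in_crystal_swap1 phi_0 // eps_0 //.
  by apply: in_crystal_e_node => //; rewrite in_crystal_swap1.
have [im'|im'] := leqP i m; first by apply: in_crystal_e_node => //; rewrite i0.
have -> : i = m.+1 by lia.
rewrite e_vec_n // in_crystal_bar phi_n // eps_n //.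
by rewrite in_crystal_e_node ?in_crystal_bar //; lia.
Qed.

Definition tstep i c p : vec * vec :=
  (e_vec i (tc1 i c p.1 p.2) p.1, e_vec i (tc2 i c p.1 p.2) p.2).

Definition in_tensor l k p : bool := in_crystal l p.1 && in_crystal k p.2.

Lemma tstepK i c p : (i <= m.+1)%N -> tstep i (- c) (tstep i c p) = p.
Proof.
case: p => x y im; rewrite /tstep /=.
set c1 := tc1 i c x y; set c2 := tc2 i c x y.
have [f1 _] := phi_eps_e_vec c1 x im; have [_ g2] := phi_eps_e_vec c2 y im.
have -> : tc1 i (- c) (e_vec i c1 x) (e_vec i c2 y) = - c1.
  by rewrite {1}/tc1 f1 g2 /c1 /c2 /tc1 /tc2; lia.
have -> : tc2 i (- c) (e_vec i c1 x) (e_vec i c2 y) = - c2.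
  by rewrite {1}/tc2 f1 g2 /c1 /c2 /tc1 /tc2; lia.
by rewrite !e_vecK.
Qed.

Lemma in_tensor_tstep l k i c p : (i <= m.+1)%N -> in_tensor l k p ->
  in_tensor l k (tstep i c p) = (- tphi i p.1 p.2 <= c <= teps i p.1 p.2).
Proof.
move=> im /andP[xl yk]; rewrite /in_tensor !in_crystal_e //.
have := phi_ge0 m2 im xl; have := eps_ge0 m2 im xl.
have := phi_ge0 m2 im yk; have := eps_ge0 m2 im yk.
by rewrite /tc1 /tc2 /tphi /teps /posp; lia.
Qed.

Definition tval l k (p : tensor m.+1 l k) : vec * vec := (val p.1, val p.2).

Lemma tval_inj l k : injective (@tval l k).
Proof. by move=> [x y] [z t] [/val_inj-> /val_inj->]. Qed.

Lemma tval_in l k (p : tensor m.+1 l k) : in_tensor l k (tval p).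
Proof. by rewrite /in_tensor (valP p.1) (valP p.2). Qed.

(** Working with vectors, where all operators are defined everywhere, the
partiality of e_tensor reduces to membership in the crystals. *)
Lemma e_tensor_SomeP l k i c (p q : tensor m.+1 l k) :
  e_tensor i c p = Some q <-> tval q = tstep i c (tval p).
Proof.
case: p q => [x y] [z t]; rewrite /e_tensor /e_op /tstep /tval /=.
case: insubP => [u _ uE|zl]; last first.
  by split=> // -[zE _]; rewrite -zE (valP z) in zl.
case: insubP => [v _ vE|tl]; last first.
  by split=> // -[_ tE]; rewrite -tE (valP t) in tl.
split=> [[<- <-]|[zE tE]]; first by rewrite uE vE.
by congr (Some (_, _)); apply: val_inj; rewrite ?uE ?vE.
Qed.

Lemma e_tensor_NoneP l k i c (p : tensor m.+1 l k) :
  e_tensor i c p = None <-> ~~ in_tensor l k (tstep i c (tval p)).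
Proof.
split=> [pN|okN]; last first.
  case pE: (e_tensor i c p) => [q|//].
  by move: okN; rewrite -((e_tensor_SomeP i c p q).1 pE) tval_in.
apply/negP => /andP[h1 h2].
pose q : tensor m.+1 l k := (Sub _ h1, Sub _ h2).
have : tval q = tstep i c (tval p) by rewrite /tval !SubK -surjective_pairing.
by move/(e_tensor_SomeP i c p q); rewrite pN.
Qed.

(** The equivalence relation generated by the arrows.  Quantifying over the
properties closed under forward arrows is enough, because e_i^(-c) is the
inverse of e_i^c (conn_sym). *)
Definition conn l k p q : Prop := forall P : vec * vec -> Prop,
  (forall r i c, (i <= m.+1)%N -> in_tensor l k r -> in_tensor l k (tstep i c r) ->
     P r -> P (tstep i c r)) -> P p -> P q.

Lemma conn_trans l k p q r : conn l k p q -> conn l k q r -> conn l k p r.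
Proof. by move=> pq qr P hP /(pq P hP)/(qr P hP). Qed.

Lemma conn_step l k i c p : (i <= m.+1)%N -> in_tensor l k p ->
  in_tensor l k (tstep i c p) -> conn l k p (tstep i c p).
Proof. by move=> im pok qok P hP; apply: hP. Qed.

Lemma conn_sym l k p q : conn l k p q -> conn l k q p.
Proof.
move=> pq P hP; refine (pq (fun r => P r -> P p) _ id) => r i c im rok sok IH Ps.
by apply: IH; rewrite -(tstepK c r im); apply: hP; rewrite ?tstepK.
Qed.

End TensorSteps.

(** * The tensor product is connected *)

Section Connectedness.
Variable m : nat.
Hypothesis m2 : (2 < m)%N.
Local Notation vec := (Defs.vec m.+1).
Implicit Types (x y : vec) (i j k l : nat) (p q : vec * vec).

Let n_in : (0 < m.+1 <= m.+1)%N. Proof. exact: leqnn. Qed.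
Let one_in : (0 < 1 <= m)%N. Proof. exact: ltnW (ltnW m2). Qed.
Let m_in : (0 < m <= m)%N. Proof. by rewrite leqnn (ltnW (ltnW m2)). Qed.

Lemma sum_last l x : in_crystal l x ->
  \sum_(1 <= k < m) (coord x k + bcoord x k)
    + (coord x m + bcoord x m + coord x m.+1) = l%:Z.
Proof.
move=> /in_crystalP[_ _ <-].
have h1 : (0 < m)%N by lia.
by rewrite (big_nat_recr m 1 _ h1) /= !addrA.
Qed.

Lemma last_ge l x : in_crystal l x ->
  coord x m <= coord x m + bcoord x m + coord x m.+1
  /\ bcoord x m <= coord x m + bcoord x m + coord x m.+1.
Proof. by move=> /in_crystalP[h1 h2 _]; have := h1 m m_in; lia. Qed.

(** A linear form that increases by c under e_i^c for every i >= 1. *)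
Definition height x : int :=
  \sum_(1 <= k < m.+1) (m.+1 - k)%N%:Z * (coord x k - bcoord x k).

Lemma height_le l x : in_crystal l x -> height x <= m.+1%:Z * l%:Z.
Proof.
move=> xl; rewrite -(sum_last xl) mulrDr /height.
rewrite big_nat_recr /=; last by rewrite ltnW // ltnW.
have [h1 h2] := last_ge xl; move/in_crystalP: xl => [h _ _].
apply: lerD; last by have := h m m_in; rewrite subSnn; nia.
rewrite mulr_sumr; apply: ler_sum_nat => k hk.
have [c0 b0] : 0 <= coord x k /\ 0 <= bcoord x k by apply: h; lia.
have : (m.+1 - k)%N%:Z <= m.+1%:Z by lia.
have : 0 <= (m.+1 - k)%N%:Z by lia.
move: (m.+1 - k)%N%:Z (coord x k) (bcoord x k) c0 b0 m.+1%:Z => a c b c0 b0 d ad a0.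
by nia.
Qed.

Lemma height_e i c x : (0 < i <= m.+1)%N ->
  height (e_vec i c x) = height x + c.
Proof.
move=> im.
have delta j : (0 < j <= m)%N -> \sum_(1 <= k < m.+1) (if k == j then c else 0) = c.
  by move=> hj; rewrite -big_mkcond big_nat1_eq hj.
have [im'|im'] := leqP i m; last first.
  have -> : i = m.+1 by lia.
  rewrite -[in RHS](delta m m_in) /height -big_split; apply: eq_big_nat => k hk /=.
  have km : (k == m.+1) = false by lia.
  rewrite /e_vec /= (_ : (m.+1 == m) = false) ?eqxx; last by lia.
  rewrite coord_mk ?bcoord_mk ?km; try lia.
  by case: eqP => [->|_]; rewrite ?subSnn; lia.
have hi : (0 < i <= m)%N by lia.
rewrite -[in RHS](delta i hi) /height -big_split.
have [e|ne] := eqVneq i m.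
  apply: eq_big_nat => k hk /=; rewrite coord_e ?bcoord_e; try lia.
  rewrite (introT eqP e) e (_ : (k == m.+1) = false); last by lia.
  by case: eqP => [->|_]; rewrite ?subSnn; lia.
apply: (eq_big_nat2 (i := i)); try lia.
  move=> k hk ki ki1; rewrite coord_e ?bcoord_e; try lia.
  by rewrite /= (negPf ne) (negPf ki) (negPf ki1) addr0.
rewrite /= !coord_e ?bcoord_e; try lia.
rewrite (negPf ne) !eqxx (_ : (i.+1 == i) = false); last by lia.
rewrite subSS (_ : (m.+1 - i)%N = (m - i).+1); last by lia.
by rewrite -addn1 PoszD; ring.
Qed.

Lemma coord1_e i c x : (1 < i <= m.+1)%N ->
  coord (e_vec i c x) 1 = coord x 1 /\ bcoord (e_vec i c x) 1 = bcoord x 1.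
Proof.
move=> im; have m1F : (1%N == m) = false by lia.
have n1F : (1%N == m.+1) = false by lia.
have [i1 i2 i0] : [/\ (1%N == i) = false, (1%N == i.+1) = false & (i == 0%N) = false].
  by split; lia.
rewrite /e_vec i0; case: ifP => _; first by rewrite coord_mk // bcoord_mk //= m1F n1F.
case: ifP => _; first by rewrite coord_mk // bcoord_mk //= n1F m1F.
by rewrite coord_mk // bcoord_mk //= i1 i2.
Qed.

Lemma teps_ge0 l k i p : (i <= m.+1)%N -> in_tensor l k p -> 0 <= teps i p.1 p.2.
Proof.
move=> im /andP[h _]; have := eps_ge0 m2 im h.
by rewrite /teps /posp; lia.
Qed.

Lemma tphi_ge0 l k i p : (i <= m.+1)%N -> in_tensor l k p -> 0 <= tphi i p.1 p.2.
Proof.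
move=> im /andP[_ h]; have := phi_ge0 m2 im h.
by rewrite /tphi /posp; lia.
Qed.

Definition same1 p q : Prop :=
  [/\ coord q.1 1 = coord p.1 1, bcoord q.1 1 = bcoord p.1 1,
      coord q.2 1 = coord p.2 1 & bcoord q.2 1 = bcoord p.2 1].

(** Apply the operators e_i, a <= i, as long as possible; the height is bounded.
For a = 1 this leads to elements that are highest for the nodes 1, ..., n, and
for a = 2 it does not touch the coordinates of index 1. *)
Lemma raise a l k p : (0 < a)%N -> in_tensor l k p ->
  exists q, [/\ in_tensor l k q, conn l k p q,
    forall i, (a <= i <= m.+1)%N -> teps i q.1 q.2 = 0
    & (1 < a)%N -> same1 p q].
Proof.
move=> a0.
have [N] := ubnP (absz (m.+1%:Z * l%:Z + m.+1%:Z * k%:Z - height p.1 - height p.2)%R).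
elim: N p => // N IH p hN pok.
have [/allP h|/allPn[i]] :=
    boolP (all (fun i => teps i p.1 p.2 == 0) (index_iota a m.+2)).
  exists p; split=> // i hi; apply/eqP/h; rewrite mem_index_iota; lia.
rewrite mem_index_iota => hi t0; have im : (i <= m.+1)%N by lia.
set c := teps i p.1 p.2 in t0; have c0 := teps_ge0 im pok.
have f0 := tphi_ge0 im pok.
have qok : in_tensor l k (tstep i c p).
  by rewrite (in_tensor_tstep m2 _ im pok) lexx andbT -/c; lia.
have [hp1 hp2] := (height_le (andP pok).1, height_le (andP pok).2).
have [hq1 hq2] := (height_le (andP qok).1, height_le (andP qok).2).
have hi' : (0 < i <= m.+1)%N by lia.
have hq : height (tstep i c p).1 + height (tstep i c p).2
        = height p.1 + height p.2 + c.
  by rewrite /= !height_e // /tc1 /tc2; lia.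
have dec : (absz (m.+1%:Z * l%:Z + m.+1%:Z * k%:Z - height (tstep i c p).1
                  - height (tstep i c p).2)%R < N)%N.
  by move: hN t0 c0; rewrite -/c; lia.
have [q [q1 q2 q3 q4]] := IH (tstep i c p) dec qok.
exists q; split=> //.
  by apply: conn_trans q2; apply: conn_step.
move=> a1; have [e1 e2 e3 e4] := q4 a1; have hi1 : (1 < i <= m.+1)%N by lia.
have [d1 d2] := coord1_e (tc1 i c p.1 p.2) p.1 hi1.
have [d3 d4] := coord1_e (tc2 i c p.1 p.2) p.2 hi1.
by split; rewrite ?e1 ?e2 ?e3 ?e4 ?d1 ?d2 ?d3 ?d4.
Qed.

End Connectedness.

Section Paths.
Variable m : nat.
Hypothesis m2 : (2 < m)%N.
Local Notation vec := (Defs.vec m.+1).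
Implicit Types (x y : vec) (i j k l : nat) (p q : vec * vec).

Let n_in : (0 < m.+1 <= m.+1)%N. Proof. exact: leqnn. Qed.
Let one_in : (0 < 1 <= m)%N. Proof. exact: ltnW (ltnW m2). Qed.
Let two_in : (0 < 2 <= m)%N. Proof. exact: ltnW m2. Qed.
Let m_in : (0 < m <= m)%N. Proof. by rewrite leqnn (ltnW (ltnW m2)). Qed.

(** The vectors whose only nonzero coordinates are x_1, x_2, xb_2, xb_1; all the
explicit paths below go through such vectors. *)
Definition vec4 (a b c d : int) : vec :=
  mkvec m.+1 (fun k => if k == 1%N then a else if k == 2%N then b else 0)
             (fun k => if k == 1%N then d else if k == 2%N then c else 0).

Lemma coord_vec4 a b c d k : (0 < k <= m.+1)%N ->
  coord (vec4 a b c d) k = if k == 1%N then a else if k == 2%N then b else 0.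
Proof. exact: coord_mk. Qed.

Lemma bcoord_vec4 a b c d k : (0 < k <= m)%N ->
  bcoord (vec4 a b c d) k = if k == 1%N then d else if k == 2%N then c else 0.
Proof. exact: bcoord_mk. Qed.

Lemma in_crystal_vec4 l a b c d : in_crystal l (vec4 a b c d) =
  [&& 0 <= a, 0 <= b, 0 <= c, 0 <= d & a + b + c + d == l%:Z].
Proof.
have [e1 e2] : (m == 1%N) = false /\ (m == 2%N) = false by lia.
have [e3 e4] : (m.+1 == 1%N) = false /\ (m.+1 == 2%N) = false by lia.
have sE : \sum_(1 <= k < m.+1)
    (coord (vec4 a b c d) k + bcoord (vec4 a b c d) k)
    + coord (vec4 a b c d) m.+1 = a + b + c + d.
  rewrite big_ltn; last by lia.
  rewrite big_ltn; last by lia.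
  rewrite big_nat_cond big1 => [|k /andP[hk _]]; last first.
    rewrite coord_vec4 ?bcoord_vec4; try lia.
    by rewrite !gtn_eqF //; lia.
  by rewrite !coord_vec4 ?bcoord_vec4 // e3 e4 /=; lia.
apply/in_crystalP/idP => [[h _ s]|s].
  have := h 1%N one_in; have := h 2%N two_in.
  by rewrite !coord_vec4 ?bcoord_vec4 //= -s sE; lia.
split; last by rewrite sE; lia.
- move=> k hk; rewrite coord_vec4 ?bcoord_vec4 //; last by lia.
  by split; do 2?case: ifP => //; lia.
- by rewrite !coord_vec4 ?bcoord_vec4 ?e1 ?e2 ?e3 ?e4 //; lia.
Qed.

Lemma hw_vec4 l : hw_vec m.+1 l = vec4 l%:Z 0 0 0.
Proof.
apply: vec_eq => k hk; rewrite ?coord_vec4 ?bcoord_vec4 // ?coord_mk ?bcoord_mk //.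
  by case: ifP => // _; case: ifP.
by case: ifP => // _; case: ifP.
Qed.

Lemma vec4_eqP x : (forall k, (2 < k <= m)%N -> coord x k = 0 /\ bcoord x k = 0) ->
  coord x m.+1 = 0 ->
  x = vec4 (coord x 1) (coord x 2) (bcoord x 2) (bcoord x 1).
Proof.
move=> h hn; apply: vec_eq => k hk; rewrite ?coord_vec4 ?bcoord_vec4 //.
  case: eqP => [->|k1] //; case: eqP => [->|k2] //.
  have [->//|kn] := eqVneq k m.+1.
  by apply: (h k _).1; lia.
case: eqP => [->|k1] //; case: eqP => [->|k2] //.
by apply: (h k _).2; lia.
Qed.

Lemma vec4_only_first l x : in_crystal l x -> coord x 1 + bcoord x 1 = l%:Z ->
  x = vec4 (coord x 1) 0 0 (bcoord x 1).
Proof.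
move=> xl s1; have := sum_last m2 xl; have [h1 h2] := last_ge m2 xl.
have /in_crystalP[h h3 _] := xl; have [hm hmb] := h m m_in.
rewrite big_ltn ?s1; last by lia.
set r := \sum_(2 <= k < m) _ => s.
have r0 : 0 <= r.
  rewrite /r big_nat_cond; apply: sumr_ge0 => k hk.
  by have := h k; lia.
have zero k : (1 < k <= m)%N -> coord x k = 0 /\ bcoord x k = 0.
  move=> hk; have [km|km] := eqVneq k m; first by rewrite km; lia.
  have [c0 b0] : 0 <= coord x k /\ 0 <= bcoord x k by apply: h; lia.
  have : coord x k + bcoord x k <= r.
    rewrite /r (bigD1_seq k) ?iota_uniq ?mem_index_iota //=; last by lia.
    rewrite lerDl big_seq_cond; apply: sumr_ge0 => j.
    by rewrite mem_index_iota => hj; have := h j; lia.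
  by lia.
have z2 := zero 2 two_in.
rewrite [LHS]vec4_eqP ?z2.1 ?z2.2 //; last by have := zero m; lia.
by move=> k hk; apply: zero; lia.
Qed.

(** The highest elements for the nodes 2, ..., n. *)
Lemma vec4_upper_trivial l x : in_crystal l x ->
  (forall i, (1 < i <= m.+1)%N -> eps i x = 0) ->
  x = vec4 (coord x 1) (coord x 2) 0 (bcoord x 1).
Proof.
move=> xl h0; have /in_crystalP[h h3 _] := xl.
have e_n := h0 m.+1; have e_m := h0 m.
rewrite /eps /= eqxx in e_n; rewrite (_ : (m.+1 == m) = false) in e_n; last by lia.
rewrite eps_node // eqxx in e_m.
have bm : bcoord x m = 0 by apply: e_n; lia.
have cn : coord x m.+1 = 0 by have := e_m; rewrite bm; lia.
have step i : (1 < i < m)%N ->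
    bcoord x i = 0 /\ coord x i.+1 <= bcoord x i.+1.
  move=> hi; have := h0 i; rewrite eps_node //; last by lia.
  rewrite (_ : (i == m) = false); last by lia.
  by have := h i; rewrite /posp; lia.
have bz i : (1 < i <= m)%N -> bcoord x i = 0.
  move=> hi; have [->//|im] := eqVneq i m.
  by apply: (step i _).1; lia.
have cz i : (2 < i <= m)%N -> coord x i = 0.
  case: i => // i hi; have := h i.+1; have := step i.
  by have := bz i.+1; lia.
rewrite [LHS]vec4_eqP // ?(bz 2 two_in) // => k hk.
by rewrite cz ?bz //; lia.
Qed.

Lemma teps0 l k i p : (i <= m.+1)%N -> in_tensor l k p -> teps i p.1 p.2 = 0 ->
  eps i p.1 = 0 /\ eps i p.2 <= phi i p.1.
Proof.
move=> im /andP[h1 h2]; have := eps_ge0 m2 im h1.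
by rewrite /teps /posp; lia.
Qed.

Lemma phi_first a d i : (1 < i <= m.+1)%N -> phi i (vec4 a 0 0 d) = 0.
Proof.
move=> hi; have z k : (1 < k <= m.+1)%N -> coord (vec4 a 0 0 d) k = 0.
  by move=> hk; rewrite coord_vec4; [case: eqP; [lia|case: ifP]|lia].
have zb k : (1 < k <= m)%N -> bcoord (vec4 a 0 0 d) k = 0.
  by move=> hk; rewrite bcoord_vec4; [case: eqP; [lia|case: ifP]|lia].
rewrite /phi (_ : m.+1.-1 = m) //; case: eqP => [|_]; first by lia.
case: eqP => [_|i1]; first by rewrite z //; lia.
case: eqP => [_|i2]; first by rewrite !z //; lia.
by rewrite !z ?zb /posp //; lia.
Qed.

(** The second factor is trivial for the nodes 2, ..., n, so raising acts on the
first factor alone; it reaches an element determined by x_1 and xb_1.  Thus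
xb_2 can be moved to x_2 at once, without an explicit path through all the
coordinates. *)
Lemma straighten_left l k a b c d a' d' :
  in_tensor l k (vec4 a b c d, vec4 a' 0 0 d') ->
  conn l k (vec4 a b c d, vec4 a' 0 0 d') (vec4 a (b + c) 0 d, vec4 a' 0 0 d').
Proof.
move=> pok; have [q [qok pq qe s1]] := raise m2 (isT : (0 < 2)%N) pok.
have [e1 e2 e3 e4] := s1 isT; case/andP: (qok) => q1 q2; case/andP: (pok) => p1 p2.
rewrite /= !coord_vec4 // !bcoord_vec4 //= in e1 e2 e3 e4.
have q2E : q.2 = vec4 a' 0 0 d'.
  rewrite -e3 -e4; apply: vec4_only_first q2 _.
  by move: p2; rewrite /= in_crystal_vec4 e3 e4; lia.
have q1E : q.1 = vec4 a (b + c) 0 d.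
  have [b1 q1E'] : exists b1, q.1 = vec4 a b1 0 d.
    exists (coord q.1 2); rewrite -{1}e1 -{1}e2; apply: vec4_upper_trivial q1 _ => i hi.
    by have [|-> //] := teps0 _ qok (qe i hi); lia.
  rewrite q1E'; congr (vec4 _ _ _ _).
  by move: p1 q1; rewrite q1E' /= !in_crystal_vec4; lia.
by rewrite [q]surjective_pairing q1E q2E in pq.
Qed.

Lemma straighten_right l k a b c d a' d' :
  in_tensor l k (vec4 a' 0 0 d', vec4 a b c d) ->
  conn l k (vec4 a' 0 0 d', vec4 a b c d) (vec4 a' 0 0 d', vec4 a (b + c) 0 d).
Proof.
move=> pok; have [q [qok pq qe s1]] := raise m2 (isT : (0 < 2)%N) pok.
have [e1 e2 e3 e4] := s1 isT; case/andP: (qok) => q1 q2; case/andP: (pok) => p1 p2.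
rewrite /= !coord_vec4 // !bcoord_vec4 //= in e1 e2 e3 e4.
have q1E : q.1 = vec4 a' 0 0 d'.
  rewrite -e1 -e2; apply: vec4_only_first q1 _.
  by move: p1; rewrite /= in_crystal_vec4 e1 e2; lia.
have q2E : q.2 = vec4 a (b + c) 0 d.
  have [b2 q2E'] : exists b2, q.2 = vec4 a b2 0 d.
    exists (coord q.2 2); rewrite -{1}e3 -{1}e4; apply: (vec4_upper_trivial q2) => i hi.
    have im : (i <= m.+1)%N by lia.
    have [_] := teps0 im qok (qe i hi); have := eps_ge0 m2 im q2.
    by rewrite q1E phi_first //; lia.
  rewrite q2E'; congr (vec4 _ _ _ _).
  by move: p2 q2; rewrite q2E' /= !in_crystal_vec4; lia.
by rewrite [q]surjective_pairing q1E q2E in pq.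
Qed.

Lemma unbar_left l k a c d a' d' : in_tensor l k (vec4 a 0 c d, vec4 a' 0 0 d') ->
  conn l k (vec4 a 0 c d, vec4 a' 0 0 d') (vec4 a c 0 d, vec4 a' 0 0 d').
Proof. by move/straighten_left; rewrite add0r. Qed.

Lemma unbar_right l k a c d a' d' : in_tensor l k (vec4 a' 0 0 d', vec4 a 0 c d) ->
  conn l k (vec4 a' 0 0 d', vec4 a 0 c d) (vec4 a' 0 0 d', vec4 a c 0 d).
Proof. by move/straighten_right; rewrite add0r. Qed.

Lemma e0_vec4 t a b c d : let u := Num.max b (c + t) - Num.max b c in
  e_vec 0 t (vec4 a b c d) = vec4 (a - u) (b + u - t) (c + u) (d - u + t).
Proof.
move=> u; apply: vec_eq => k hk.
  rewrite coord_vec4 // coord_mk // /xi !coord_vec4 // !bcoord_vec4 //=.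
  by case: (k == 1%N) => //; case: (k == 2%N).
rewrite bcoord_vec4 // bcoord_mk // /xi !coord_vec4 // !bcoord_vec4 //=.
by case: (k == 1%N) => //; case: (k == 2%N).
Qed.

Lemma e1_vec4 t a b c d : let u := Num.max b (c + t) - Num.max b c in
  e_vec 1 t (vec4 a b c d) = vec4 (a - u + t) (b + u - t) (c + u) (d - u).
Proof.
have m1F : (1%N == m) = false by lia.
move=> u; apply: vec_eq => k hk.
  rewrite coord_vec4 // coord_e // m1F /xi !coord_vec4 // !bcoord_vec4 //=.
  by case: (k == 1%N) => //; case: (k == 2%N).
rewrite bcoord_vec4 // bcoord_e // m1F /xi !coord_vec4 // !bcoord_vec4 //=.
by case: (k == 1%N) => //; case: (k == 2%N).
Qed.

Lemma phi_eps_vec4 a b c d :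
  [/\ phi 0 (vec4 a b c d) = d + posp (c - b),
      eps 0 (vec4 a b c d) = a + posp (b - c),
      phi 1 (vec4 a b c d) = a + posp (c - b) &
      eps 1 (vec4 a b c d) = d + posp (b - c)].
Proof.
have m1F : (1%N == m) = false by lia.
rewrite (phi_node m2 one_in) (eps_node m2 one_in) m1F /phi /eps /=.
by rewrite !coord_vec4 // !bcoord_vec4.
Qed.

Lemma conn_e0 l k t a b c d a' b' c' d' A B C D A' B' C' D' :
  let f := d + posp (c - b) in let g := a' + posp (b' - c') in
  let t1 := Num.max (t + f) g - Num.max f g in
  let t2 := Num.max f g - Num.max f (- t + g) in
  let u := Num.max b (c + t1) - Num.max b c in
  let u' := Num.max b' (c' + t2) - Num.max b' c' in
  in_tensor l k (vec4 a b c d, vec4 a' b' c' d') ->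
  in_tensor l k (vec4 A B C D, vec4 A' B' C' D') ->
  [/\ A = a - u, B = b + u - t1, C = c + u & D = d - u + t1] ->
  [/\ A' = a' - u', B' = b' + u' - t2, C' = c' + u' & D' = d' - u' + t2] ->
  conn l k (vec4 a b c d, vec4 a' b' c' d') (vec4 A B C D, vec4 A' B' C' D').
Proof.
move=> f g t1 t2 u u' pok qok [hA hB hC hD] [hA' hB' hC' hD'].
have [f0 _ _ _] := phi_eps_vec4 a b c d.
have [_ g0 _ _] := phi_eps_vec4 a' b' c' d'.
have e : (vec4 A B C D, vec4 A' B' C' D')
    = tstep 0 t (vec4 a b c d, vec4 a' b' c' d').
  rewrite /tstep /tc1 /tc2 /= f0 g0 !e0_vec4.
  by rewrite hA hB hC hD hA' hB' hC' hD'.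
by rewrite e; apply: conn_step => //; rewrite -e.
Qed.

Lemma conn_e1 l k t a b c d a' b' c' d' A B C D A' B' C' D' :
  let f := a + posp (c - b) in let g := d' + posp (b' - c') in
  let t1 := Num.max (t + f) g - Num.max f g in
  let t2 := Num.max f g - Num.max f (- t + g) in
  let u := Num.max b (c + t1) - Num.max b c in
  let u' := Num.max b' (c' + t2) - Num.max b' c' in
  in_tensor l k (vec4 a b c d, vec4 a' b' c' d') ->
  in_tensor l k (vec4 A B C D, vec4 A' B' C' D') ->
  [/\ A = a - u + t1, B = b + u - t1, C = c + u & D = d - u] ->
  [/\ A' = a' - u' + t2, B' = b' + u' - t2, C' = c' + u' & D' = d' - u'] ->
  conn l k (vec4 a b c d, vec4 a' b' c' d') (vec4 A B C D, vec4 A' B' C' D').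
Proof.
move=> f g t1 t2 u u' pok qok [hA hB hC hD] [hA' hB' hC' hD'].
have [_ _ f0 _] := phi_eps_vec4 a b c d.
have [_ _ _ g0] := phi_eps_vec4 a' b' c' d'.
have e : (vec4 A B C D, vec4 A' B' C' D')
    = tstep 1 t (vec4 a b c d, vec4 a' b' c' d').
  rewrite /tstep /tc1 /tc2 /= f0 g0 !e1_vec4.
  by rewrite hA hB hC hD hA' hB' hC' hD'.
by rewrite e; apply: conn_step => //; rewrite -e.
Qed.

Ltac solve4 := rewrite /posp /in_tensor /= ?in_crystal_vec4; try split; lia.

(** The path: e_1^(d-l) acts on the first factor; e_0^(a+l-d) acts on both; xb_2
is moved to x_2 in the second factor; e_1^a acts on the second factor. *)
Lemma conn_turn l k (a d : int) :
  0 <= a -> 0 <= d -> d <= l%:Z -> a + d = k%:Z ->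
  conn l k (vec4 l%:Z 0 0 0, vec4 a 0 0 d) (vec4 d 0 0 (l%:Z - d), vec4 a 0 0 d).
Proof.
move=> a0 d0 dl ad.
apply: (@conn_trans m l k _ (vec4 d (l%:Z - d) 0 0, vec4 a 0 0 d)).
  by apply: (conn_e1 (t := d - l%:Z)); solve4.
apply: (@conn_trans m l k _ (vec4 d 0 0 (l%:Z - d), vec4 0 0 a d)).
  by apply: (conn_e0 (t := a + (l%:Z - d))); solve4.
apply: (@conn_trans m l k _ (vec4 d 0 0 (l%:Z - d), vec4 0 a 0 d)).
  by apply: unbar_right; solve4.
by apply: (conn_e1 (t := a)); solve4.
Qed.


(** Which factor an operator acts on depends on the comparison of phi and eps, so
the two cases need different paths; star exchanges them. *)
Lemma conn_shift l k (d : int) : 0 <= d -> d <= l%:Z -> d <= k%:Z ->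
  conn l k (vec4 d 0 0 (l%:Z - d), vec4 (k%:Z - d) 0 0 d)
           (vec4 0 0 0 l%:Z, vec4 k%:Z 0 0 0).
Proof.
move=> d0 dl dk; have [kl|lk] := lerP k%:Z l%:Z.
  apply: (@conn_trans m l k _ (vec4 0 0 d (l%:Z - d), vec4 (k%:Z - d) 0 0 d)).
    by apply: (conn_e0 (t := d)); solve4.
  apply: (@conn_trans m l k _ (vec4 0 d 0 (l%:Z - d), vec4 (k%:Z - d) 0 0 d)).
    by apply: unbar_left; solve4.
  apply: (@conn_trans m l k _ (vec4 0 0 0 l%:Z, vec4 (k%:Z - d) 0 0 d)).
    by apply: (conn_e0 (t := d)); solve4.
  apply: (@conn_trans m l k _ (vec4 0 0 0 l%:Z, vec4 (k%:Z - d) 0 d 0)).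
    by apply: (conn_e1 (t := d)); solve4.
  apply: (@conn_trans m l k _ (vec4 0 0 0 l%:Z, vec4 (k%:Z - d) d 0 0)).
    by apply: unbar_right; solve4.
  by apply: (conn_e1 (t := d)); solve4.
apply: (@conn_trans m l k _ (vec4 d 0 0 (l%:Z - d), vec4 (k%:Z - d) d 0 0)).
  by apply: (conn_e0 (t := - d)); solve4.
apply: (@conn_trans m l k _ (vec4 d 0 0 (l%:Z - d), vec4 (k%:Z - d) 0 d 0)).
  apply: (conn_sym m2); apply: unbar_right; solve4.
apply: (@conn_trans m l k _ (vec4 d 0 0 (l%:Z - d), vec4 k%:Z 0 0 0)).
  by apply: (conn_e0 (t := - d)); solve4.
apply: (@conn_trans m l k _ (vec4 0 d 0 (l%:Z - d), vec4 k%:Z 0 0 0)).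
  by apply: (conn_e1 (t := - d)); solve4.
apply: (@conn_trans m l k _ (vec4 0 0 d (l%:Z - d), vec4 k%:Z 0 0 0)).
  apply: (conn_sym m2); apply: unbar_left; solve4.
by apply: (conn_e1 (t := - d)); solve4.
Qed.

(** Raising leads to (l, 0, ..., 0) (x) y where y is highest for the nodes
2, ..., n.  The explicit paths lead from there to an element independent of
y, which can be reached from the pair of highest elements as well. *)
Theorem tensor_connected l k p : in_tensor l k p ->
  conn l k (hw_vec m.+1 l, hw_vec m.+1 k) p.
Proof.
move=> pok; rewrite !hw_vec4; apply: (conn_sym m2).
have [[x y] [qok pq qe _]] := raise m2 (isT : (0 < 1)%N) pok.
apply: (conn_trans pq); case/andP: (qok) => xl yk; rewrite /= in xl yk qe.
have e_x i : (0 < i <= m.+1)%N -> eps i x = 0 /\ eps i y <= phi i x.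
  by move=> hi; apply: (teps0 _ qok (qe i hi)); lia.
have xE : x = vec4 l%:Z 0 0 0.
  have [a [b [d xE]]] : exists a b d, x = vec4 a b 0 d.
    exists (coord x 1), (coord x 2), (bcoord x 1).
    by apply: (vec4_upper_trivial xl) => i hi; apply: (e_x i _).1; lia.
  have [_ _ _ e1] := phi_eps_vec4 a b 0 d.
  have [|e0 _] := e_x 1%N; first by [].
  move: xl e0; rewrite xE e1 in_crystal_vec4 /posp => xl e0.
  by congr (vec4 _ _ _ _); lia.
have [a [b [d yE]]] : exists a b d, y = vec4 a b 0 d.
  exists (coord y 1), (coord y 2), (bcoord y 1).
  apply: (vec4_upper_trivial yk) => i hi.
  have [|_] := e_x i; first by lia.
  have im : (i <= m.+1)%N by lia.
  have := eps_ge0 m2 im yk.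
  by rewrite xE phi_first //; lia.
have [_ _ f1 _] := phi_eps_vec4 l%:Z 0 0 0.
have [_ _ _ g1] := phi_eps_vec4 a b 0 d.
have [|_] := e_x 1%N; first by [].
move: yk; rewrite xE yE f1 g1 in_crystal_vec4 /posp => yk bd.
have [a0 b0 d0 s] : [/\ 0 <= a, 0 <= b, 0 <= d & a + b + d = k%:Z] by split; lia.
apply: (@conn_trans m l k _ (vec4 l%:Z 0 0 0, vec4 a 0 0 (d + b))).
  by apply: (conn_e0 (t := b)); solve4.
apply: (@conn_trans m l k _ (vec4 (d + b) 0 0 (l%:Z - (d + b)), vec4 a 0 0 (d + b))).
  by apply: conn_turn; lia.
have -> : a = k%:Z - (d + b) by lia.
apply: (@conn_trans m l k _ (vec4 0 0 0 l%:Z, vec4 k%:Z 0 0 0)).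
  by apply: conn_shift; lia.
apply: (conn_sym m2); rewrite -{2}[l%:Z]subr0.
by apply: conn_turn; lia.
Qed.

End Paths.

(** * R at the highest elements, and the theorem *)

Lemma max_seqP (s : seq int) a :
  a \in s -> (forall b, b \in s -> b <= a) -> max_seq s = a.
Proof.
move=> sa sb; have s0 : s != [::] by case: s sa {sb}.
have [mem_s ge_s] : max_seq s \in s /\ (forall b, b \in s -> b <= max_seq s).
  elim: s s0 {sa sb} => // b [|c s] IH _.
    by split=> [|d]; rewrite mem_seq1 // => /eqP->.
  have [h1 h2] := IH isT; rewrite max_seq_cons //; split.
    by rewrite in_cons; case: leP => _; rewrite ?eqxx // h1 orbT.
  move=> d; rewrite in_cons le_max => /orP[/eqP->|/h2->]; last by rewrite orbT.
  by rewrite lexx.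
by apply/le_anti; rewrite sb // ge_s.
Qed.

Section Final.
Variable m : nat.
Hypothesis m2 : (2 < m)%N.
Local Notation vec := (Defs.vec m.+1).
Implicit Types (x y : vec) (i j k l : nat) (p q : vec * vec).

Let n_in : (0 < m.+1 <= m.+1)%N. Proof. exact: leqnn. Qed.
Let one_in : (0 < 1 <= m)%N. Proof. exact: ltnW (ltnW m2). Qed.
Let m1F : (m == 0%N) = false. Proof. by lia. Qed.

Lemma sum_first (f : nat -> int) j : (0 < j)%N ->
  (forall k, (1 < k <= j)%N -> f k = 0) -> \sum_(1 <= k < j.+1) f k = f 1%N.
Proof.
move=> j0 f0; rewrite big_ltn // big_nat_cond big1 ?addr0 // => k.
by rewrite andbT => hk; apply: f0.
Qed.

Lemma ell_first (a d : int) : ell (vec4 m a 0 0 d) = a + d.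
Proof.
rewrite /ell !sum_first //; try lia.
- by rewrite coord_vec4 // bcoord_vec4.
- by move=> k hk; rewrite bcoord_vec4; [case: eqP; [lia|case: ifP]|lia].
- by move=> k hk; rewrite coord_vec4; [case: eqP; [lia|case: ifP]|lia].
Qed.

Lemma max_seq_V i x y a :
  (forall j, (0 < j < m)%N -> theta i j x y <= a /\ theta' i j x y <= a) ->
  (forall j, (0 < j <= m.+1)%N -> eta i j x y <= a /\ eta' i j x y <= a) ->
  eta i 1 x y = a \/ eta' i 1 x y = a -> V i x y = a.
Proof.
move=> hth het ea; apply: max_seqP => [|b].
  have mem1 (f : nat -> int) : f 1%N \in [seq f j | j <- index_iota 1 m.+2].
    by apply: map_f; rewrite mem_index_iota.
  rewrite !mem_cat; case: ea => <-.
    by rewrite (mem1 (fun j => eta i j x y)) !orbT.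
  by rewrite (mem1 (fun j => eta' i j x y)) !orbT.
rewrite (_ : m.+1.-1 = m) // !mem_cat => /or4P[] /mapP[j];
  rewrite mem_index_iota => hj ->.
- exact: (hth j hj).1.
- exact: (hth j hj).2.
- exact: (het j hj).1.
- exact: (het j hj).2.
Qed.

(** The two cases are those needed for the highest elements: the first one for
V_i and, up to symmetry, for its image by star, the second one for V_0 after
the exchange of x_1 and xb_1. *)
Lemma V_first a d a' d' i : (i <= m)%N ->
  let x := vec4 m a 0 0 d in let y := vec4 m a' 0 0 d' in
  0 <= a -> 0 <= d -> 0 <= a' -> 0 <= d' ->
  (d = 0 /\ d' = 0) \/ (i = 0%N /\ a = 0 /\ a' = 0) ->
  V i x y = a + d + a' + d'.
Proof.
move=> im x y a0 d0 a0' d0' cases.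
have [lx ly] : ell x = a + d /\ ell y = a' + d' by rewrite !ell_first.
have cc z t j : (0 < j <= m.+1)%N ->
    coord (vec4 m z 0 0 t) j = if j == 1%N then z else 0.
  by move=> hj; rewrite coord_vec4 //; case: ifP => // _; case: ifP.
have bb z t j : (0 < j <= m)%N ->
    bcoord (vec4 m z 0 0 t) j = if j == 1%N then t else 0.
  by move=> hj; rewrite bcoord_vec4 //; case: ifP => // _; case: ifP.
have cS j : (0 < j <= m)%N ->
    \sum_(1 <= r < j.+1) (coord y r - coord x r) = a' - a.
  move=> hj; rewrite sum_first ?cc //; [lia|move=> r hr].
  by rewrite !cc; try lia; rewrite gtn_eqF //; lia.
have bS z t z' t' j : (j <= m)%N -> \sum_(1 <= r < j.+1)
    (bcoord (vec4 m z 0 0 t) r - bcoord (vec4 m z' 0 0 t') r)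
    = if j == 0%N then 0 else t - t'.
  move=> hj; case: eqP => [->|j0]; first by rewrite big_nil.
  rewrite sum_first ?bb //; [lia|move=> r hr].
  by rewrite !bb; try lia; rewrite gtn_eqF //; lia.
have xn : coord x m.+1 = 0 by rewrite cc // gtn_eqF // ltnS (andP one_in).2.
have thB j : (0 < j <= m)%N -> theta i j x y =
    if (j <= i)%N then a + d else if i == 0%N then a' + d else a' + d'.
  move=> hj; rewrite /theta lx ly; case: leqP => ji; rewrite sum_tail ?bS; try lia.
    by case: eqP => [|_]; [lia|case: eqP => [|_]; [lia|ring]].
  by case: eqP => [|_]; [lia|case: eqP => _; ring].
have th'B j : (0 < j <= m)%N -> theta' i j x y =
    if i == 0%N then a' + d else a' + d'.
  move=> hj; rewrite /theta' lx cS // bS //; case: eqP => _; ring.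
have etaE j : (0 < j <= m)%N -> eta i j x y =
    theta i j x y + (bcoord y j - coord x j).
  move=> hj; rewrite /eta /theta (_ : (j == m.+1) = false); last by lia.
  by case: ifP.
have eta'E j : (0 < j <= m)%N -> eta' i j x y =
    theta' i j x y + (coord x j - bcoord y j).
  by move=> hj; rewrite /eta' /theta' (_ : (j == m.+1) = false) //; lia.
have etan : eta i m.+1 x y = if i == 0%N then a' + d else a' + d'.
  rewrite /eta eqxx sum_tail // !bS // xn ly (gtn_eqF (andP one_in).2).
  by case: eqP => _; ring.
have eta'n : eta' i m.+1 x y <= a + d + a' + d'.
  rewrite /eta' eqxx bS // cS ?xn ?lx ?ly; last by lia.
  by case: ifP => /eqP e1; case: eqP => e2; lia.
apply: max_seq_V.
- move=> j hj; rewrite thB ?th'B; try lia.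
  by split; do 2?case: ifP; lia.
- move=> j hj; have [->|jn] := eqVneq j m.+1; first by split=> //; rewrite etan; case: eqP; lia.
  have hj' : (0 < j <= m)%N by lia.
  rewrite etaE // eta'E // thB // th'B // cc // bb //.
  by split; do 4?case: ifP; lia.
rewrite etaE // eta'E // thB // th'B // cc // bb //=.
by case: cases => [[-> ->]|[-> [-> ->]]] /=; [right; case: eqP|left]; lia.
Qed.

Lemma bar_swap_first a d : bar_swap (vec4 m a 0 0 d) = vec4 m d 0 0 a.
Proof.
apply: vec_eq => k hk.
  rewrite coord_bar // !coord_vec4 //; have [->|kn] := eqVneq k m.+1.
    have [-> ->] : (m.+1 == 1%N) = false /\ (m.+1 == 2%N) = false by lia.
    by [].
  by rewrite bcoord_vec4 //; lia.
by rewrite bcoord_bar // bcoord_vec4 // coord_vec4 //; lia.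
Qed.

Lemma swap1_first a d : swap1 (vec4 m a 0 0 d) = vec4 m d 0 0 a.
Proof.
apply: vec_eq => k hk.
  rewrite coord_swap1 // !coord_vec4 // bcoord_vec4 //.
  by case: (k == 1%N).
rewrite bcoord_swap1 // !bcoord_vec4 // coord_vec4 //.
by case: (k == 1%N).
Qed.

Lemma R_hw l k :
  R_fst (hw_vec m.+1 l) (hw_vec m.+1 k) = hw_vec m.+1 k
  /\ R_snd (hw_vec m.+1 l) (hw_vec m.+1 k) = hw_vec m.+1 l.
Proof.
rewrite !hw_vec4; set x := vec4 m l%:Z 0 0 0; set y := vec4 m k%:Z 0 0 0.
pose s : int := l%:Z + k%:Z.
have v i : (i <= m)%N -> V i x y = s.
  by move=> im; rewrite V_first // ?addr0 //; left.
have v0s : sigma1 (V 0) x y = s.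
  by rewrite /sigma1 !swap1_first V_first //; [rewrite add0r addr0|right].
have vs i : (i <= m)%N -> star (V i) x y = s.
  have [->|i0] := posnP i; first by rewrite V0_star ?v.
  move=> im; rewrite /star !bar_swap_first -[V i _ _](V_swap1 m2) ?i0 //.
  rewrite !swap1_first V_first //; last by left.
  by rewrite !addr0 addrC.
have w i : (0 < i <= m)%N -> W i x y = s + s.
  move=> hi; rewrite /W v // v0s v ?vs; try lia.
  case: eqP => // i1; case: eqP => // im.
  rewrite !v ?vs; try lia.
  rewrite !coord_vec4 ?bcoord_vec4; try lia.
  by case: eqP => // _; case: eqP; lia.
have n1F : (m.+1 == 1%N) = false by lia.
split; apply: vec_eq => j hj.
- rewrite coord_R_fst //; case: eqP => [->|j1]; first by rewrite v0s v // addrK.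
  case: eqP => [->|jn]; first by rewrite v // vs // addrK.
  by rewrite !v ?w; try lia; ring.
- rewrite bcoord_R_fst //; case: eqP => [->|j1]; first by rewrite !v // addrK.
  by rewrite !v ?addrK //; lia.
- rewrite coord_R_snd //; case: eqP => [->|j1]; first by rewrite v // vs // addrK.
  case: eqP => [->|jn]; first by rewrite v // vs // addrK.
  by rewrite !vs ?addrK //; lia.
rewrite bcoord_R_snd //; case: eqP => [->|j1]; first by rewrite v0s vs // addrK.
by rewrite !vs ?w; try lia; ring.
Qed.

Definition Rv p : vec * vec := (R_fst p.1 p.2, R_snd p.1 p.2).

Lemma Rv_tstep i c p : (i <= m.+1)%N -> Rv (tstep i c p) = tstep i c (Rv p).
Proof.
move=> im; have [e1 e2] := R_commutes_vec m2 c p.1 p.2 im.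
by rewrite /Rv /tstep /= e1 e2.
Qed.

Lemma in_tensor_tstep_Rv l k i c p : (i <= m.+1)%N -> in_tensor l k p -> in_tensor k l (Rv p) ->
  in_tensor k l (tstep i c (Rv p)) = in_tensor l k (tstep i c p).
Proof.
move=> im pok Rok; rewrite (in_tensor_tstep m2 _ im pok) (in_tensor_tstep m2 _ im Rok).
by have [-> ->] := R_string m2 p.1 p.2 im.
Qed.

Lemma Rv_hw l k :
  Rv (hw_vec m.+1 l, hw_vec m.+1 k) = (hw_vec m.+1 k, hw_vec m.+1 l).
Proof. by have [e1 e2] := R_hw l k; rewrite /Rv /= e1 e2. Qed.

Lemma in_tensor_hw l k : in_tensor l k (hw_vec m.+1 l, hw_vec m.+1 k).
Proof. by rewrite /in_tensor !hw_vec_in_crystal. Qed.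

Lemma tensor_ind l k (P : vec * vec -> Prop) :
  (forall r i c, (i <= m.+1)%N -> in_tensor l k r -> in_tensor l k (tstep i c r) ->
     P r -> P (tstep i c r)) ->
  P (hw_vec m.+1 l, hw_vec m.+1 k) -> forall p, in_tensor l k p -> P p.
Proof. by move=> hP P0 p /(tensor_connected m2)/(_ P hP P0). Qed.

Lemma Rv_in l k p : in_tensor l k p -> in_tensor k l (Rv p).
Proof.
move: p; apply: tensor_ind.
  by move=> r i c im rok sok Rok; rewrite Rv_tstep // (in_tensor_tstep_Rv _ im rok Rok).
by rewrite Rv_hw in_tensor_hw.
Qed.

Lemma RvK l k p : in_tensor l k p -> Rv (Rv p) = p.
Proof.
move: p; apply: tensor_ind.
  by move=> r i c im rok sok RR; rewrite !Rv_tstep // RR.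
by rewrite !Rv_hw.
Qed.

Definition R_tensor l k (p : tensor m.+1 l k) : tensor m.+1 k l :=
  let h := andP (Rv_in (tval_in p)) in (Sub _ h.1, Sub _ h.2).

Lemma tval_R l k (p : tensor m.+1 l k) : tval (R_tensor p) = Rv (tval p).
Proof. by rewrite /tval !SubK. Qed.

Lemma R_tensorK l k : cancel (@R_tensor l k) (@R_tensor k l).
Proof.
by move=> p; apply: (@tval_inj m); rewrite !tval_R (RvK (tval_in p)).
Qed.

Lemma R_tensor_commutes l k : R_commutes (@R_tensor l k).
Proof.
move=> i c p im; case pE: (e_tensor i c p) => [q|] /=.
  apply/(e_tensor_SomeP i c); rewrite !tval_R -Rv_tstep //.
  by rewrite ((e_tensor_SomeP i c p q).1 pE).
apply/(e_tensor_NoneP i c); rewrite tval_R.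
rewrite (in_tensor_tstep_Rv c im (tval_in p)) ?(Rv_in (tval_in p)) //.
exact: (e_tensor_NoneP i c p).1 pE.
Qed.

Lemma R_tensor_normalized l k : R_normalized (@R_tensor l k).
Proof.
move=> p e1 e2; rewrite !SubK /Rv /= e1 e2.
exact: R_hw.
Qed.

(** The set where both maps agree contains the pair of highest elements and is
stable under the arrows. *)
Lemma R_tensor_unique l k (R' : tensor m.+1 l k -> tensor m.+1 k l) :
  R_normalized R' -> R_intertwines R' -> R' =1 @R_tensor l k.
Proof.
move=> nR' iR' p; apply: (@tval_inj m); rewrite tval_R.
pose P (r : vec * vec) :=
  forall p : tensor m.+1 l k, tval p = r -> tval (R' p) = Rv r.
suff : P (tval p) by apply.
apply: tensor_ind (tval_in p).
  move=> r i c im /andP[r1 r2] sok Pr q qE.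
  pose s : tensor m.+1 l k := (Sub _ r1, Sub _ r2).
  have sE : tval s = r by rewrite /tval !SubK -surjective_pairing.
  have eE : e_tensor i c s = Some q by apply/(e_tensor_SomeP i c); rewrite sE.
  have := (e_tensor_SomeP i c _ _).1 (iR' i c s q im eE).
  by rewrite (Pr s sE) -Rv_tstep.
move=> q qE; have [e1 e2] : val q.1 = hw_vec m.+1 l /\ val q.2 = hw_vec m.+1 k.
  by case: qE.
by have [f1 f2] := nR' q e1 e2; rewrite Rv_hw /tval f1 f2.
Qed.

End Final.

Theorem theorem4p28 (n l1 l2 : nat) (hn : (4 <= n)%N)
    (hl1 : (0 < l1)%N) (hl2 : (0 < l2)%N) :
  exists R : tensor n l1 l2 -> tensor n l2 l1,
    (forall (x : crystal n l1) (y : crystal n l2),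
        val (R (x, y)).1 = R_fst (val x) (val y) /\
        val (R (x, y)).2 = R_snd (val x) (val y)) /\
    is_combinatorial_R R.
Proof.
case: n hn => // m m2; exists (@R_tensor m m2 l1 l2); split.
  move=> x y; have RE := tval_R m2 (x, y).
  by split; [exact: (congr1 fst RE)|exact: (congr1 snd RE)].
split.
- by exists (@R_tensor m m2 l2 l1); apply: R_tensorK.
- exact: R_tensor_commutes.
- exact: R_tensor_normalized.
- exact: R_tensor_unique.
Qed.
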